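(* Let $(X,\bar 0)\subset(\mathbb{C}^{n+1},\bar 0)$ be a hypersurface germ and let $\pi:\mathbb{C}^{n+1}\to\mathbb{C}^n$ be a linear projection such that $\pi|_{(X,\bar 0)}$ is finite. Let $L$ be a (projective) line in $\mathbb{CP}^n$ containing the projection direction $p_\pi$. Assume that the intersection (with reduced structure) of $L$ and the tangent cone $C_{X,\bar 0}$ in $\mathbb{CP}^n$ is a union of isolated points. Consider any arc in $(\mathbb{C}^n,\bar 0)$ whose tangent at the origin is in the direction given by $L$, i.e. is the point $\overline{\pi}(L\setminus\{p_\pi\})\in\mathbb{CP}^{n-1}$. Then the reduced tangent cone (in $\mathbb{CP}^n$) of the corresponding arc-section is $C_{X,\bar 0}\cap L$. In particular, if $C_{X,\bar 0}\cap L$ consists of $2$ or more different points, then the arc-section is reducible.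
   Context: Finiteness of $\pi|_{(X,\bar 0)}$ means $\pi^{-1}(\bar 0)\cap X=\{\bar 0\}$ as germs. $C_{X,\bar 0}\subset\mathbb{CP}^n$ is the projectivized tangent cone of $(X,\bar 0)$. $p_\pi\in\mathbb{CP}^n$ is the point corresponding to the line $\ker\pi\subset\mathbb{C}^{n+1}$, and $\overline{\pi}:\mathbb{CP}^n\setminus\{p_\pi\}\to\mathbb{CP}^{n-1}$ is the projection from $p_\pi$ induced by $\pi$; for a line $L\ni p_\pi$, $\overline{\pi}(L\setminus\{p_\pi\})$ is a single point. After a linear change of coordinates, $\pi(x_1,\dots,x_{n+1})=(x_1,\dots,x_n)$ and $X=\{F=0\}$ with $F$ a reduced Weierstrass polynomial in $x_{n+1}$; the discriminant $\Delta$ of $\pi|_X$ is the zero set of the discriminant of $F$ with respect to $x_{n+1}$. An arc is a holomorphic map germ $\alpha:(\mathbb{C},0)\to(\mathbb{C}^n,\bar 0)$ with an injective representative; its tangent at the origin is the tangent line of its image (the limit of the secants through $\bar 0$), viewed in $\mathbb{CP}^{n-1}$. The corresponding arc-section is $\pi^{-1}(\alpha(\mathbb{D}))\cap X$ where $\alpha:\mathbb{D}\to\mathbb{C}^n$ is an injective representative on a sufficiently small closed disk centered at $0$, such that either $\alpha(\mathbb{D})\subset\Delta$ or $\alpha(\mathbb{D})\cap\Delta=\{\bar 0\}$. Reducible means that its germ at $\bar 0$, with reduced structure, is reducible. *)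

(* Defs.v *)
From HB Require Import structures.
From mathcomp Require Import all_boot all_order all_algebra.
From mathcomp Require Import all_classical all_reals all_analysis.
From mathcomp Require Export complex.

Set Implicit Arguments.
Unset Strict Implicit.
Unset Printing Implicit Defensive.

Import Order.TTheory GRing.Theory Num.Theory numFieldNormedType.Exports.

Local Open Scope classical_set_scope.
Local Open Scope ring_scope.
Local Open Scope complex_scope.

(* The field of complex numbers over R, packed so that the topology that
   mathcomp-analysis puts on every numClosedFieldType applies to it. *)
Definition Cplx (R : realType) : numClosedFieldType := R[i].

(* P(C^k): points are the one-dimensional linear subspaces of C^k, so that
   CP^n is [projC R n.+1] and CP^(n-1) is [projC R n]. *)
Definition projC (R : realType) (k : nat) : Type :=
  {l : {vspace 'cV[Cplx R]_k} | \dim l == 1%N}.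

HB.instance Definition _ (R : realType) (k : nat) :=
  Choice.copy (projC R k) {l : {vspace 'cV[Cplx R]_k} | \dim l == 1%N}.
HB.instance Definition _ (R : realType) (k : nat) :=
  SubChoice.copy (projC R k) {l : {vspace 'cV[Cplx R]_k} | \dim l == 1%N}.

Section ProjTopology.
Variables (R : realType) (k : nat).
Local Notation V := 'cV[Cplx R]_k.
Implicit Types (l m : projC R k) (U W : set (projC R k)).

(* The quotient topology of C^k \ {0}: since v |-> <[v]> is open there, the
   neighbourhoods of a line are the images of those of any of its generators. *)
Definition proj_nbhs l : set_system (projC R k) :=
  [set U | \forall v \near vpick (\val l), forall m, \val m = <[v]>%VS -> U m].

Lemma vpick_neq0 l : vpick (\val l) != 0.
Proof. by rewrite vpick0 -dimv_eq0 (eqP (valP l)). Qed.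

Lemma proj_vpickE l : \val l = <[vpick (\val l)]>%VS.
Proof.
apply/esym/eqP; rewrite eqEdim -memvE memv_pick /=.
by rewrite dim_vline vpick_neq0 (eqP (valP l)).
Qed.

Lemma proj_nbhs_filter l : ProperFilter (proj_nbhs l).
Proof.
apply: Build_ProperFilter_ex => [U lU|].
  by exists l; exact: (nbhs_singleton lU _ (proj_vpickE l)).
pose F := nbhs (vpick (\val l) : V).
split=> [|U W lU lW|U W UW lU].
- by apply: (@filterS _ F _ _ _ _ filterT) => v _ m _.
- apply: (@filterS _ F _ _ _ _ (filterI (lU : F _) lW)) => v [vU vW] m mv.
  by split; [exact: vU|exact: vW].
- by apply: (@filterS _ F _ _ _ _ lU) => v vU m mv; apply: UW; exact: vU.
Qed.

Lemma proj_nbhs_singleton l U : proj_nbhs l U -> U l.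
Proof. by move=> lU; exact: (nbhs_singleton lU _ (proj_vpickE l)). Qed.

Lemma proj_nbhs_nbhs l U : proj_nbhs l U -> proj_nbhs l (proj_nbhs^~ U).
Proof.
move=> lU; apply: (filterS _ (nbhs_interior lU)) => v vU m mv.
have: vpick (\val m) \in <[v]>%VS by rewrite -mv memv_pick.
case/vlineP => c uE.
have c0 : c != 0.
  by apply: contraNneq (vpick_neq0 m) => c0; rewrite uE c0 scale0r.
have vE : v = c^-1 *: vpick (\val m) by rewrite uE scalerA mulVf // scale1r.
have cvgu : (fun w : V => c^-1 *: w) @ vpick (\val m) --> v.
  by rewrite [v in _ --> v]vE; exact: (@scaler_continuous (Cplx R) V c^-1).
apply: (@filterS _ (nbhs (vpick (\val m) : V)) _ _ _ _ (cvgu _ vU)).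
move=> w wU m' m'w; apply: wU; rewrite m'w.
apply/eqP; rewrite eqEsubv -!memvE memvZ ?memv_line // andbT.
by apply/vlineP; exists c; rewrite scalerA mulfV // scale1r.
Qed.

End ProjTopology.

HB.instance Definition _ (R : realType) (k : nat) :=
  hasNbhs.Build (projC R k) (@proj_nbhs R k).
HB.instance Definition _ (R : realType) (k : nat) :=
  Nbhs_isNbhsTopological.Build (projC R k) (@proj_nbhs_filter R k)
    (@proj_nbhs_singleton R k) (@proj_nbhs_nbhs R k).

Section Germs.
Variable R : realType.
Local Notation C := (Cplx R).

(* [f] is, on the open polydisc of radius [rho], the sum of a power series
   whose coefficients satisfy Cauchy's estimates there (so that the series
   converges absolutely and the shape of the partial sums is immaterial). The
   norm of ['cV_k] is the sup norm. *)
Definition holo_on k (rho : R) (f : 'cV[C]_k -> C) : Prop :=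
  exists c : {ffun 'I_k -> nat} -> C,
    (exists M : R, forall a, `|c a| * rho%:C ^+ (\sum_i a i) <= M%:C :> C) /\
    (forall x : 'cV[C]_k, `|x| < rho%:C ->
      (fun N : nat => \sum_(a : {ffun 'I_k -> 'I_N})
         c [ffun i => val (a i)] * \prod_i x i 0 ^+ a i) @ \oo --> f x).

Definition holo_germ k (f : 'cV[C]_k -> C) : Prop :=
  exists2 rho : R, 0 < rho & holo_on rho f.

Definition analytic_germ k (S : set 'cV[C]_k) : Prop :=
  exists m (f : 'I_m -> 'cV[C]_k -> C), (forall i, holo_germ (f i)) /\
    \forall x \near (0 : 'cV[C]_k), S x <-> forall i, f i x = 0.

Definition hypersurface_germ k (X : set 'cV[C]_k) : Prop :=
  exists f : 'cV[C]_k -> C,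
    [/\ holo_germ f, f 0 = 0, ~ (\forall x \near (0 : 'cV[C]_k), f x = 0) &
        \forall x \near (0 : 'cV[C]_k), X x <-> f x = 0].

Definition reducible_germ k (S : set 'cV[C]_k) : Prop :=
  exists S1 S2 : set 'cV[C]_k,
    [/\ analytic_germ S1, analytic_germ S2,
        \forall x \near (0 : 'cV[C]_k), S x <-> S1 x \/ S2 x,
        ~ (\forall x \near (0 : 'cV[C]_k), S1 x <-> S x) &
        ~ (\forall x \near (0 : 'cV[C]_k), S2 x <-> S x)].

(* The underlying set of the projectivized tangent cone at the origin: limits
   in P(C^k) of secant lines through 0. *)
Definition tangent_cone k (S : set 'cV[C]_k) : set (projC R k) :=
  [set l | exists (x_ : nat -> 'cV[C]_k) (l_ : nat -> projC R k),
    [/\ forall j, S (x_ j), forall j, \val (l_ j) = <[x_ j]>%VS,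
        x_ @ \oo --> (0 : 'cV[C]_k) & l_ @ \oo --> l]].

Definition proj_line k (L : {vspace 'cV[C]_k}) : set (projC R k) :=
  [set l | (\val l <= L)%VS].

Definition finite_germ n (X : set 'cV[C]_n.+1)
    (p : 'Hom('cV[C]_n.+1, 'cV[C]_n)) : Prop :=
  \forall x \near (0 : 'cV[C]_n.+1), X x /\ p x = 0 <-> x = 0.

(* The image of [L] minus the point [lker p] under the projection from that
   point, which sends a line [l] to the line [p @: l]. *)
Definition proj_image n (p : 'Hom('cV[C]_n.+1, 'cV[C]_n))
    (L : {vspace 'cV[C]_n.+1}) : set (projC R n) :=
  [set t | exists l : projC R n.+1,
    [/\ proj_line L l, \val l != lker p & \val t = (p @: \val l)%VS]].

(* Germs at 0 of families of polynomials, i.e. elements of O_n[s]. *)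
Definition holo_poly n (G : 'cV[C]_n -> {poly C}) : Prop :=
  (exists N : nat, forall y, (size (G y) <= N)%N) /\
  (forall i, holo_germ (fun y => (G y)`_i)).

(* No square of a non-unit of O_n[s] divides [F]. As [F] is monic in the use
   below, a factor is a unit iff it has degree 0. *)
Definition reduced_poly n (F : 'cV[C]_n -> {poly C}) : Prop :=
  forall G H : 'cV[C]_n -> {poly C}, holo_poly G -> holo_poly H ->
    (\forall y \near (0 : 'cV[C]_n), F y = G y ^+ 2 * H y) ->
    \forall y \near (0 : 'cV[C]_n), size (G y) = 1%N.

(* [x |-> (p x, h x)] are linear coordinates on C^(n+1), in which [X] is the
   zero set of the reduced Weierstrass polynomial [F] of degree [d]. *)
Definition weierstrass_equation n (X : set 'cV[C]_n.+1)
    (p : 'Hom('cV[C]_n.+1, 'cV[C]_n)) (h : 'Hom('cV[C]_n.+1, C^o))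
    (rho : R) (d : nat) (F : 'cV[C]_n -> {poly C}) : Prop :=
  [/\ forall x, p x = 0 -> h x = 0 -> x = 0,
      forall y, F y \is monic /\ size (F y) = d.+1,
      F 0 = 'X^d /\ (forall i, holo_on rho (fun y => (F y)`_i)),
      reduced_poly F &
      \forall x \near (0 : 'cV[C]_n.+1), X x <-> root (F (p x)) (h x)].

(* The zero set of the discriminant of [F], i.e. up to sign the resultant of
   [F] and its derivative. It does not depend on the choice of [h], nor, by
   uniqueness of power series expansions, on that of [F]. *)
Definition discriminant n (X : set 'cV[C]_n.+1)
    (p : 'Hom('cV[C]_n.+1, 'cV[C]_n)) : set 'cV[C]_n :=
  [set y | exists h rho d F, [/\ `|y| < rho%:C,
     weierstrass_equation X p h rho d F & resultant (F y) (F y)^`() = 0]].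

Definition disk (r : R) : set C := [set t | `|t| <= r%:C].

(* [alpha] is holomorphic near the closed disk of radius [r] and injective on
   it; outside a neighbourhood of the disk its values are irrelevant. *)
Definition arc_representative n (alpha : C -> 'cV[C]_n) (r : R) : Prop :=
  (exists2 rho : R, r < rho & exists a : nat -> 'cV[C]_n,
     forall t : C, `|t| < rho%:C ->
       series (fun j => t ^+ j *: a j) @ \oo --> alpha t) /\
  (forall s t, disk r s -> disk r t -> alpha s = alpha t -> s = t).

Definition is_arc n (alpha : C -> 'cV[C]_n) : Prop :=
  alpha 0 = 0 /\ exists2 r : R, 0 < r & arc_representative alpha r.

(* The disks over which arc-sections are taken. When [X] is smooth and
   transverse to the projection the discriminant is empty, hence the inclusion
   instead of an equality in the second case. *)
Definition arc_disk n (X : set 'cV[C]_n.+1)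
    (p : 'Hom('cV[C]_n.+1, 'cV[C]_n)) (alpha : C -> 'cV[C]_n) (r : R) : Prop :=
  [/\ 0 < r, arc_representative alpha r &
      alpha @` disk r `<=` discriminant X p \/
      alpha @` disk r `&` discriminant X p `<=` [set 0]].

Definition arc_section n (X : set 'cV[C]_n.+1)
    (p : 'Hom('cV[C]_n.+1, 'cV[C]_n)) (alpha : C -> 'cV[C]_n) (r : R) :
    set 'cV[C]_n.+1 :=
  p @^-1` (alpha @` disk r) `&` X.

End Germs.

(* Main.v *)
(* Reparametrize the arc as gam, with a coordinate equal to s ^+ k. If psi is the
   initial form of an equation f of X, the isolatedness hypothesis says that psi
   is not identically zero on L. A point of the cone of X on L is a zero of psi;
   in the chart (s, w), w = s ^+ k * z, of the surface swept by the lines parallel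
   to ker p through the arc, f has initial form psi (v + z *: u), with an isolated
   zero at z = 0. Convergent Hensel lifting of this factorization produces points
   of the arc-section with secants tending to the given line. The same lifting
   writes f as a product whose factors cut out the branches tangent to that line
   and the other ones; their images in the space of dimension n + 1 are analytic,
   by taking norms over s |-> s ^+ k, and they are proper when the cone has a
   second point on L. *)
Require Import Defs.
From mathcomp Require Import all_boot all_order all_algebra.
From mathcomp Require Import all_classical all_reals all_analysis.
From mathcomp Require Import perm ring lra zify.

Set Implicit Arguments.
Unset Strict Implicit.
Unset Printing Implicit Defensive.

Import Order.TTheory GRing.Theory Num.Theory numFieldNormedType.Exports.

Local Open Scope classical_set_scope.
Local Open Scope ring_scope.
Local Open Scope complex_scope.

(** * Real-valued norms *)

(** Lifting takes place in C[z][[s]], where z ^+ m and the cofactor of the initial form are coprime.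
    A series in s whose coefficients are polynomials in z is a convergent germ in (s, w) only if the
    degrees in z grow slowly enough and the coefficients grow at most geometrically; the degree
    bound and the majorant of the quadratic recursion are what bring the factors back. A coordinate
    of the arc is made equal to s ^+ k because a branch given in (s, w) is not given by functions of
    the point x: s is known from x only up to a k-th root of unity. As s ^+ k is linear in x, s is
    integral over the germs in x, and norms exist. The kernel direction has infinite slope z in the
    first chart. There the roles are exchanged: the height is s ^+ k and the parameter of the arc
    becomes the unknown. *)

Lemma half01 (R : realType) : 0 <= (2^-1 : R) < 1.
Proof. by rewrite invr_ge0 ler0n invf_lt1 ?ltr1n. Qed.

Lemma finite_min (R : realType) (I : finType) (P : I -> R -> Prop) :
  (forall i d d', 0 < d' <= d -> P i d -> P i d') ->
  (forall i, exists2 d, 0 < d & P i d) -> exists2 d, 0 < d & forall i, P i d.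
Proof.
move=> Ple h; have /choice[d dP] i : exists d, 0 < d /\ P i d by have [d d0] := h i; exists d.
have d0 : 0 < \big[Num.min/1]_i d i.
  by elim/big_ind: _ => // [a b a0 b0|i _]; [rewrite lt_min a0 | have [] := dP i].
exists (\big[Num.min/1]_i d i) => // i; have [_] := dP i; apply: Ple.
by rewrite d0; exact: bigmin_le.
Qed.

Section RealNorm.
Variable R : realType.
Local Notation C := (Cplx R).

(** Norms take values in [Cplx R], which is only partially ordered; the real part brings all
    estimates into the ordered field [R]. *)
Definition rn (V : normedZmodType C) (x : V) : R := complex.Re (`|x| : R[i]).

Lemma rnE (V : normedZmodType C) (x : V) : `|x| = (rn x)%:C :> C.
Proof.
by rewrite /rn; apply/esym/RRe_real; rewrite ger0_real ?normr_ge0.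
Qed.

Lemma rn_le (V : normedZmodType C) (x : V) (a : R) :
  (`|x| <= a%:C :> C) = (rn x <= a).
Proof. by rewrite rnE; exact: lecR. Qed.

Lemma rn_lt (V : normedZmodType C) (x : V) (a : R) :
  (`|x| < a%:C :> C) = (rn x < a).
Proof. by rewrite rnE; exact: ltcR. Qed.

Lemma rcD (a b : R) : ((a + b)%:C = a%:C + b%:C :> C). Proof. exact: rmorphD. Qed.
Lemma rcM (a b : R) : ((a * b)%:C = a%:C * b%:C :> C). Proof. exact: rmorphM. Qed.
Lemma rcX (a : R) n : ((a ^+ n)%:C = a%:C ^+ n :> C). Proof. exact: rmorphXn. Qed.
Lemma rc_inj (a b : R) : (a%:C = b%:C :> C) -> a = b. Proof. by case. Qed.

Lemma rn_ge0 (V : normedZmodType C) (x : V) : 0 <= rn x.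
Proof. by rewrite -lecR -rnE; exact: normr_ge0. Qed.

Lemma rnD (V : normedZmodType C) (x y : V) : rn (x + y) <= rn x + rn y.
Proof. by rewrite -lecR rcD -!rnE; exact: ler_normD. Qed.

Lemma rnN (V : normedZmodType C) (x : V) : rn (- x) = rn x.
Proof. by rewrite /rn normrN. Qed.

Lemma rn0 (V : normedZmodType C) : rn (0 : V) = 0.
Proof. by rewrite /rn normr0. Qed.

Lemma rn_eq0 (V : normedZmodType C) (x : V) : (rn x == 0) = (x == 0).
Proof.
apply/eqP/eqP => [x0|->]; last exact: rn0.
by apply/eqP; rewrite -normr_eq0 rnE x0.
Qed.

Lemma rn_gt0 (V : normedZmodType C) (x : V) : (0 < rn x) = (x != 0).
Proof. by rewrite lt_def rn_ge0 rn_eq0 andbT. Qed.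

Lemma rn_le0 (V : normedZmodType C) (x : V) : rn x <= 0 -> x = 0.
Proof. by move=> h; apply/eqP; rewrite -rn_eq0 eq_le h rn_ge0. Qed.

Lemma rn_eq0_eps (V : normedZmodType C) (x : V) :
  (forall e : R, 0 < e -> rn x <= e) -> x = 0.
Proof. by move=> h; apply: rn_le0; apply/ler_addgt0Pr => e e0; rewrite add0r h. Qed.

Lemma lerX_rn (V : normedZmodType C) (x : V) (a : R) n : rn x <= a -> rn x ^+ n <= a ^+ n.
Proof.
by move=> xa; apply: lerXn2r; rewrite ?nnegrE ?rn_ge0 // (le_trans _ xa) ?rn_ge0.
Qed.

(** Turns an error of order K + 1 in t into an arbitrarily small multiple of order K; dividing by Q
    + 1 instead of Q allows Q = 0. *)
Lemma rn_absorb (V : normedZmodType C) (x : V) (Q e : R) :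
  0 < Q + 1 -> rn x < e / (Q + 1) -> Q * rn x <= e.
Proof.
move=> Q1 xe; apply: (@le_trans _ _ ((Q + 1) * rn x)).
  by apply: ler_wpM2r; rewrite ?rn_ge0 // lerDl.
by rewrite mulrC -ler_pdivlMr // ltW.
Qed.

Lemma rnB (V : normedZmodType C) (x y : V) : rn (x - y) <= rn x + rn y.
Proof. by rewrite -(rnN y); exact: rnD. Qed.

Lemma rnBC (V : normedZmodType C) (x y : V) : rn (x - y) = rn (y - x).
Proof. by rewrite -rnN opprB. Qed.

Lemma rn_tri (V : normedZmodType C) (y x z : V) :
  rn (x - z) <= rn (x - y) + rn (y - z).
Proof. by apply: le_trans (rnD _ _); rewrite addrA subrK. Qed.

Lemma rn_sum (V : normedZmodType C) I (r : seq I) (P : pred I) (F : I -> V) :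
  rn (\sum_(i <- r | P i) F i) <= \sum_(i <- r | P i) rn (F i).
Proof.
elim/big_rec2: _ => [|i y x Pi xy]; first by rewrite rn0.
by apply: le_trans (rnD _ _) _; rewrite lerD2l.
Qed.

Lemma rnM (x y : C) : rn (x * y) = rn x * rn y.
Proof. by apply: rc_inj; rewrite rcM -!rnE normrM. Qed.

Lemma rn1 : rn (1 : C) = 1.
Proof. by apply: rc_inj; rewrite -rnE normr1. Qed.

Lemma rnX (x : C) n : rn (x ^+ n) = rn x ^+ n.
Proof. by apply: rc_inj; rewrite rcX -!rnE normrX. Qed.

Lemma rnV (x : C) : rn (x^-1) = (rn x)^-1.
Proof.
have [->|x0] := eqVneq x 0; first by rewrite invr0 rn0 invr0.
have nx0 : rn x != 0 by rewrite rn_eq0.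
by apply: (mulfI nx0); rewrite -rnM !divff // rn1.
Qed.

Lemma rn_prod I (r : seq I) (P : pred I) (F : I -> C) :
  rn (\prod_(i <- r | P i) F i) = \prod_(i <- r | P i) rn (F i).
Proof.
by elim/big_rec2: _ => [|i y x Pi <-]; rewrite ?rn1 // rnM.
Qed.

Lemma rn_real (a : R) : rn (a%:C : C) = `|a|.
Proof. by rewrite /rn normc_def /= expr0n addr0 sqrtr_sqr. Qed.

Lemma rnZ k (c : C) (x : 'cV[C]_k) : rn (c *: x) = rn c * rn x.
Proof. by apply: rc_inj; rewrite rcM -!rnE mx_normZ. Qed.

Lemma rn_coord k (x : 'cV[C]_k) i : rn (x i 0) <= rn x.
Proof.
rewrite -lecR -!rnE {2}/Num.norm /= mx_normE.
rewrite -[leLHS]nngE num_le.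
exact: (le_bigmax _ (fun ij : 'I_k * 'I_1 => `|x ij.1 ij.2|%:nng) (i, 0)).
Qed.

(** Tested on the punctured disk only, so that t can be inverted in the charts w = t ^+ k * z. *)
Definition small_o (V : normedZmodType C) K (G : C -> V) := forall eta : R, 0 < eta ->
  exists2 d : R, 0 < d & forall t, 0 < rn t < d -> rn (G t) <= eta * rn t ^+ K.

Lemma rn_attained k (x : 'cV[C]_k) : x != 0 -> exists i, rn x = rn (x i 0).
Proof.
rewrite -rn_eq0 => x0; have : mx_norm x != 0.
  by apply: contraNneq x0; rewrite -[mx_norm x]/(`|x|) rnE => /rc_inj ->.
move=> /mx_norm_neq0[[i j] /= h]; exists i; apply: rc_inj.
by rewrite -!rnE -[`|x|]/(mx_norm x) h (ord1 j).
Qed.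

Lemma rn_colP k (x : 'cV[C]_k) (a : R) : 0 <= a ->
  (forall i, rn (x i 0) <= a) -> rn x <= a.
Proof. by move=> a0 xa; have [->|/rn_attained[i ->]] := eqVneq x 0; rewrite ?rn0. Qed.

Lemma rn_col_lt k (x : 'cV[C]_k) (a : R) : 0 < a ->
  (forall i, rn (x i 0) < a) -> rn x < a.
Proof. by move=> a0 xa; have [->|/rn_attained[i ->]] := eqVneq x 0; rewrite ?rn0. Qed.

Lemma nearvP k (v : 'cV[C]_k) (P : 'cV[C]_k -> Prop) :
  (\forall x \near v, P x) <->
  exists2 d : R, 0 < d & forall x, rn (x - v) < d -> P x.
Proof.
split.
- move=> /nbhs_ballP[e /= e0 eP].
  have ereal : e = (complex.Re (e : R[i]))%:C.
    by apply/esym/RRe_real; rewrite gtr0_real.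
  exists (complex.Re (e : R[i])); first by rewrite -ltcR -ereal.
  move=> x xe; apply: eP; rewrite mx_norm_ball /ball_ /=.
  by rewrite ereal rn_lt rnBC.
- move=> [d d0 dP]; apply/nbhs_ballP; exists (d%:C : C) => /=.
    by rewrite ltcR.
  move=> x; rewrite mx_norm_ball /ball_ /= rn_lt rnBC; exact: dP.
Qed.

Lemma near0P k (P : 'cV[C]_k -> Prop) :
  (\forall x \near (0 : 'cV[C]_k), P x) <->
  exists2 d : R, 0 < d & forall x, rn x < d -> P x.
Proof.
by rewrite nearvP; split=> -[d d0 dP]; exists d => // x; have := dP x; rewrite subr0.
Qed.

Lemma cvg_rnP (V : normedModType C) (u : nat -> V) (l : V) :
  (u @ \oo --> l) <->
  forall e : R, 0 < e -> exists N, forall n, (N <= n)%N -> rn (u n - l) < e.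
Proof.
split.
- move=> /cvgrPdist_lt ul e e0.
  have := ul (e%:C); rewrite ltcR => /(_ e0)[N _ h].
  by exists N => n Nn; have := h n Nn; rewrite /= rn_lt rnBC.
- move=> h; apply/cvgrPdist_lt => e e0.
  have ereal : e = (complex.Re (e : R[i]))%:C.
    by apply/esym/RRe_real; rewrite gtr0_real.
  have e'0 : 0 < complex.Re (e : R[i]) by rewrite -ltcR -ereal.
  have [N NP] := h _ e'0.
  by exists N => // n Nn /=; rewrite ereal rn_lt rnBC; exact: NP.
Qed.

End RealNorm.

(** * Germs as series of homogeneous polynomials *)

Section Cauchy.

Lemma cauchy_sum (A : pzRingType) (a b : nat -> A) K :
  \sum_(N < K) \sum_(i < N.+1) a i * b (N - i)%N =
  \sum_(i < K) a i * \sum_(j < K - i) b j.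
Proof.
elim: K => [|K IH]; first by rewrite !big_ord0.
rewrite big_ord_recr /= IH [RHS]big_ord_recr /= subSnn big_ord1.
rewrite [X in _ + X]big_ord_recr /= subnn addrA; congr (_ + _).
rewrite -big_split /=; apply: eq_bigr => i _.
by rewrite subSn ?(ltnW (ltn_ord i)) // big_ord_recr /= mulrDr.
Qed.

Lemma le_geo (R : realType) (a b c q : R) : 0 <= q < 1 ->
  (forall n : nat, a <= b + c * q ^+ n) -> a <= b.
Proof.
move=> /andP[q0 q1] h.
have cv : (fun n => b + c * q ^+ n) @ \oo --> b.
  rewrite -[X in _ --> X]addr0; apply: cvgD; first exact: cvg_cst.
  rewrite -[X in _ --> X](mulr0 c); apply: cvgMl_tmp.
  by apply: cvg_expr; rewrite ger0_norm.
have -> : b = lim ((fun n => b + c * q ^+ n) @ \oo) by apply/esym/cvg_lim.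
apply: limr_ge; first by apply/cvg_ex; exists b.
by near=> n; exact: h.
Unshelve. all: by end_near. Qed.

End Cauchy.

Section Homogeneous.
Variables (R : realType) (d : nat).
Local Notation C := (Cplx R).
Local Notation V := 'cV[C]_d.
Local Notation expo := {ffun 'I_d -> nat}.
Implicit Types (f g : V -> C) (x : V).

Definition adeg (a : expo) : nat := (\sum_i a i)%N.
Definition mon x (a : expo) : C := \prod_i x i 0 ^+ a i.

(* [phi] is homogeneous of degree [N], with coefficients of total size at most
   [B]; the monomials in [s] may be repeated. *)
Definition hp N (B : R) phi := exists s : seq (C * expo),
  [/\ all (fun u => adeg u.2 == N) s, \sum_(u <- s) rn u.1 <= B &
      forall x, phi x = \sum_(u <- s) u.1 * mon x u.2].

Lemma mon_bound x a : rn (mon x a) <= rn x ^+ adeg a.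
Proof.
rewrite /mon rn_prod /adeg expr_sum; apply: ler_prod => i _.
by rewrite rn_ge0 rnX lerX_rn // rn_coord.
Qed.

Lemma monZ c x a : mon (c *: x) a = c ^+ adeg a * mon x a.
Proof.
rewrite /mon /adeg expr_sum -big_split /=; apply: eq_bigr => i _.
by rewrite mxE exprMn.
Qed.

Lemma monD x (a b : expo) : mon x [ffun i => (a i + b i)%N] = mon x a * mon x b.
Proof.
by rewrite /mon -big_split /=; apply: eq_bigr => i _; rewrite ffunE exprD.
Qed.

Lemma adegD (a b : expo) : adeg [ffun i => (a i + b i)%N] = (adeg a + adeg b)%N.
Proof. by rewrite /adeg -big_split /=; apply: eq_bigr => i _; rewrite ffunE. Qed.

Lemma hp_ge0 N B phi : hp N B phi -> 0 <= B.
Proof.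
move=> [s [_ sB _]]; apply: le_trans sB; apply: sumr_ge0 => u _; exact: rn_ge0.
Qed.

Lemma hp_ext N B phi psi : phi =1 psi -> hp N B phi -> hp N B psi.
Proof. by move=> e [s [h1 h2 h3]]; exists s; split => // x; rewrite -e. Qed.

Lemma hp0 N : hp N 0 (fun=> 0).
Proof. by exists [::]; split => // [|x]; rewrite big_nil. Qed.

Lemma hp_cst c : hp 0 (rn c) (fun=> c).
Proof.
exists [:: (c, [ffun=> 0%N])]; split => [||x]; rewrite ?big_seq1 //=.
  by rewrite andbT /adeg big1 // => i _; rewrite ffunE.
by rewrite /mon big1 ?mulr1 // => i _; rewrite ffunE expr0.
Qed.

Lemma hp_coord i : hp 1 1 (fun x => x i 0).
Proof.
exists [:: (1, [ffun j => (j == i) : nat])]; split => [||x]; rewrite ?big_seq1 /=.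
- rewrite andbT /adeg (bigD1 i) //= ffunE eqxx big1 // => j /negbTE ji.
  by rewrite ffunE ji.
- by rewrite rn1.
- rewrite /mon mul1r (bigD1 i) //= ffunE eqxx big1 ?mulr1 // => j /negbTE ji.
  by rewrite ffunE ji expr0.
Qed.

Lemma hpD N B B' phi psi : hp N B phi -> hp N B' psi ->
  hp N (B + B') (fun x => phi x + psi x).
Proof.
move=> [s [h1 h2 h3]] [s' [h1' h2' h3']]; exists (s ++ s'); split.
- by rewrite all_cat h1 h1'.
- by rewrite big_cat /= lerD.
- by move=> x; rewrite big_cat h3 h3'.
Qed.

Lemma hpM N N' B B' phi psi : hp N B phi -> hp N' B' psi ->
  hp (N + N')%N (B * B') (fun x => phi x * psi x).
Proof.
move=> h h'; have B0 := hp_ge0 h; have B'0 := hp_ge0 h'.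
move: h h' => [s [h1 h2 h3]] [s' [h1' h2' h3']].
pose m (u v : C * expo) := (u.1 * v.1, [ffun i => (u.2 i + v.2 i)%N] : expo).
exists [seq m u v | u <- s, v <- s']; split.
- apply/allP => _ /allpairsP[[u v] /= [us vs ->]] /=.
  by rewrite adegD (eqP (allP h1 _ us)) (eqP (allP h1' _ vs)).
- rewrite big_allpairs_dep /=.
  apply: le_trans (ler_pM _ _ h2 h2').
  + rewrite big_distrl /=; apply: ler_sum => u _.
    rewrite big_distrr /=; apply: ler_sum => v _.
    by rewrite rnM.
  + by apply: sumr_ge0 => u _; exact: rn_ge0.
  + by apply: sumr_ge0 => u _; exact: rn_ge0.
- move=> x; rewrite big_allpairs_dep /= h3 h3' big_distrl /=.
  apply: eq_bigr => u _; rewrite big_distrr /=; apply: eq_bigr => v _.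
  by rewrite monD mulrACA.
Qed.

Lemma hpZ N B c phi : hp N B phi -> hp N (rn c * B) (fun x => c * phi x).
Proof. by move=> h; exact: (hpM (hp_cst c) h). Qed.

Lemma hp_sum N I (r : seq I) (P : pred I) (B : I -> R) (phi : I -> V -> C) :
  (forall i, P i -> hp N (B i) (phi i)) ->
  hp N (\sum_(i <- r | P i) B i) (fun x => \sum_(i <- r | P i) phi i x).
Proof.
move=> h; elim: r => [|i r IH].
  by rewrite big_nil; apply: hp_ext (hp0 N) => x; rewrite big_nil.
rewrite big_cons; case: ifPn => Pi.
  by apply: hp_ext (hpD (h _ Pi) IH) => x; rewrite big_cons Pi.
by apply: hp_ext IH => x; rewrite big_cons (negbTE Pi).
Qed.

Lemma hp_bound N B phi x : hp N B phi -> rn (phi x) <= B * rn x ^+ N.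
Proof.
move=> [s [h1 h2 h3]]; rewrite h3; apply: le_trans (rn_sum _ _ _) _.
apply: (@le_trans _ _ (\sum_(u <- s) rn u.1 * rn x ^+ N)).
  rewrite big_seq [leRHS]big_seq; apply: ler_sum => u us.
  rewrite rnM -(eqP (allP h1 _ us)); apply: ler_wpM2l; first exact: rn_ge0.
  exact: mon_bound.
by rewrite -big_distrl /=; apply: ler_wpM2r => //; rewrite exprn_ge0 ?rn_ge0.
Qed.

Lemma hp_hom N B phi c x : hp N B phi -> phi (c *: x) = c ^+ N * phi x.
Proof.
move=> [s [h1 h2 h3]]; rewrite !h3 big_distrr /= big_seq [RHS]big_seq.
apply: eq_bigr => u us; rewrite monZ (eqP (allP h1 _ us)).
by rewrite mulrCA.
Qed.

Lemma hp_eq0 N phi : hp N 0 phi -> forall x, phi x = 0.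
Proof.
move=> h x; apply: rn_le0.
by have := hp_bound x h; rewrite mul0r.
Qed.

(* [f] is the sum of the homogeneous series [phi] on the ball of radius [rho]. *)
Definition GHr (rho M : R) f (phi : nat -> V -> C) (B : nat -> R) :=
  [/\ forall N, hp N (B N) (phi N),
      forall K, \sum_(N < K) B N * rho ^+ N <= M &
      forall q x, 0 <= q < 1 -> rn x <= q * rho -> forall K,
        rn (f x - \sum_(N < K) phi N x) <= M * q ^+ K].

Definition GH f := exists rho M phi B, 0 < rho /\ GHr rho M f phi B.

Lemma GHr_M0 rho M f phi B : GHr rho M f phi B -> 0 <= M.
Proof. by move=> [_ /(_ 0%N)]; rewrite big_ord0. Qed.

Lemma hp_tail rho M phi (B : nat -> R) q x m n : 0 <= rho ->
  (forall N, hp N (B N) (phi N)) -> (forall K, \sum_(N < K) B N * rho ^+ N <= M) ->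
  0 <= q < 1 -> rn x <= q * rho -> (m <= n)%N ->
  rn (\sum_(N < n) phi N x - \sum_(N < m) phi N x) <= M * q ^+ m.
Proof.
move=> rho0 h1 h2 /andP[q0 q1] xq /subnKC <-; have B0 N := hp_ge0 (h1 N).
rewrite big_split_ord /= addrAC subrr add0r.
apply: le_trans (rn_sum _ _ _) _.
apply: (@le_trans _ _ (\sum_(i < n - m) B (m + i)%N * rho ^+ (m + i) * q ^+ m)).
  apply: ler_sum => i _; apply: le_trans (hp_bound _ (h1 _)) _.
  rewrite -mulrA; apply: ler_wpM2l => //.
  apply: (@le_trans _ _ ((q * rho) ^+ (m + i))); first exact: lerX_rn.
  rewrite exprMn mulrC; apply: ler_wpM2l; first exact: exprn_ge0.
  rewrite exprD; apply: ler_piMr; first exact: exprn_ge0.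
  by rewrite exprn_ile1 // ltW.
rewrite -big_distrl /=; apply: ler_wpM2r; first exact: exprn_ge0.
apply: le_trans (h2 (m + (n - m))%N).
rewrite big_split_ord /= lerDr; apply: sumr_ge0 => i _.
by rewrite mulr_ge0 // exprn_ge0.
Qed.

(* The constant [c] may be arbitrary: comparing with the partial sum of length
   [K + n] and letting [n] grow replaces it by [M]. *)
Lemma GHr_improve rho M c f phi B : 0 <= rho ->
  (forall N, hp N (B N) (phi N)) ->
  (forall K, \sum_(N < K) B N * rho ^+ N <= M) ->
  (forall q x, 0 <= q < 1 -> rn x <= q * rho -> forall K,
        rn (f x - \sum_(N < K) phi N x) <= c * q ^+ K) ->
  GHr rho M f phi B.
Proof.
move=> rho0 h1 h2 h3; split => // q x q01 xq K.
apply: (@le_geo _ _ _ (c * q ^+ K) q q01) => n; rewrite -mulrA -exprD.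
apply: le_trans (rn_tri (\sum_(N < K + n) phi N x) _ _) _.
by rewrite addrC; apply: lerD; [exact: hp_tail rho0 h1 h2 q01 xq (leq_addr _ _) | exact: h3].
Qed.

Lemma GHr_shrink rho rho' M f phi B : 0 < rho' <= rho ->
  GHr rho M f phi B -> GHr rho' M f phi B.
Proof.
move=> /andP[r'0 r'r] [h1 h2 h3].
split => // [K|q x q01 xq K].
- apply: le_trans (h2 K); apply: ler_sum => i _.
  apply: ler_wpM2l; first exact: hp_ge0 (h1 i).
  by apply: lerXn2r => //; rewrite nnegrE ltW // (lt_le_trans r'0).
- apply: h3 => //; apply: le_trans xq _.
  by apply: ler_wpM2l => //; case/andP: q01.
Qed.

(** A Schwarz lemma: without constant term every B N * (l * rho) ^+ N has at least one factor l, so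
    shrinking the radius also shrinks the majorant norm. *)
Lemma GHr_small rho l M f phi B : 0 < rho -> 0 < l <= 1 -> B 0 = 0 ->
  GHr rho M f phi B -> GHr (l * rho) (l * M) f phi B.
Proof.
move=> r0 /andP[l0 l1] B0 h.
have [] : GHr (l * rho) M f phi B.
  by apply: GHr_shrink h; rewrite mulr_gt0 //= ler_piMl // ltW.
move=> h1 h2 h3; apply: (@GHr_improve _ _ M) => //.
  by rewrite mulr_ge0 // ltW.
have [_ h4 _] := h; have M0 := GHr_M0 h.
case=> [|K]; first by rewrite big_ord0 mulr_ge0 // ltW.
apply: (@le_trans _ _ (l * \sum_(N < K.+1) B N * rho ^+ N)); last first.
  by apply: ler_wpM2l; [exact: ltW | exact: h4].
rewrite big_distrr /=; apply: ler_sum => -[[|i] /= _] _.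
  by rewrite B0 !mul0r mulr0.
rewrite mulrCA; apply: ler_wpM2l; first exact: hp_ge0 (h1 _).
rewrite exprMn; apply: ler_wpM2r; first by rewrite exprn_ge0 // ltW.
rewrite exprS; apply: ler_piMr; first exact: ltW.
by apply: exprn_ile1 => //; exact: ltW.
Qed.

(** [B 0] only bounds the constant term and may be positive although [f 0 = 0]; it is reset to 0, as
    [GHr_small] requires. *)
Lemma GHr_vanish rho M f phi B : 0 < rho -> f 0 = 0 -> GHr rho M f phi B ->
  GHr rho M f (fun N => if N is 0 then fun=> 0 else phi N)
              (fun N => if N is 0 then 0 else B N).
Proof.
move=> r0 f0 h; have M0 := GHr_M0 h; case: (h) => h1 h2 h3.
have p0 x : phi 0%N x = 0.
  have := hp_hom 0 x (h1 0%N); rewrite expr0 mul1r => <-; rewrite scale0r.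
  have := h3 0 0; rewrite lexx ltr01 rn0 mul0r lexx => /(_ isT isT 1%N).
  rewrite big_ord1 f0 sub0r rnN expr1 mulr0 => h0.
  by apply: rn_le0; rewrite h0.
split.
- by case=> [|N]; [exact: hp0 | exact: h1].
- move=> K; apply: le_trans (h2 K); apply: ler_sum => -[[|i] _] _ //=.
  by rewrite mul0r mulr_ge0 ?expr0 ?ler01 // (hp_ge0 (h1 0%N)).
- move=> q x q01 xq K; have := h3 q x q01 xq K.
  rewrite (eq_bigr (fun N : 'I_K => match val N with 0%N => fun=> 0 | _.+1 => phi N end x)) //.
  by move=> [[|i] _] _ //=.
Qed.

Lemma GHr_ext rho M f g phi B : f =1 g -> GHr rho M f phi B -> GHr rho M g phi B.
Proof. by move=> e [h1 h2 h3]; split => // q x q01 xq K; rewrite -e; exact: h3. Qed.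

Lemma GH_ext f g : f =1 g -> GH f -> GH g.
Proof.
move=> e [r [M [p [B [r0 h]]]]]; exists r, M, p, B; split => //.
exact: GHr_ext h.
Qed.

Lemma GHr_hp rho N B f : 0 < rho -> hp N B f ->
  GHr rho (B * rho ^+ N) f (fun n => if n == N then f else fun=> 0)
     (fun n => if n == N then B else 0).
Proof.
move=> r0 h; have B0 := hp_ge0 h; have r0' := ltW r0.
split.
- by move=> n; case: eqP => [->//|_]; exact: hp0.
- move=> K; case: (ltnP N K) => NK.
    rewrite (bigD1 (Ordinal NK)) //= eqxx big1 ?addr0 // => i iN.
    by rewrite -[_ == _ :> nat]/(i == Ordinal NK) (negbTE iN) mul0r.
  rewrite big1 ?mulr_ge0 ?exprn_ge0 // => i _.
  by rewrite ltn_eqF ?mul0r // (leq_trans _ NK).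
- move=> q x /andP[q0 q1] xq K; case: (ltnP N K) => NK.
    rewrite (bigD1 (Ordinal NK)) //= eqxx big1 => [|i iN].
      by rewrite addr0 subrr rn0 !mulr_ge0 // exprn_ge0.
    by rewrite -[_ == _ :> nat]/(i == Ordinal NK) (negbTE iN).
  rewrite big1 => [|i _]; last by rewrite ltn_eqF // (leq_trans _ NK).
  rewrite subr0; apply: le_trans (hp_bound _ h) _; rewrite -mulrA.
  apply: ler_wpM2l => //; apply: (@le_trans _ _ ((q * rho) ^+ N)).
    exact: lerX_rn.
  rewrite exprMn mulrC; apply: ler_wpM2l; first exact: exprn_ge0.
  by apply: ler_wiXn2l => //; exact: ltW.
Qed.

Lemma GH_hp N B f : hp N B f -> GH f.
Proof. by move=> h; do 4!eexists; split; last exact: (GHr_hp ltr01 h). Qed.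

Lemma GHrD rho M M' f g phi psi B B' :
  GHr rho M f phi B -> GHr rho M' g psi B' ->
  GHr rho (M + M') (fun x => f x + g x) (fun N x => phi N x + psi N x)
    (fun N => B N + B' N).
Proof.
move=> [h1 h2 h3] [g1 g2 g3]; split.
- by move=> N; exact: hpD.
- move=> K; under eq_bigr do rewrite mulrDl.
  by rewrite big_split lerD.
- move=> q x q01 xq K; rewrite big_split opprD addrACA mulrDl.
  by apply: le_trans (rnD _ _) _; rewrite lerD ?h3 ?g3.
Qed.

Lemma GHrM rho M M' f g phi psi B B' : 0 < rho ->
  GHr rho M f phi B -> GHr rho M' g psi B' ->
  GHr rho (M * M') (fun x => f x * g x)
    (fun N x => \sum_(i < N.+1) phi i x * psi (N - i)%N x)
    (fun N => \sum_(i < N.+1) B i * B' (N - i)%N).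
Proof.
move=> r0 hf hg; have M0 := GHr_M0 hf; have M'0 := GHr_M0 hg.
case: hf => [h1 h2 h3]; case: hg => [g1 g2 g3].
have B0 N := hp_ge0 (h1 N); have B'0 N := hp_ge0 (g1 N).
have r0' := ltW r0.
apply: (@GHr_improve _ _ (M * M' + M * M')) => //.
- move=> N; apply: hp_sum => i _.
  by have := hpM (h1 i) (g1 (N - i)%N); rewrite subnKC // -ltnS.
- move=> K.
  rewrite (eq_bigr (fun N : 'I_K =>
      \sum_(i < N.+1) (B i * rho ^+ i) * (B' (N - i)%N * rho ^+ (N - i)))).
    rewrite (cauchy_sum (fun i => B i * rho ^+ i) (fun i => B' i * rho ^+ i)).
    apply: (@le_trans _ _ (\sum_(i < K) (B i * rho ^+ i) * M')).
      apply: ler_sum => i _; apply: ler_wpM2l; last exact: g2.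
      by rewrite mulr_ge0 // exprn_ge0.
    by rewrite -big_distrl /=; apply: ler_wpM2r => //; exact: h2.
  move=> N _; rewrite big_distrl /=; apply: eq_bigr => i _.
  by rewrite mulrACA -exprD subnKC // -ltnS.
- move=> q x q01 xq K; have /andP[q0 q1] := q01.
  rewrite (cauchy_sum (phi^~ x) (psi^~ x)).
  (* The truncation is triangular: the i-th tail of g starts at K - i, and the missing factor q ^+ i
     comes from the size of [phi i x]. *)
  have -> : f x * g x - \sum_(i < K) phi i x * \sum_(j < K - i) psi j x =
    (f x - \sum_(i < K) phi i x) * g x +
    \sum_(i < K) phi i x * (g x - \sum_(j < K - i) psi j x).
    rewrite mulrBl -addrA; congr (_ + _).
    under [X in _ = _ + X]eq_bigr do rewrite mulrBr.
    by rewrite big_split /= -big_distrl /= addKr -sumrN.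
  apply: le_trans (rnD _ _) _; rewrite [leRHS]mulrDl; apply: lerD.
    rewrite rnM mulrAC; apply: ler_pM; rewrite ?rn_ge0 ?h3 //.
    by have := g3 q x q01 xq 0%N; rewrite big_ord0 subr0 mulr1.
  apply: le_trans (rn_sum _ _ _) _.
  apply: (@le_trans _ _ (\sum_(i < K) B i * rho ^+ i * (M' * q ^+ K))).
    apply: ler_sum => i _; rewrite rnM.
    have -> : B i * rho ^+ i * (M' * q ^+ K) =
      (B i * (q * rho) ^+ i) * (M' * q ^+ (K - i)).
      have -> : q ^+ K = q ^+ i * q ^+ (K - i).
        by rewrite -exprD subnKC // ltnW.
      by rewrite exprMn; ring.
    apply: ler_pM; rewrite ?rn_ge0 ?g3 //.
    apply: le_trans (hp_bound _ (h1 i)) _; apply: ler_wpM2l => //.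
    exact: lerX_rn.
  rewrite -big_distrl /= -mulrA; apply: ler_wpM2r; last exact: h2.
  by rewrite mulr_ge0 // exprn_ge0.
Qed.

Lemma GH_common f g : GH f -> GH g -> exists rho, 0 < rho /\
  exists M M' phi psi B B', GHr rho M f phi B /\ GHr rho M' g psi B'.
Proof.
move=> [r [M [p [B [r0 h]]]]] [r' [M' [p' [B' [r'0 h']]]]].
exists (Num.min r r'); split; first by rewrite lt_min r0.
exists M, M', p, p', B, B'; split.
  by apply: GHr_shrink h; rewrite lt_min r0 r'0 ge_min lexx.
by apply: GHr_shrink h'; rewrite lt_min r0 r'0 ge_min lexx orbT.
Qed.

Lemma GHD f g : GH f -> GH g -> GH (fun x => f x + g x).
Proof.
move=> hf hg; have [r [r0 [M [M' [p [p' [B [B' [h h']]]]]]]]] := GH_common hf hg.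
by do 4!eexists; split; [exact: r0 | exact: GHrD h h'].
Qed.

Lemma GHM f g : GH f -> GH g -> GH (fun x => f x * g x).
Proof.
move=> hf hg; have [r [r0 [M [M' [p [p' [B [B' [h h']]]]]]]]] := GH_common hf hg.
by do 4!eexists; split; [exact: r0 | exact: GHrM h h'].
Qed.

Lemma GH_cst c : GH (fun=> c). Proof. exact: GH_hp (hp_cst c). Qed.
Lemma GH_coord i : GH (fun x => x i 0). Proof. exact: GH_hp (hp_coord i). Qed.

Lemma GHX f n : GH f -> GH (fun x => f x ^+ n).
Proof.
move=> h; elim: n => [|n IH]; first exact: GH_cst.
by apply: GH_ext (GHM h IH) => x; rewrite exprS.
Qed.

Lemma GH_sum I (r : seq I) (P : pred I) (f : I -> V -> C) :
  (forall i, P i -> GH (f i)) -> GH (fun x => \sum_(i <- r | P i) f i x).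
Proof.
move=> h; elim: r => [|i r IH].
  by apply: GH_ext (GH_cst 0) => x; rewrite big_nil.
have [Pi|nPi] := boolP (P i).
  by apply: GH_ext (GHD (h _ Pi) IH) => x; rewrite big_cons Pi.
by apply: GH_ext IH => x; rewrite big_cons (negbTE nPi).
Qed.

Lemma GH_prod I (r : seq I) (P : pred I) (f : I -> V -> C) :
  (forall i, P i -> GH (f i)) -> GH (fun x => \prod_(i <- r | P i) f i x).
Proof.
move=> h; elim: r => [|i r IH].
  by apply: GH_ext (GH_cst 1) => x; rewrite big_nil.
have [Pi|nPi] := boolP (P i).
  by apply: GH_ext (GHM (h _ Pi) IH) => x; rewrite big_cons Pi.
by apply: GH_ext IH => x; rewrite big_cons (negbTE nPi).
Qed.

(** The order of vanishing is read on the bounds [B]. Radius and majorant norm stay explicit, unlike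
    in [GH], because composition sums infinitely many such functions on one ball. *)
Definition GO m rho M f := exists phi B, GHr rho M f phi B /\
  forall N, (N < m)%N -> B N = 0.

Lemma GO_phi0 rho M f phi B N x : GHr rho M f phi B -> B N = 0 -> phi N x = 0.
Proof. by move=> [h1 _ _] BN; apply: (@hp_eq0 N); rewrite -BN; exact: h1. Qed.

Lemma GOM m m' rho M M' f g : 0 < rho -> GO m rho M f -> GO m' rho M' g ->
  GO (m + m')%N rho (M * M') (fun x => f x * g x).
Proof.
move=> r0 [p [B [h hm]]] [p' [B' [h' hm']]].
do 2!eexists; split; first exact: GHrM r0 h h'.
move=> N Nm /=; apply: big1 => i _.
case: (ltnP i m) => im; first by rewrite hm // mul0r.
by rewrite hm' ?mulr0 //; have := ltn_ord i; lia.
Qed.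

Lemma GO_cst rho c : 0 < rho -> GO 0 rho (rn c) (fun=> c).
Proof.
move=> r0; do 2!eexists; split; last by [].
by have := GHr_hp r0 (hp_cst c); rewrite expr0 mulr1; exact.
Qed.

Lemma GO_ext m rho M f g : f =1 g -> GO m rho M f -> GO m rho M g.
Proof. by move=> e [p [B [h hm]]]; exists p, B; split => //; exact: GHr_ext h. Qed.

Lemma GOX rho M f n : 0 < rho -> GO 1 rho M f ->
  GO n rho (M ^+ n) (fun x => f x ^+ n).
Proof.
move=> r0 h; elim: n => [|n IH].
  by have := GO_cst 1 r0; rewrite rn1.
by rewrite exprS -add1n; apply: GO_ext (GOM r0 h IH) => x; rewrite add1n exprS.
Qed.

Lemma GO_sum m rho I (r : seq I) (M : I -> R) (f : I -> V -> C) : 0 < rho ->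
  (forall i, GO m rho (M i) (f i)) ->
  GO m rho (\sum_(i <- r) M i) (fun x => \sum_(i <- r) f i x).
Proof.
move=> r0 h; elim: r => [|i r [p [B [IH Im]]]].
  exists (fun _ => fun=> 0), (fun=> 0); split => //; rewrite big_nil.
  split => [N|K|q x q01 xq K]; first exact: hp0.
    by rewrite big1 // => i _; rewrite mul0r.
  by rewrite big_nil big1 // subrr rn0 mul0r.
have [p' [B' [h' hm']]] := h i; rewrite big_cons.
do 2!eexists; split.
  by apply: GHr_ext (GHrD h' IH) => x; rewrite big_cons.
by move=> N Nm; rewrite /= hm' ?Im ?addr0.
Qed.

Lemma GO_prod rho I (r : seq I) (m : I -> nat) (M : I -> R) (f : I -> V -> C) :
  0 < rho -> (forall i, GO (m i) rho (M i) (f i)) ->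
  GO (\sum_(i <- r) m i)%N rho (\prod_(i <- r) M i) (fun x => \prod_(i <- r) f i x).
Proof.
move=> r0 h; elim: r => [|i r IH].
  rewrite !big_nil; have := GO_cst 1 r0; rewrite rn1.
  by apply: GO_ext => x; rewrite big_nil.
by rewrite !big_cons; apply: GO_ext (GOM r0 (h i) IH) => x; rewrite big_cons.
Qed.

Lemma GO_le m rho M M' f : M <= M' -> GO m rho M f -> GO m rho M' f.
Proof.
move=> MM' [p [B [[h1 h2 h3] hm]]]; exists p, B; split => //; split => //.
  by move=> K; exact: le_trans (h2 K) MM'.
move=> q x q01 xq K; apply: le_trans (h3 q x q01 xq K) _.
by apply: ler_wpM2r => //; rewrite exprn_ge0 //; case/andP: q01.
Qed.

(** The bound [e] is reached by shrinking the radius; quantifying over all smaller [rho] lets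
    finitely many functions share one radius. *)
Lemma GO1 f (e : R) : 0 < e -> GH f -> f 0 = 0 ->
  exists2 rho0, 0 < rho0 & forall rho, 0 < rho <= rho0 -> GO 1 rho e f.
Proof.
move=> e0 [r [M [p [B [r0 h]]]]] f0.
have M0 := GHr_M0 h.
have {}h := GHr_vanish r0 f0 h.
pose l := Num.min 1 (e / (M + 1)).
have l0 : 0 < l by rewrite lt_min ltr01 divr_gt0 // ltr_wpDl.
exists (l * r) => [|rho rhoP]; first exact: mulr_gt0.
apply: (@GO_le _ _ (l * M)).
  apply: (@le_trans _ _ (e / (M + 1) * M)).
    by apply: ler_wpM2r => //; rewrite /l ge_min lexx orbT.
  rewrite mulrAC ler_pdivrMr ?ltr_wpDl //; apply: ler_wpM2l; first exact: ltW.
  by rewrite lerDl.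
have l01 : 0 < l <= 1 by rewrite l0 /l ge_min lexx.
have {}h := GHr_shrink rhoP (GHr_small r0 l01 erefl h).
by do 2!eexists; split; [exact: h | case].
Qed.

Lemma GH_small f (e : R) : GH f -> f 0 = 0 -> 0 < e ->
  exists2 dl : R, 0 < dl & forall x, rn x < dl -> rn (f x) < e.
Proof.
move=> hf f0 e0; have e20 : 0 < e / 2 by rewrite divr_gt0.
have [r0 r00 hr] := GO1 e20 hf f0.
have [|p [B [[_ _ h3] _]]] := hr r0; first by rewrite r00 lexx.
exists (r0 / 2); first by rewrite divr_gt0.
move=> x xr; have := h3 2^-1 x (half01 R); rewrite mulrC.
move=> /(_ (ltW xr) 0%N); rewrite big_ord0 subr0 expr0 mulr1 => h4.
by apply: le_lt_trans h4 _; rewrite ltr_pdivrMr //; lra.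
Qed.

End Homogeneous.

(** * Composition of convergent power series *)

Section Composition.
Variables (R : realType) (k d : nat).
Local Notation C := (Cplx R).

(** Once every [X i] has majorant norm at most [rf], the term [phi m] composed with [X] has order at
    least m and norm at most [Bf m * rf ^+ m], which is summable; in each degree only finitely many
    m contribute. *)
Lemma GH_comp (f : 'cV[C]_k -> C) (X : 'I_k -> 'cV[C]_d -> C) :
  GH f -> (forall i, GH (X i)) -> (forall i, X i 0 = 0) ->
  GH (fun x => f (\col_i X i x)).
Proof.
move=> [rf [Mf [phi [Bf [rf0 hf]]]]] hX X0.
have Mf0 := GHr_M0 hf; have [h1 h2 h3] := hf.
have Bf0 N := hp_ge0 (h1 N).
have [rho r0 hO] : exists2 rho, 0 < rho & forall i, GO 1 rho rf (X i).
  have [|i|rho rho0 h] := @finite_min R 'I_k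
      (fun i r => forall rho, 0 < rho <= r -> GO 1 rho rf (X i)).
  - move=> i d1 d2 /andP[_ d21] h rho' /andP[r0 r1]; apply: h; rewrite r0.
    exact: le_trans d21.
  - exact: GO1 (hX i) (X0 i).
  - by exists rho => // i; apply: h; rewrite rho0 lexx.
have Xbound x q : 0 <= q < 1 -> rn x <= q * rho -> rn (\col_i X i x) <= q * rf.
  move=> q01 xq; apply: rn_colP => [|i].
    by rewrite mulr_ge0 ?(ltW rf0) //; case/andP: q01.
  have [p [B [hi hm]]] := hO i; have [_ _ hi3] := hi.
  have := hi3 q x q01 xq 1%N.
  by rewrite big_ord1 (GO_phi0 _ hi (hm 0%N _)) // subr0 expr1 mxE mulrC.
have /choice[t tP] m : exists t : (nat -> 'cV[C]_d -> C) * (nat -> R),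
    GHr rho (Bf m * rf ^+ m) (fun x => phi m (\col_i X i x)) t.1 t.2 /\
    forall N, (N < m)%N -> t.2 N = 0.
  have [s [s1 s2 s3]] := h1 m.
  suff [p [B hpB]] : GO m rho (Bf m * rf ^+ m) (fun x => phi m (\col_i X i x)).
    by exists (p, B).
  apply: (@GO_le _ _ _ _ (\sum_(u <- s) rn u.1 * rf ^+ m)).
    rewrite -big_distrl /=; apply: ler_wpM2r => //.
    by rewrite exprn_ge0 // ltW.
  apply: (@GO_ext _ _ _ _ _ (fun x => \sum_(u <- s) u.1 * mon (\col_i X i x) u.2)).
    by move=> x; rewrite s3.
  (* [GO_sum] asks for a bound on every index, listed in [s] or not, so monomials of the wrong
     degree are replaced by 0. *)
  pose fu (u : C * {ffun 'I_k -> nat}) x :=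
    if adeg u.2 == m then u.1 * mon (\col_i X i x) u.2 else 0.
  apply: (@GO_ext _ _ _ _ _ (fun x => \sum_(u <- s) fu u x)).
    move=> x; rewrite big_seq [RHS]big_seq; apply: eq_bigr => u us.
    by rewrite /fu (allP s1 _ us).
  apply: GO_sum => // u; rewrite /fu; case: eqP => [<-|_]; last first.
    exists (fun _ => fun=> 0), (fun=> 0); split => //.
    have M0 : 0 <= rn u.1 * rf ^+ m by rewrite mulr_ge0 ?rn_ge0 ?exprn_ge0 ?ltW.
    split => [N|K|q x q01 xq K]; first exact: hp0.
      by rewrite big1 // => i _; rewrite mul0r.
    rewrite big1 // subrr rn0 mulr_ge0 ?exprn_ge0 //; by case/andP: q01.
  rewrite -[X in GO X _ _ _]add0n; apply: GOM => //; first exact: GO_cst.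
  rewrite /adeg expr_sum /mon.
  apply: (@GO_ext _ _ _ _ _ (fun x => \prod_i X i x ^+ u.2 i)).
    by move=> x; apply: eq_bigr => i _; rewrite mxE.
  by apply: GO_prod => // i; apply: GOX.
(* Degree N of the composition; the sum stops at m = N since the m-th term has order at least m. *)
pose p N x : C := \sum_(m < N.+1) (t m).1 N x.
pose B N : R := \sum_(m < N.+1) (t m).2 N.
have t0 m N x : (N < m)%N -> (t m).1 N x = 0.
  by move=> Nm; have [hm h0] := tP m; apply: (GO_phi0 _ hm); exact: h0.
have tB m N : 0 <= (t m).2 N.
  by have [[hm _ _] _] := tP m; exact: hp_ge0 (hm N).
have widen (A : nmodType) (g : nat -> nat -> A) K :
    (forall m N, (N < m)%N -> g m N = 0) ->
    \sum_(N < K) \sum_(m < N.+1) g m N = \sum_(m < K) \sum_(N < K) g m N.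
  move=> g0; rewrite exchange_big /=; apply: eq_bigr => N _.
  rewrite [RHS](bigID (fun m : 'I_K => (m < N.+1)%N)) /= [X in _ + X]big1; last first.
    by move=> m; rewrite -leqNgt; exact: g0.
  by rewrite addr0 (big_ord_widen _ (fun m => g m N) (ltn_ord N)).
exists rho, Mf, p, B; split => //.
apply: (@GHr_improve _ _ _ _ (Mf + Mf)); first exact: ltW.
- move=> N; apply: hp_sum => m _; have [[hm _ _] _] := tP m; exact: hm.
- move=> K.
  have -> : \sum_(N < K) B N * rho ^+ N =
      \sum_(m < K) \sum_(N < K) (t m).2 N * rho ^+ N.
    rewrite -(widen _ (fun m N => (t m).2 N * rho ^+ N)).
      by apply: eq_bigr => N _; rewrite big_distrl.
    by move=> m N Nm; have [_ ->] := tP m; rewrite ?mul0r.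
  apply: le_trans (h2 K); apply: ler_sum => m _.
  by have [[_ hm _] _] := tP m; exact: hm.
- move=> q x q01 xq K.
  rewrite (widen _ (fun m N => (t m).1 N x)); last by move=> m N; exact: t0.
  (* The truncation error of [f] at the image point and the tails of the K composed terms contribute
     one [Mf] each. *)
  apply: le_trans (rn_tri (\sum_(m < K) phi m (\col_i X i x)) _ _) _.
  rewrite [leRHS]mulrDl; apply: lerD; first by apply: h3 => //; exact: Xbound.
  rewrite -sumrB; apply: le_trans (rn_sum _ _ _) _.
  apply: (@le_trans _ _ (\sum_(m < K) Bf m * rf ^+ m * q ^+ K)).
    apply: ler_sum => m _; have [[_ _ hm] _] := tP m; exact: hm.
  rewrite -big_distrl /=; apply: ler_wpM2r; last exact: h2.
  by rewrite exprn_ge0 //; case/andP: q01.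
Qed.

End Composition.

Lemma geo_small (R : realType) (c q e : R) : 0 <= q < 1 -> 0 < e ->
  exists K0, forall K, (K0 <= K)%N -> c * q ^+ K < e.
Proof.
move=> /andP[q0 q1] e0.
have cv : (fun n => c * q ^+ n) @ \oo --> (0 : R).
  rewrite -[X in _ --> X](mulr0 c); apply: cvgMl_tmp.
  by apply: cvg_expr; rewrite ger0_norm.
have [K0 _ h] : \forall n \near \oo, `|0 - c * q ^+ n| < e.
  by move/cvgrPdist_lt : cv; exact.
exists K0 => K KK; have := h K KK; rewrite /= sub0r normrN.
exact: le_lt_trans (ler_norm _).
Qed.

Lemma natSinv_small (R : realType) (e : R) : 0 < e ->
  exists N, forall n, (N <= n)%N -> n.+1%:R^-1 < e.
Proof.
move=> e0; have [N NP] := geo_small 1 (half01 R) e0.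
exists (2 ^ N)%N => n Nn; apply: le_lt_trans (NP N (leqnn _)).
rewrite mul1r exprVn lef_pV2 ?posrE ?ltr0n ?exprn_gt0 //.
by rewrite -natrX ler_nat (leq_trans Nn).
Qed.

(** * Cubical and graded partial sums *)

Section Boxes.
Variables (d : nat).
Local Notation expo := {ffun 'I_d -> nat}.

(** Truncations in [holo_on] are cubical, those in [GHr] go by total degree; both become sums over
    lists of exponents, which can be compared. *)
Definition box K : seq expo :=
  [seq ([ffun i => val (a i)] : expo) | a : {ffun 'I_d -> 'I_K} <- enum {: {ffun 'I_d -> 'I_K}}].

Definition degs N : seq expo := [seq a <- box N.+1 | adeg a == N].

Lemma mem_box K (a : expo) : (a \in box K) = [forall i, (a i < K)%N].
Proof.
apply/mapP/forallP => [[b _ ->] i|h]; first by rewrite ffunE ltn_ord.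
exists [ffun i => Ordinal (h i)]; first by rewrite mem_enum.
by apply/ffunP => i; rewrite !ffunE.
Qed.

Lemma uniq_box K : uniq (box K).
Proof.
rewrite map_inj_uniq ?enum_uniq // => a b /ffunP ab.
by apply/ffunP => i; apply: val_inj; have := ab i; rewrite !ffunE.
Qed.

Lemma sum_box (A : nmodType) (F : expo -> A) K :
  \sum_(a : {ffun 'I_d -> 'I_K}) F [ffun i => val (a i)] = \sum_(a <- box K) F a.
Proof. by rewrite big_map big_enum. Qed.

Lemma adeg_ge (a : expo) i : (a i <= adeg a)%N.
Proof. by rewrite /adeg (bigD1 i) //= leq_addr. Qed.

Lemma mem_degs N (a : expo) : (a \in degs N) = (adeg a == N).
Proof.
rewrite mem_filter mem_box andbC; case: eqP => [<-|_]; last by rewrite andbF.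
by rewrite andbT; apply/forallP => i; rewrite ltnS adeg_ge.
Qed.

Lemma uniq_degs N : uniq (degs N).
Proof. by rewrite filter_uniq // uniq_box. Qed.

Lemma sum_graded (A : nmodType) (F : expo -> A) K K' : (K <= K')%N ->
  \sum_(N < K) \sum_(a <- degs N) F a = \sum_(a <- box K' | (adeg a < K)%N) F a.
Proof.
move=> KK'.
transitivity (\sum_(N < K) \sum_(a <- box K' | adeg a == N) F a).
  apply: eq_bigr => N _; rewrite -[RHS]big_filter; apply: perm_big.
  apply: uniq_perm; rewrite ?uniq_degs ?filter_uniq ?uniq_box // => a.
  rewrite mem_degs mem_filter mem_box; case: eqP => //= aN; apply/esym/forallP => i.
  by rewrite (leq_ltn_trans (adeg_ge a i)) // aN (leq_trans (ltn_ord N)).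
rewrite (exchange_big_dep predT) //= [RHS]big_mkcond /=; apply: eq_bigr => a _.
case: ltnP => aK; last first.
  by rewrite big1 // => N /eqP aN; move: aK; rewrite aN leqNgt ltn_ord.
by rewrite (big_pred1 (Ordinal aK)) // => N /=; rewrite eq_sym.
Qed.

Lemma sub_sum (R : numDomainType) (F : expo -> R) (r r' : seq expo) :
  uniq r -> uniq r' -> {subset r <= r'} -> (forall a, 0 <= F a) ->
  \sum_(a <- r) F a <= \sum_(a <- r') F a.
Proof.
move=> ur ur' rr' F0.
rewrite (perm_big [seq a <- r' | a \in r]) /=; last first.
  apply: uniq_perm; rewrite ?filter_uniq // => a; rewrite mem_filter.
  by case: (boolP (a \in r)) => // /rr' ->.
rewrite big_filter big_mkcond /=; apply: ler_sum => a _.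
by case: ifP.
Qed.

Lemma half_sum (R : realType) K : \sum_(j < K) (2^-1 : R) ^+ j <= 2.
Proof.
suff -> : \sum_(j < K) (2^-1 : R) ^+ j = 2 - 2 * 2^-1 ^+ K.
  by rewrite gerBl mulr_ge0 // exprn_ge0.
elim: K => [|K IH]; first by rewrite big_ord0 expr0; ring.
by rewrite big_ord_recr /= IH exprS; field.
Qed.

Lemma sum_half (R : realType) K : \sum_(a <- box K) (2^-1 : R) ^+ adeg a <= 2 ^+ d.
Proof.
rewrite -sum_box.
apply: (@le_trans _ _ (\prod_(i < d) \sum_(j < K) (2^-1 : R) ^+ j)).
  rewrite bigA_distr_bigA /=; apply: ler_sum => a _.
  rewrite /adeg expr_sum; rewrite (eq_bigr (fun i => 2^-1 ^+ a i)) //.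
  by move=> i _; rewrite ffunE.
rewrite prodr_const card_ord; apply: lerXn2r; rewrite ?nnegrE //.
  by apply: sumr_ge0 => j _; rewrite exprn_ge0.
exact: half_sum.
Qed.

End Boxes.

(** * Equivalence of power series germs and homogeneous series germs *)

Section Germ.
Variables (R : realType) (d : nat).
Local Notation C := (Cplx R).
Local Notation V := 'cV[C]_d.
Local Notation expo := {ffun 'I_d -> nat}.

Lemma holo_on_GH (rho : R) (f : V -> C) : 0 < rho -> holo_on rho f -> GH f.
Proof.
move=> r0 [c [[M cM] cv]].
have {}cM a : rn (c a) * rho ^+ adeg a <= M.
  by have := cM a; rewrite rnE -rcX -rcM => h; rewrite -lecR.
have M0 : 0 <= M.
  by apply: le_trans (cM [ffun=> 0%N]); rewrite mulr_ge0 ?rn_ge0 // exprn_ge0 // ltW.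
(* Halving the radius turns Cauchy's estimates into a convergent sum of bounds, at most M * 2 ^+
   d. *)
pose rho' := 2^-1 * rho.
have r'0 : 0 < rho' by rewrite mulr_gt0.
pose phi N x := \sum_(a <- degs d N) c a * mon x a.
pose B N := \sum_(a <- degs d N) rn (c a).
have hphi N : hp N (B N) (phi N).
  exists [seq (c a, a) | a <- degs d N]; split.
  - by apply/allP => _ /mapP[a ad ->] /=; rewrite -mem_degs.
  - by rewrite big_map.
  - by move=> x; rewrite big_map.
have cb (q : R) a : 0 <= q -> rn (c a) * (q * rho') ^+ adeg a <=
    M * (2^-1 ^+ adeg a * q ^+ adeg a).
  move=> q0; rewrite /rho' !exprMn.
  have -> : rn (c a) * (q ^+ adeg a * (2^-1 ^+ adeg a * rho ^+ adeg a)) =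
    (rn (c a) * rho ^+ adeg a) * (2^-1 ^+ adeg a * q ^+ adeg a) by ring.
  by apply: ler_wpM2r => //; rewrite mulr_ge0 // exprn_ge0.
exists rho', (M * 2 ^+ d), phi, B; split => //; split => //.
- move=> K.
  rewrite (eq_bigr (fun N : 'I_K => \sum_(a <- degs d N) rn (c a) * rho' ^+ adeg a)); last first.
    move=> N _; rewrite /B big_distrl /= big_seq [RHS]big_seq.
    by apply: eq_bigr => a; rewrite mem_degs => /eqP ->.
  rewrite (sum_graded (fun a => rn (c a) * rho' ^+ adeg a) (leqnn K)).
  apply: (@le_trans _ _ (\sum_(a <- box d K) M * 2^-1 ^+ adeg a)).
    rewrite big_mkcond; apply: ler_sum => a _.
    case: ifP => _; last by rewrite mulr_ge0 // exprn_ge0.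
    by have := cb 1 a ler01; rewrite mul1r expr1n mulr1.
  by rewrite -big_distrr /=; apply: ler_wpM2l => //; exact: sum_half.
- move=> q x /andP[q0 q1] xq K.
  have xr : `|x| < rho%:C :> C.
    rewrite rn_lt (le_lt_trans xq) // /rho' mulrA -[ltRHS]mul1r ltr_pM2r //.
    by have := ltW q1; lra.
  have {}cv := cv x xr.
  apply/ler_addgt0Pr => e e0.
  have [N0 N0P] := (cvg_rnP _ _).1 cv e e0.
  pose K' := maxn N0 K.
  have KK' : (K <= K')%N by rewrite leq_maxr.
  have h1 : rn (\sum_(a <- box d K') c a * mon x a - f x) < e.
    rewrite -(sum_box (fun a => c a * mon x a)).
    have := N0P K' (leq_maxl _ _); congr (rn (_ - _) < _).
    apply: eq_bigr => a _; congr (_ * _); apply: eq_bigr => i _.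
    by rewrite ffunE.
  apply: le_trans (rn_tri (\sum_(a <- box d K') c a * mon x a) _ _) _.
  rewrite addrC; apply: lerD; last by rewrite rnBC; exact: ltW.
  rewrite (sum_graded (fun a => c a * mon x a) KK').
  rewrite (bigID (fun a => (adeg a < K)%N)) /= addrAC subrr add0r.
  apply: le_trans (rn_sum _ _ _) _.
  apply: (@le_trans _ _ (\sum_(a <- box d K') M * q ^+ K * 2^-1 ^+ adeg a)).
    rewrite big_mkcond; apply: ler_sum => a _.
    case: ifP => [aK|_]; last by rewrite !mulr_ge0 // exprn_ge0.
    rewrite rnM; apply: (@le_trans _ _ (rn (c a) * (q * rho') ^+ adeg a)).
      apply: ler_wpM2l; first exact: rn_ge0.
      apply: le_trans (mon_bound _ _) _.
      exact: lerX_rn.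
    apply: le_trans (cb _ _ q0) _; rewrite -mulrA; apply: ler_wpM2l => //.
    rewrite mulrC; apply: ler_wpM2r; first by rewrite exprn_ge0.
    by apply: ler_wiXn2l; rewrite ?(ltW q1) // leqNgt.
  rewrite -big_distrr /= [leLHS]mulrAC; apply: ler_wpM2r; first exact: exprn_ge0.
  by apply: ler_wpM2l => //; exact: sum_half.
Qed.

Lemma sum_fibre (A : pzRingType) (s : seq (C * expo)) N (G : C * expo -> A) :
  all (fun u => adeg u.2 == N) s ->
  \sum_(a <- degs d N) \sum_(u <- s | u.2 == a) G u = \sum_(u <- s) G u.
Proof.
move=> sN; rewrite (exchange_big_dep predT) //= big_seq [RHS]big_seq.
apply: eq_bigr => u us.
rewrite -big_filter (perm_big [:: u.2]) /= ?big_seq1 //.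
apply: uniq_perm => //; first by rewrite filter_uniq // uniq_degs.
move=> a; rewrite mem_filter mem_degs inE eq_sym.
by case: eqP => // ->; rewrite (allP sN).
Qed.

Lemma GH_holo_germ (f : V -> C) : GH f -> holo_germ f.
Proof.
move=> [rho [M [phi [B [r0 h]]]]]; exists rho => //.
have M0 := GHr_M0 h; case: h => h1 h2 h3.
have [s sP] := choice h1.
have B0 N := hp_ge0 (h1 N).
(* The list for degree [adeg a] may repeat a monomial, so its coefficient is collected over all
   repetitions. *)
pose c (a : expo) := \sum_(u <- s (adeg a) | u.2 == a) u.1.
have cE N x : \sum_(a <- degs d N) c a * mon x a = phi N x.
  have [s1 s2 s3] := sP N; rewrite s3 -(sum_fibre _ s1).
  rewrite big_seq [RHS]big_seq; apply: eq_bigr => a.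
  rewrite mem_degs => /eqP aN; rewrite /c aN big_distrl /=.
  by apply: eq_bigr => u /eqP ->.
have cB N : \sum_(a <- degs d N) rn (c a) <= B N.
  have [s1 s2 s3] := sP N; apply: le_trans s2; rewrite -(sum_fibre _ s1).
  rewrite big_seq [leRHS]big_seq; apply: ler_sum => a.
  by rewrite mem_degs => /eqP aN; rewrite /c aN; exact: rn_sum.
have cM a : rn (c a) * rho ^+ adeg a <= M.
  apply: le_trans (h2 (adeg a).+1); rewrite big_ord_recr /=.
  rewrite -[leLHS]add0r; apply: lerD.
    by apply: sumr_ge0 => i _; rewrite mulr_ge0 // exprn_ge0 // ltW.
  apply: ler_wpM2r; first by rewrite exprn_ge0 // ltW.
  apply: le_trans (cB (adeg a)).
  rewrite (perm_big (a :: rem a (degs d (adeg a)))) /=; last first.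
    by apply: perm_to_rem; rewrite mem_degs.
  by rewrite big_cons lerDl; apply: sumr_ge0 => *; exact: rn_ge0.
exists c; split.
  by exists M => a; rewrite rnE -rcX -rcM lecR; exact: cM.
move=> x; rewrite rn_lt => xr; apply/cvg_rnP => e e0.
pose q := rn x / rho.
have q01 : 0 <= q < 1.
  by rewrite divr_ge0 ?rn_ge0 ?ltW //= ltr_pdivrMr // mul1r.
have xq : rn x <= q * rho by rewrite /q divfK // gt_eqF.
have /andP[q0 q1] := q01.
have qr0 := le_trans (rn_ge0 x) xq.
have [K0 K0P] := geo_small (M + M) q01 e0.
exists K0 => K KK; apply: le_lt_trans (K0P K KK).
rewrite rnBC.
have -> : \sum_(a : {ffun 'I_d -> 'I_K}) c [ffun i => val (a i)] * \prod_i x i 0 ^+ a i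
   = \sum_(a <- box d K) c a * mon x a.
  rewrite -(sum_box (fun a => c a * mon x a)); apply: eq_bigr => a _.
  by congr (_ * _); apply: eq_bigr => i _; rewrite ffunE.
rewrite (bigID (fun a => (adeg a < K)%N)) /=.
rewrite -(sum_graded (fun a => c a * mon x a) (leqnn K)).
rewrite (eq_bigr (fun N : 'I_K => phi N x)) => [|N _]; last exact: cE.
rewrite opprD addrA mulrDl; apply: le_trans (rnB _ _) _.
apply: lerD; first exact: h3.
apply: le_trans (rn_sum _ _ _) _.
(* Exceeds every total degree occurring in the cube, so that the sum over the cube is dominated by a
   graded sum. *)
pose T := (d * K).+1.
have aT a : a \in box d K -> (adeg a < T)%N.
  rewrite mem_box => /forallP aK; rewrite ltnS /adeg.
  apply: (@leq_trans (\sum_(i < d) K)); last by rewrite sum_nat_const card_ord.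
  by apply: leq_sum => i _; exact: ltnW.
apply: (@le_trans _ _ (\sum_(a <- box d K) rn (c a) * rho ^+ adeg a * q ^+ K)).
  rewrite big_mkcond; apply: ler_sum => a _.
  case: ifP => [aK|_]; last by rewrite !mulr_ge0 ?rn_ge0 // exprn_ge0 // ltW.
  rewrite rnM -mulrA; apply: ler_wpM2l; first exact: rn_ge0.
  apply: le_trans (mon_bound _ _) _.
  apply: (@le_trans _ _ ((q * rho) ^+ adeg a)).
    exact: lerX_rn.
  rewrite exprMn mulrC; apply: ler_wpM2l; first by rewrite exprn_ge0 // ltW.
  by apply: ler_wiXn2l; rewrite ?(ltW q1) // leqNgt.
rewrite -big_distrl /=; apply: ler_wpM2r; first by rewrite exprn_ge0.
apply: le_trans (h2 T).
apply: (@le_trans _ _ (\sum_(N < T) \sum_(a <- degs d N) rn (c a) * rho ^+ adeg a)); last first.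
  apply: ler_sum => N _.
  apply: (@le_trans _ _ (\sum_(a <- degs d N) rn (c a) * rho ^+ N)).
    by rewrite big_seq [leRHS]big_seq; apply: ler_sum => a; rewrite mem_degs => /eqP ->.
  rewrite -big_distrl /=; apply: ler_wpM2r => //.
  by rewrite exprn_ge0 // ltW.
rewrite (sum_graded (fun a => rn (c a) * rho ^+ adeg a) (leq_maxr K T)) -[leRHS]big_filter.
apply: sub_sum => [||a aK|a].
- exact: uniq_box.
- by rewrite filter_uniq // uniq_box.
- rewrite mem_filter aT // mem_box; apply/forallP => i.
  by move: aK; rewrite mem_box => /forallP/(_ i) aK; rewrite (leq_trans aK) // leq_maxl.
- by rewrite mulr_ge0 ?rn_ge0 // exprn_ge0 // ltW.
Qed.

Lemma holo_germ_GH (f : V -> C) : holo_germ f -> GH f.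
Proof. by move=> [rho r0]; exact: holo_on_GH. Qed.

End Germ.

(** * Weighted expansions in two variables *)

Section Weights.
Variables (A : pzRingType) (k : nat).
Hypothesis k0 : (0 < k)%N.
Implicit Types u v : nat -> nat -> A.

(* The part of degree [N] of the double series [u], for the weights [1] and [k]. *)
Definition wpart u N : A :=
  \sum_(i < N.+1) \sum_(j < N.+1 | (i + k * j == N)%N) u i j.

Definition conv2 u v i j : A :=
  \sum_(i1 < i.+1) \sum_(j1 < j.+1) u i1 j1 * v (i - i1)%N (j - j1)%N.

Lemma sum_widen (B : nmodType) (F : nat -> B) m n : (m <= n)%N ->
  (forall i, (m <= i)%N -> F i = 0) -> \sum_(i < n) F i = \sum_(i < m) F i.
Proof.
move=> /subnKC <- F0; rewrite big_split_ord /= [X in _ + X]big1 ?addr0 // => i _.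
by rewrite F0 // leq_addr.
Qed.

Lemma wpart_widen u N K1 K2 : (N < K1)%N -> (N < K2)%N ->
  wpart u N = \sum_(i < K1) \sum_(j < K2 | (i + k * j == N)%N) u i j.
Proof.
move=> NK1 NK2; rewrite /wpart.
transitivity (\sum_(i < K1) \sum_(j < N.+1 | (i + k * j == N)%N) u i j).
  rewrite (sum_widen (F := fun i => \sum_(j < N.+1 | (i + k * j == N)%N) u i j) NK1) //.
  by move=> i Ni; rewrite big1 // => j /eqP; lia.
apply: eq_bigr => i _; rewrite [LHS]big_mkcond [RHS]big_mkcond /=.
rewrite (sum_widen (F := fun j => if (i + k * j == N)%N then u i j else 0) NK2) //.
by move=> j Nj; case: eqP => //; nia.
Qed.

Lemma wpart_sum u K K1 K2 : (K <= K1)%N -> (K <= K2)%N ->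
  \sum_(N < K) wpart u N =
  \sum_(i < K1) \sum_(j < K2 | (i + k * j < K)%N) u i j.
Proof.
move=> KK1 KK2.
rewrite (eq_bigr (fun N : 'I_K =>
  \sum_(i < K1) \sum_(j < K2 | (i + k * j == N)%N) u i j)); last first.
  by move=> N _; apply: wpart_widen; [exact: leq_trans KK1|exact: leq_trans KK2].
rewrite exchange_big /=; apply: eq_bigr => i _.
rewrite (exchange_big_dep predT) //= [RHS]big_mkcond /=; apply: eq_bigr => j _.
case: ltnP => h.
  by rewrite (big_pred1 (Ordinal h)) // => N; rewrite eq_sym.
by rewrite big1 // => N /eqP e; move: h; rewrite e leqNgt ltn_ord.
Qed.

Lemma wpart_ext u v N : (forall i j, u i j = v i j) -> wpart u N = wpart v N.
Proof. by move=> uv; apply: eq_bigr => i _; apply: eq_bigr => j _. Qed.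

(** Letting all indices range over one square makes the later exchanges of sums free of dependent
    bounds. *)
Lemma conv2_pairs u v S i j : (i < S)%N -> (j < S)%N ->
  conv2 u v i j = \sum_(p : 'I_S * 'I_S)
    \sum_(q : 'I_S * 'I_S | (p.1 + q.1 == i)%N && (p.2 + q.2 == j)%N)
      u p.1 p.2 * v q.1 q.2.
Proof.
move=> iS jS; rewrite /conv2.
rewrite (big_ord_widen S (fun i1 => \sum_(j1 < j.+1) u i1 j1 * v (i - i1)%N (j - j1)%N) iS).
rewrite (eq_bigr (fun i1 : 'I_S =>
  \sum_(j1 < S | (j1 < j.+1)%N) u i1 j1 * v (i - i1)%N (j - j1)%N)); last first.
  move=> i1 _.
  by rewrite (big_ord_widen S (fun j1 => u i1 j1 * v (i - i1)%N (j - j1)%N) jS).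
rewrite pair_big /= big_mkcond /=; apply: eq_bigr => -[p1 p2] _ /=.
rewrite !ltnS; case: ifP => [/andP[p1i p2j]|h].
  have h1 : (i - p1 < S)%N by rewrite (leq_ltn_trans (leq_subr _ _)).
  have h2 : (j - p2 < S)%N by rewrite (leq_ltn_trans (leq_subr _ _)).
  rewrite (big_pred1 (Ordinal h1, Ordinal h2)) // => -[q1 q2] /=.
  rewrite xpair_eqE -!val_eqE /=; lia.
by rewrite big1 // => -[q1 q2] /=; lia.
Qed.

Lemma wpart_pairs u S n : (n < S)%N ->
  wpart u n = \sum_(p : 'I_S * 'I_S | (p.1 + k * p.2 == n)%N) u p.1 p.2.
Proof.
move=> nS; rewrite (wpart_widen u nS nS) pair_big_dep /=.
by apply: eq_bigl => -[p1 p2].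
Qed.

(** Weights are additive, so both sides are the sum over the pairs of exponents whose weights add up
    to N. *)
Lemma wpart_conv u v N :
  wpart (conv2 u v) N = \sum_(n < N.+1) wpart u n * wpart v (N - n)%N.
Proof.
set S := N.+1; have SE : S = N.+1 by [].
pose T := ('I_S * 'I_S)%type; pose wt (p : T) := (p.1 + k * p.2)%N.
transitivity (\sum_(a : T) \sum_(b : T | (wt a + wt b == N)%N) u a.1 a.2 * v b.1 b.2).
  rewrite (@wpart_pairs _ S) //.
  rewrite (eq_bigr _ (fun (p : T) _ => conv2_pairs u v (ltn_ord p.1) (ltn_ord p.2))).
  rewrite exchange_big /=; apply: eq_bigr => a _.
  rewrite (exchange_big_dep predT) //= [RHS]big_mkcond /=; apply: eq_bigr => b _.
  case: eqP => h.
    have h1 : (a.1 + b.1 < S)%N by move: h; rewrite /wt; lia.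
    have h2 : (a.2 + b.2 < S)%N by move: h; rewrite /wt; nia.
    rewrite (big_pred1 (Ordinal h1, Ordinal h2)) // => -[p1 p2] /=.
    rewrite xpair_eqE -!val_eqE /= [in RHS]eq_sym [X in _ = _ && X]eq_sym.
    apply/andP/idP => [[_ ->//]|/andP[/eqP e1 /eqP e2]].
    by rewrite -e1 -e2 !eqxx; split => //; apply/eqP; move: h; rewrite /wt /=; lia.
  rewrite big1 // => -[p1 p2] /= /andP[/eqP e /andP[/eqP e1 /eqP e2]].
  by case: h; rewrite /wt -e -e1 -e2; lia.
rewrite (eq_bigr (fun n : 'I_S => \sum_(a : T | wt a == n) \sum_(b : T | wt b == (N - n)%N)
   u a.1 a.2 * v b.1 b.2)); last first.
  move=> n _; rewrite (wpart_pairs u (ltn_ord n)).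
  rewrite (@wpart_pairs v S) ?ltnS ?leq_subr // big_distrl /=.
  by apply: eq_bigr => a _; rewrite big_distrr.
rewrite [RHS](exchange_big_dep predT) //=; apply: eq_bigr => a _.
rewrite [RHS](exchange_big_dep predT) //= [LHS]big_mkcond /=; apply: eq_bigr => b _.
case: eqP => h.
  have h1 : (wt a < S)%N by move: h; lia.
  rewrite (big_pred1 (Ordinal h1)) // => n /=; rewrite -val_eqE /= [RHS]eq_sym.
  by case: eqP => //= e; apply/eqP; move: h e; lia.
rewrite big1 // => n /andP[/eqP e1 /eqP e2]; case: h.
by rewrite e1 e2; have := ltn_ord n; lia.
Qed.

End Weights.

(** * Completeness and the summation of homogeneous series *)

Section Complete.
Variable R : realType.
Local Notation C := (Cplx R).

Lemma real_complete (u : nat -> R) (c q : R) : 0 <= q < 1 ->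
  (forall m n, (m <= n)%N -> `|u n - u m| <= c * q ^+ m) ->
  exists l, forall n, `|l - u n| <= c * q ^+ n.
Proof.
move=> q01 h.
have cv : cvg (u @ \oo).
  apply: cauchy_cvg; apply: cauchy_exP => e e0.
  have [K0 K0P] := geo_small c q01 e0.
  exists (u K0), K0 => // n Kn; rewrite /ball /= distrC.
  by apply: le_lt_trans (h _ _ Kn) _; exact: K0P.
exists (lim (u @ \oo)) => n.
apply/ler_addgt0Pr => e e0.
have [N _ NP] : \forall m \near \oo, `|lim (u @ \oo) - u m| < e.
  by move/cvgrPdist_lt : cv; exact.
have := NP (maxn N n) (leq_maxl _ _); have := h n (maxn N n) (leq_maxr _ _).
rewrite /= => h1 h2.
have -> : lim (u @ \oo) - u n =
  (lim (u @ \oo) - u (maxn N n)) + (u (maxn N n) - u n) by rewrite addrA subrK.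
by apply: le_trans (ler_normD _ _) _; rewrite addrC lerD // ltW.
Qed.

Lemma rn_Re (z : C) : `|complex.Re z| <= rn z.
Proof. by rewrite -lecR -rnE; exact: normc_ge_Re. Qed.

Lemma rn_Im (z : C) : `|complex.Im z| <= rn z.
Proof.
case: z => a b /=; rewrite /rn normc_def /= -sqrtr_sqr ler_sqrt.
  by rewrite lerDr sqr_ge0.
by rewrite addr_ge0 // sqr_ge0.
Qed.

Lemma rn_ReIm (z : C) : rn z <= `|complex.Re z| + `|complex.Im z|.
Proof.
case: z => a b /=; rewrite /rn normc_def /=.
rewrite -[leRHS]ger0_norm ?addr_ge0 // -sqrtr_sqr ler_sqrt ?sqr_ge0 //.
rewrite sqrrD !real_normK ?num_real //.
by have := mulr_ge0 (normr_ge0 a) (normr_ge0 b); lra.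
Qed.

Lemma complex_complete (u : nat -> C) (c q : R) : 0 <= q < 1 ->
  (forall m n, (m <= n)%N -> rn (u n - u m) <= c * q ^+ m) ->
  exists l, forall n, rn (l - u n) <= (c + c) * q ^+ n.
Proof.
move=> q01 h.
have [|a aP] := @real_complete (fun n => complex.Re (u n)) c q q01.
  move=> m n mn; apply: le_trans (h m n mn).
  by have := rn_Re (u n - u m); rewrite raddfB.
have [|b bP] := @real_complete (fun n => complex.Im (u n)) c q q01.
  move=> m n mn; apply: le_trans (h m n mn).
  by have := rn_Im (u n - u m); rewrite raddfB.
exists (a +i* b) => n; apply: le_trans (rn_ReIm _) _.
by rewrite mulrDl; apply: lerD; [have := aP n|have := bP n]; case: (u n).
Qed.

(** The limit at x is estimated with the least ratio [rn x / rho], which serves all admissible q at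
    once; outside the ball its value is arbitrary. *)
Lemma GHr_exists d (rho M : R) (phi : nat -> 'cV[C]_d -> C) (B : nat -> R) :
  0 < rho -> (forall N, hp N (B N) (phi N)) ->
  (forall K, \sum_(N < K) B N * rho ^+ N <= M) ->
  exists f, GHr rho M f phi B.
Proof.
move=> r0 h1 h2.
have M0 : 0 <= M by have := h2 0%N; rewrite big_ord0.
have B0 N := hp_ge0 (h1 N).
have /choice[f fP] x : exists l, rn x < rho -> forall q, 0 <= q < 1 ->
    rn x <= q * rho -> forall n, rn (l - \sum_(N < n) phi N x) <= (M + M) * q ^+ n.
  have [xr|] := ltP (rn x) rho; last by exists 0 => //; rewrite ltNge.
  pose q := rn x / rho.
  have q01 : 0 <= q < 1.
    by rewrite divr_ge0 ?rn_ge0 ?ltW //= ltr_pdivrMr // mul1r.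
  have xq : rn x <= q * rho by rewrite /q divfK // gt_eqF.
  have [l lP] := complex_complete q01
    (fun m n => hp_tail (m := m) (n := n) (ltW r0) h1 h2 q01 xq).
  exists l => _ q' /andP[q'0 q'1] xq' n; apply: le_trans (lP n) _.
  apply: ler_wpM2l; first exact: addr_ge0.
  apply: lerXn2r; rewrite ?nnegrE //; first by case/andP: q01.
  by rewrite /q ler_pdivrMr.
exists f; apply: (@GHr_improve _ _ _ _ (M + M)) => //; first exact: ltW.
move=> q x q01 xq K; apply: fP => //.
by apply: le_lt_trans xq _; rewrite -[ltRHS]mul1r ltr_pM2r //; case/andP: q01.
Qed.

End Complete.

(** * Germs of two variables and their coefficient arrays *)

Section Arrays.
Variable R : realType.
Local Notation C := (Cplx R).
Implicit Types (c : nat -> nat -> C) (F G : C -> C -> C) (t w z : C).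

Definition bdd c := exists M tau : R,
  [/\ 0 <= M, 1 <= tau & forall i j, rn (c i j) <= M * tau ^+ (i + j)].

Definition tm c t w i j : C := c i j * t ^+ i * w ^+ j.

Definition rect c K1 K2 t w : C := \sum_(i < K1) \sum_(j < K2) tm c t w i j.

Definition fun2 F (x : 'cV[C]_2) : C := F (x 0 0) (x 1 0).

Definition mk2 t w : 'cV[C]_2 := \col_i (if i == 0 then t else w).

Definition GH2 F := GH (fun2 F).

(** [c] is the Taylor array of [F]: with both weights equal to 1 the weighted parts are the
    homogeneous ones. *)
Definition AG c F := bdd c /\ exists rho M B, 0 < rho /\
  GHr rho M (fun2 F) (fun N x => wpart 1 (tm c (x 0 0) (x 1 0)) N) B.

Lemma mk2_0 t w : mk2 t w 0 0 = t. Proof. by rewrite mxE. Qed.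
Lemma mk2_1 t w : mk2 t w 1 0 = w. Proof. by rewrite mxE. Qed.

Lemma mk2E (x : 'cV[C]_2) : x = mk2 (x 0 0) (x 1 0).
Proof.
apply/matrixP => i j; rewrite (ord1 j) mxE.
case: eqP => [->//|]; case: i => -[|[|i]] // hi ne.
  by case: ne; apply: val_inj.
by congr (x _ _); apply: val_inj.
Qed.

Lemma fun2_mk2 F t w : fun2 F (mk2 t w) = F t w.
Proof. by rewrite /fun2 mk2_0 mk2_1. Qed.

Lemma rn_mk2_lt t w (a : R) : rn t < a -> rn w < a -> rn (mk2 t w) < a.
Proof.
move=> ta wa; apply: rn_col_lt => [|i]; first exact: le_lt_trans (rn_ge0 t) ta.
by rewrite mxE; case: ifP.
Qed.

Lemma AG_GH2 c F : AG c F -> GH2 F.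
Proof. by move=> [_ [r [M [B [r0 h]]]]]; do 4!eexists; split; first exact: r0; exact: h. Qed.

(** As tau is at least 1, a term of weight N = i + k * j is at most M * (tau * a) ^+ N. Halving 2 *
    tau * a frees the factor (2 * tau * a) ^+ K for N at least K and leaves two geometric series of
    ratio 1/2, whence the constant 4. *)
Lemma weight_tail k c (M tau a : R) t w K K1 K2 : (0 < k)%N ->
  0 <= M -> 1 <= tau -> (forall i j, rn (c i j) <= M * tau ^+ (i + j)) ->
  rn t <= a -> rn w <= a ^+ k -> 2 * tau * a <= 1 -> (K <= K1)%N -> (K <= K2)%N ->
  rn (rect c K1 K2 t w - \sum_(N < K) wpart k (tm c t w) N) <=
    4 * M * (2 * tau * a) ^+ K.
Proof.
move=> k0 M0 tau1 cM ta wa a1 KK1 KK2.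
have a0 : 0 <= a := le_trans (rn_ge0 t) ta.
have tau0 : 0 <= tau by apply: le_trans tau1.
have ta0 : 0 <= tau * a by rewrite mulr_ge0.
have tta0 : 0 <= 2 * tau * a by rewrite -mulrA mulr_ge0.
rewrite (wpart_sum k0 _ KK1 KK2) /rect -sumrB.
apply: le_trans (rn_sum _ _ _) _.
apply: (@le_trans _ _ (\sum_(i < K1) \sum_(j < K2)
   M * (2 * tau * a) ^+ K * (2^-1 ^+ i * 2^-1 ^+ j))).
  apply: ler_sum => i _.
  rewrite (bigID (fun j : 'I_K2 => (i + k * j < K)%N)) /= addrAC subrr add0r.
  apply: le_trans (rn_sum _ _ _) _; rewrite big_mkcond /=.
  apply: ler_sum => j _; case: ifP => [|_]; last first.
    by rewrite !mulr_ge0 // exprn_ge0.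
  rewrite -leqNgt => Kij; rewrite /tm !rnM !rnX.
  apply: (@le_trans _ _ (M * tau ^+ (i + j) * a ^+ i * (a ^+ k) ^+ j)).
    apply: ler_pM; rewrite ?mulr_ge0 ?exprn_ge0 ?rn_ge0 //.
      apply: ler_pM; rewrite ?exprn_ge0 ?rn_ge0 //.
      exact: lerX_rn.
    exact: lerX_rn.
  rewrite -!mulrA; apply: ler_wpM2l => //.
  rewrite -exprM -exprD.
  apply: (@le_trans _ _ ((tau * a) ^+ (i + k * j))).
    rewrite exprMn; apply: ler_wpM2r; first exact: exprn_ge0.
    by apply: ler_weXn2l => //; nia.
  have e : tau * a = (2 * tau * a) * 2^-1 by field.
  rewrite [X in X ^+ _ <= _]e [leLHS]exprMn -exprD.
  apply: ler_pM; rewrite ?exprn_ge0 ?invr_ge0 //.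
    by rewrite [in leRHS]mulrA; exact: ler_wiXn2l.
  by apply: ler_wiXn2l => //; [rewrite invf_le1 ?ler1n // | nia].
rewrite (eq_bigr (fun i : 'I_K1 =>
  M * (2 * tau * a) ^+ K * 2^-1 ^+ i * \sum_(j < K2) 2^-1 ^+ j)); last first.
  by move=> i _; rewrite big_distrr /=; apply: eq_bigr => j _; rewrite !mulrA.
rewrite -big_distrl -big_distrr /=.
have -> : 4 * M * (2 * tau * a) ^+ K = M * (2 * tau * a) ^+ K * 2 * 2 by ring.
apply: ler_pM; rewrite ?mulr_ge0 ?exprn_ge0 ?half_sum //.
- by apply: sumr_ge0 => i _; rewrite exprn_ge0.
- by apply: sumr_ge0 => i _; rewrite exprn_ge0.
by apply: ler_wpM2l; rewrite ?mulr_ge0 ?exprn_ge0 ?half_sum.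
Qed.

Lemma hp_wpart c N :
  hp N (wpart 1 (fun i j => rn (c i j)) N)
    (fun x : 'cV[C]_2 => wpart 1 (tm c (x 0 0) (x 1 0)) N).
Proof.
have hpX (i : 'I_2) n : hp n 1 (fun x : 'cV[C]_2 => x i 0 ^+ n).
  elim: n => [|n IH]; first by have := hp_cst 2 (1 : C); rewrite rn1.
  have := hpM (hp_coord R i) IH; rewrite mul1r add1n.
  by apply: hp_ext => x; rewrite exprS.
apply: hp_sum => i _; apply: hp_sum => j /eqP ij.
have := hpM (hpM (hp_cst 2 (c i j)) (hpX 0 i)) (hpX 1 j).
by rewrite !mulr1 add0n; move: ij; rewrite mul1n => ->.
Qed.

Lemma AG_exists c : bdd c -> exists F, AG c F.
Proof.
move=> bc; have [M [tau [M0 tau1 cM]]] := bc.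
have tau0 : 0 < tau by apply: lt_le_trans tau1.
pose rho := (2 * tau)^-1; have r0 : 0 < rho by rewrite invr_gt0 mulr_gt0.
pose B N := wpart 1 (fun i j => rn (c i j)) N.
have [|f hf] := @GHr_exists R 2 rho (4 * M) _ B r0 (hp_wpart c).
  move=> K.
  rewrite (eq_bigr (fun N : 'I_K =>
    wpart 1 (fun i j => rn (c i j) * rho ^+ (i + j)) N)); last first.
    move=> N _; rewrite /B /wpart big_distrl /=; apply: eq_bigr => i _.
    by rewrite big_distrl /=; apply: eq_bigr => j; rewrite mul1n => /eqP ->.
  rewrite (wpart_sum _ _ (leqnn K) (leqnn K)) //.
  apply: (@le_trans _ _ (\sum_(i < K) \sum_(j < K) M * 2^-1 ^+ i * 2^-1 ^+ j)).
    apply: ler_sum => i _; rewrite big_mkcond; apply: ler_sum => j _.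
    case: ifP => _; last by rewrite !mulr_ge0 // exprn_ge0.
    apply: (@le_trans _ _ (M * tau ^+ (i + j) * rho ^+ (i + j))).
      by apply: ler_wpM2r => //; rewrite exprn_ge0 // ltW.
    rewrite -!mulrA -exprMn -exprD /rho; apply: ler_wpM2l => //.
    by rewrite invfM mulrCA mulfV ?gt_eqF // mulr1.
  rewrite (eq_bigr (fun i : 'I_K => M * 2^-1 ^+ i * \sum_(j < K) 2^-1 ^+ j)); last first.
    by move=> i _; rewrite big_distrr.
  rewrite -big_distrl -big_distrr /=.
  have -> : 4 * M = M * 2 * 2 by ring.
  apply: ler_pM; rewrite ?mulr_ge0 ?half_sum //.
  - by apply: sumr_ge0 => i _; rewrite exprn_ge0.
  - by apply: sumr_ge0 => i _; rewrite exprn_ge0.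
  by apply: ler_wpM2l; rewrite ?half_sum.
exists (fun t w => f (mk2 t w)); split => //.
exists rho, (4 * M), B; split => //.
by apply: GHr_ext hf => x; rewrite /fun2 -mk2E.
Qed.

Lemma GHr_ext_phi d (rho M : R) (f : 'cV[C]_d -> C) phi psi B :
  (forall N x, phi N x = psi N x) -> GHr rho M f phi B -> GHr rho M f psi B.
Proof.
move=> e [h1 h2 h3]; split => // [N|q x q01 xq K].
  by apply: hp_ext (h1 N) => x.
by have := h3 q x q01 xq K; under eq_bigr do rewrite e.
Qed.

Lemma GH2_AG F : GH2 F -> exists c, AG c F.
Proof.
move=> [rho [M [phi [B [r0 h]]]]]; have M0 := GHr_M0 h; have [h1 h2 h3] := h.
have [s sP] := choice h1.
have B0 N := hp_ge0 (h1 N).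
have ad (a : {ffun 'I_2 -> nat}) : adeg a = (a 0%R + a 1%R)%N.
  by rewrite /adeg big_ord_recl big_ord1; congr (_ + a _)%N; apply: val_inj.
pose c i j := \sum_(u <- s (i + j)%N | u.2 1 == j) u.1.
have bc : bdd c.
  exists M, (Num.max 1 rho^-1); split => //; first by rewrite le_max lexx.
  move=> i j; have [s1 s2 s3] := sP (i + j)%N.
  apply: (@le_trans _ _ (B (i + j)%N)).
    apply: le_trans s2; apply: le_trans (rn_sum _ _ _) _.
    rewrite big_mkcond; apply: ler_sum => u _; case: ifP => // _; exact: rn_ge0.
  apply: (@le_trans _ _ (M * rho^-1 ^+ (i + j))).
    rewrite exprVn ler_pdivlMr ?exprn_gt0 //.
    apply: le_trans (h2 (i + j).+1); rewrite big_ord_recr /= lerDr.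
    by apply: sumr_ge0 => n _; rewrite mulr_ge0 // exprn_ge0 // ltW.
  apply: ler_wpM2l => //; apply: lerXn2r; rewrite ?nnegrE ?invr_ge0 ?(ltW r0) //.
    by rewrite le_max ler01.
  by rewrite le_max lexx orbT.
exists c; split => //; exists rho, M, B; split => //.
apply: GHr_ext_phi h => N x.
have [s1 s2 s3] := sP N; rewrite s3 /wpart.
rewrite (exchange_big_dep predT) //=.
rewrite (eq_bigr (fun j : 'I_N.+1 => \sum_(u <- s N | u.2 1 == j) u.1 * mon x u.2)); last first.
  move=> j _.
  have jN : (N - j < N.+1)%N by lia.
  rewrite (big_pred1 (Ordinal jN)) => [|i /=]; last first.
    by rewrite mul1n -val_eqE /=; have := ltn_ord j; lia.
  rewrite /tm /c /= subnK; last by rewrite -ltnS.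
  rewrite -mulrA big_distrl /= big_seq_cond [RHS]big_seq_cond.
  apply: eq_bigr => u /andP[us /eqP uj]; congr (_ * _).
  have := allP s1 _ us; rewrite ad => /eqP uN.
  rewrite /mon big_ord_recl big_ord1; congr (_ ^+ _ * _).
    have -> // : (N - j)%N = u.2 0%R.
    by apply/eqP; rewrite -(eqn_add2r (u.2 1)) uN uj subnK // -ltnS.
  by rewrite -uj; congr (x _ _ ^+ (u.2 _)); apply: val_inj.
rewrite (exchange_big_dep predT) //= big_seq [RHS]big_seq; apply: eq_bigr => u us.
have uN : (u.2 1%R < N.+1)%N.
  by have := allP s1 _ us; rewrite ad => /eqP <-; rewrite ltnS leq_addl.
by rewrite (big_pred1 (Ordinal uN)) // => j; rewrite -val_eqE /= eq_sym.
Qed.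

(* [F] is the limit of the rectangular partial sums of [c]: weaker than [AG], but
   enough to identify two germs with the same array. *)
Definition arr c F := exists2 dl : R, 0 < dl & forall t w, rn t < dl -> rn w < dl ->
  forall eta : R, 0 < eta -> exists K0, forall K1 K2, (K0 <= K1)%N -> (K0 <= K2)%N ->
  rn (F t w - rect c K1 K2 t w) < eta.

Lemma AG_arr c F : AG c F -> arr c F.
Proof.
move=> [[M' [tau [M'0 tau1 cM]]] [rho [M [B [r0 h]]]]].
have tau0 : 0 < tau by apply: lt_le_trans tau1.
have M0 := GHr_M0 h; have [h1 h2 h3] := h.
pose dl := Num.min (4 * tau)^-1 (rho / 2).
have dl0 : 0 < dl by rewrite lt_min invr_gt0 mulr_gt0 //= divr_gt0.
exists dl => // t w td wd eta eta0.
have [K0 K0P] := @geo_small R (M + 4 * M') 2^-1 eta (half01 R) eta0.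
exists K0 => K1 K2 KK1 KK2; apply: le_lt_trans (K0P K0 (leqnn _)).
apply: le_trans (rn_tri (\sum_(N < K0) wpart 1 (tm c t w) N) _ _) _.
rewrite mulrDl; apply: lerD.
  have := h3 2^-1 (mk2 t w) (half01 R); rewrite fun2_mk2 mk2_0 mk2_1; apply.
  apply: ltW; apply: rn_mk2_lt; rewrite mulrC.
    by apply: lt_le_trans td _; rewrite /dl ge_min lexx orbT.
  by apply: lt_le_trans wd _; rewrite /dl ge_min lexx orbT.
rewrite rnBC.
have e : 2 * tau * (4 * tau)^-1 = 2^-1 by field; rewrite gt_eqF.
apply: le_trans (@weight_tail 1 c M' tau (4 * tau)^-1 t w K0 K1 K2
  _ M'0 tau1 cM _ _ _ KK1 KK2) _ => //.
- by apply: le_trans (ltW td) _; rewrite /dl ge_min lexx.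
- by rewrite expr1; apply: le_trans (ltW wd) _; rewrite /dl ge_min lexx.
- by rewrite e invf_le1 // ler1n.
by rewrite e.
Qed.

Lemma finite_bidisk (I : finType) (Q : I -> C -> C -> Prop) :
  (forall i, exists2 d : R, 0 < d & forall t w, rn t < d -> rn w < d -> Q i t w) ->
  exists2 d : R, 0 < d & forall i t w, rn t < d -> rn w < d -> Q i t w.
Proof.
apply: finite_min => i d1 d2 /andP[_ d21] h t w td wd; apply: h; exact: lt_le_trans d21.
Qed.

Lemma arr_unique c F G : arr c F -> arr c G -> exists2 dl : R, 0 < dl &
  forall t w, rn t < dl -> rn w < dl -> F t w = G t w.
Proof.
move=> [d1 d10 h1] [d2 d20 h2]; exists (Num.min d1 d2); first by rewrite lt_min d10.
move=> t w; rewrite !lt_min => /andP[t1 t2] /andP[w1 w2].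
apply: subr0_eq; apply: rn_eq0_eps => e e0.
have e20 : 0 < e / 2 by rewrite divr_gt0.
have [K1 K1P] := h1 t w t1 w1 _ e20.
have [K2 K2P] := h2 t w t2 w2 _ e20.
pose K := maxn K1 K2.
have := K1P K K (leq_maxl _ _) (leq_maxl _ _).
have := K2P K K (leq_maxr _ _) (leq_maxr _ _).
move=> a b; apply: le_trans (rn_tri (rect c K K t w) _ _) _.
rewrite [X in _ + X]rnBC [leRHS]splitr; apply: lerD; exact: ltW.
Qed.

(* In the chart [w = t ^+ k * z] the part of weighted degree [N] becomes
   [t ^+ N] times this polynomial in [z]. *)
Definition wpoly k c N : {poly C} := wpart k (fun i j => (c i j) *: 'X^j) N.

Lemma wpart_wpoly k c t z N :
  wpart k (tm c t (t ^+ k * z)) N = t ^+ N * (wpoly k c N).[z].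
Proof.
rewrite /wpoly /wpart horner_sum big_distrr /=; apply: eq_bigr => i _.
rewrite horner_sum big_distrr /=; apply: eq_bigr => j /eqP ijN.
have -> : t ^+ N = t ^+ (i + k * j) by rewrite ijN.
by rewrite /tm hornerZ hornerXn exprMn exprD exprM; ring.
Qed.

(** Rectangular sums mediate: they converge to [F] and differ from the sums by weight only by the
    tail of [weight_tail]. The bound is uniform in z, as is needed when z varies with w. *)
Lemma weight_expansion k c F : (0 < k)%N -> AG c F ->
  exists dl A tau : R, [/\ 0 < dl, 0 <= A, 1 <= tau & forall t z, rn t < dl -> rn z <= 1 ->
    tau * rn t <= 1 /\ rn (t ^+ k * z) <= rn t /\
    forall K, rn (F t (t ^+ k * z) - \sum_(N < K) t ^+ N * (wpoly k c N).[z]) <=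
      A * (tau * rn t) ^+ K].
Proof.
move=> k0 h; have [dl dl0 hdl] := AG_arr h.
have [[M [tau [M0 tau1 cM]]] _] := h.
have tau0 : 0 < tau by apply: lt_le_trans tau1.
exists (Num.min dl (2 * tau)^-1), (4 * M), (2 * tau); split.
- by rewrite lt_min dl0 invr_gt0 mulr_gt0.
- by rewrite mulr_ge0.
- by apply: le_trans tau1 _; rewrite ler_peMl ?ler1n // ltW.
move=> t z; rewrite lt_min => /andP[td t2] z1.
have t21 : 2 * tau * rn t <= 1.
  by rewrite mulrC -ler_pdivlMr ?mulr_gt0 // mul1r ltW.
have wk : rn (t ^+ k * z) <= rn t ^+ k.
  by rewrite rnM rnX ler_piMr // exprn_ge0 // rn_ge0.
have wt : rn (t ^+ k * z) <= rn t.
  apply: le_trans wk _; rewrite -{2}(expr1 (rn t)).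
  apply: ler_wiXn2l => //; first exact: rn_ge0.
  apply: le_trans t21; rewrite ler_peMl ?rn_ge0 //; lra.
split => //; split => // K.
have -> : \sum_(N < K) t ^+ N * (wpoly k c N).[z] =
   \sum_(N < K) wpart k (tm c t (t ^+ k * z)) N.
  by apply: eq_bigr => N _; rewrite wpart_wpoly.
apply/ler_addgt0Pr => e e0.
have [K0 K0P] := hdl t (t ^+ k * z) td (le_lt_trans wt td) e e0.
pose K' := maxn K0 K.
have := K0P K' K' (leq_maxl _ _) (leq_maxl _ _) => h1.
apply: le_trans (rn_tri (rect c K' K' t (t ^+ k * z)) _ _) _.
rewrite addrC; apply: lerD; last exact: ltW.
by apply: weight_tail => //; rewrite leq_maxr.
Qed.

(** The number (i + 1)(j + 1) of products is at most 2 ^ (i + j), which doubles the growth rate. *)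
Lemma bdd_conv2 c d : bdd c -> bdd d -> bdd (conv2 c d).
Proof.
move=> [M [tau [M0 tau1 cM]]] [M' [tau' [M'0 tau'1 dM]]].
pose T := Num.max tau tau'.
have T1 : 1 <= T by rewrite le_max tau1.
have T0 : 0 <= T by apply: le_trans T1.
have t0 : 0 <= tau by apply: le_trans tau1.
have t'0 : 0 <= tau' by apply: le_trans tau'1.
exists (M * M'), (2 * T); split; first exact: mulr_ge0.
  by apply: le_trans T1 _; rewrite ler_peMl ?ler1n.
move=> i j; rewrite /conv2; apply: le_trans (rn_sum _ _ _) _.
apply: (@le_trans _ _ (\sum_(i1 < i.+1) \sum_(j1 < j.+1) M * M' * T ^+ (i + j))).
  apply: ler_sum => i1 _; apply: le_trans (rn_sum _ _ _) _; apply: ler_sum => j1 _.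
  rewrite rnM.
  have -> : T ^+ (i + j) = T ^+ (i1 + j1) * T ^+ ((i - i1) + (j - j1)).
    rewrite -exprD; congr (_ ^+ _); have := ltn_ord i1; have := ltn_ord j1; lia.
  rewrite mulrACA; apply: ler_pM; rewrite ?rn_ge0 //.
    apply: le_trans (cM _ _) _; apply: ler_wpM2l => //.
    by apply: lerXn2r; rewrite ?nnegrE // le_max lexx.
  apply: le_trans (dM _ _) _; apply: ler_wpM2l => //.
  by apply: lerXn2r; rewrite ?nnegrE // le_max lexx orbT.
rewrite !sumr_const !card_ord -mulrnA -[leLHS]mulr_natl [in leRHS]exprMn.
rewrite [leRHS](_ : _ = M * M' * (2 ^+ (i + j) * T ^+ (i + j))); last by ring.
rewrite [leLHS](_ : _ = M * M' * ((j.+1 * i.+1)%:R * T ^+ (i + j))); last by ring.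
apply: ler_wpM2l; first exact: mulr_ge0.
apply: ler_wpM2r; first exact: exprn_ge0.
have n2 n : (n.+1 <= 2 ^ n)%N by exact: ltn_expl.
rewrite -natrX ler_nat addnC expnD; apply: leq_mul; exact: n2.
Qed.

Lemma AGM c d F G : AG c F -> AG d G -> AG (conv2 c d) (fun t w => F t w * G t w).
Proof.
move=> [bc [r [M [B [r0 h]]]]] [bd [r' [M' [B' [r'0 h']]]]].
split; first exact: bdd_conv2.
have m0 : 0 < Num.min r r' by rewrite lt_min r0.
do 3!eexists; split; first exact: m0.
apply: GHr_ext_phi (GHrM m0 (GHr_shrink _ h) (GHr_shrink _ h')); last 2 first.
- by rewrite m0 ge_min lexx.
- by rewrite m0 ge_min lexx orbT.
move=> N x /=; rewrite -wpart_conv //; apply: wpart_ext => i j.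
rewrite /tm /conv2 !big_distrl /=; apply: eq_bigr => i1 _.
rewrite !big_distrl /=; apply: eq_bigr => j1 _.
have -> : x 0 0 ^+ i = x 0 0 ^+ i1 * x 0 0 ^+ (i - i1).
  by rewrite -exprD subnKC // -ltnS.
have -> : x 1 0 ^+ j = x 1 0 ^+ j1 * x 1 0 ^+ (j - j1).
  by rewrite -exprD subnKC // -ltnS.
by ring.
Qed.

End Arrays.

(** * Convergent Hensel lifting *)

Section PolyNorm.
Variable R : realType.
Local Notation C := (Cplx R).
Implicit Types (p q : {poly C}).

(** The l^1 norm is submultiplicative, does not increase under [take_poly] and [drop_poly], and
    bounds the values on the unit disk: all that Hensel lifting asks of a norm. *)
Definition pn p : R := \sum_(i < size p) rn p`_i.

Lemma pnE n p : (size p <= n)%N -> pn p = \sum_(i < n) rn p`_i.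
Proof.
move=> pn; rewrite (sum_widen (F := fun i => rn p`_i) pn) // => i pi.
by rewrite nth_default // rn0.
Qed.

Lemma pn_ge0 p : 0 <= pn p.
Proof. by apply: sumr_ge0 => i _; exact: rn_ge0. Qed.

Lemma rn_coef p i : rn p`_i <= pn p.
Proof.
rewrite (@pnE (maxn (size p) i.+1)) ?leq_maxl //.
have h : (i < maxn (size p) i.+1)%N by rewrite leq_maxr.
rewrite (bigD1 (Ordinal h)) //= lerDl; apply: sumr_ge0 => *; exact: rn_ge0.
Qed.

Lemma pnD p q : pn (p + q) <= pn p + pn q.
Proof.
pose n := maxn (size p) (size q).
rewrite (@pnE n (p + q)); last exact: size_polyD.
rewrite (@pnE n p) ?leq_maxl // (@pnE n q) ?leq_maxr // -big_split /=.
by apply: ler_sum => i _; rewrite coefD rnD.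
Qed.

Lemma pnN p : pn (- p) = pn p.
Proof. by rewrite /pn size_polyN; apply: eq_bigr => i _; rewrite coefN rnN. Qed.

Lemma pn0 : pn 0 = 0. Proof. by rewrite /pn size_poly0 big_ord0. Qed.

Lemma pn_sum I (r : seq I) (P : pred I) (F : I -> {poly C}) :
  pn (\sum_(i <- r | P i) F i) <= \sum_(i <- r | P i) pn (F i).
Proof.
elim/big_rec2: _ => [|i x y Pi xy]; first by rewrite pn0.
by apply: le_trans (pnD _ _) _; rewrite lerD2l.
Qed.

Lemma pnM p q : pn (p * q) <= pn p * pn q.
Proof.
pose n := (size p + size q)%N.
rewrite (@pnE n (p * q)); last first.
  by apply: leq_trans (size_polyMleq _ _) _; rewrite leq_pred.
apply: (@le_trans _ _ (\sum_(i < n) \sum_(j < i.+1) rn p`_j * rn q`_(i - j))).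
  apply: ler_sum => i _; rewrite coefM; apply: le_trans (rn_sum _ _ _) _.
  by apply: ler_sum => j _; rewrite rnM.
rewrite (cauchy_sum (fun i => rn p`_i) (fun i => rn q`_i)).
rewrite (@pnE n p) ?leq_addr // big_distrl /=; apply: ler_sum => i _.
apply: ler_wpM2l; first exact: rn_ge0.
rewrite (@pnE n q) ?leq_addl //.
have -> : \sum_(j < n) rn q`_j = \sum_(j < (n - i) + (n - (n - i))) rn q`_j.
  by rewrite subnKC // leq_subr.
rewrite big_split_ord /= lerDl; apply: sumr_ge0 => *; exact: rn_ge0.
Qed.

Lemma pnXn n : pn 'X^n = 1.
Proof.
rewrite /pn size_polyXn big_ord_recr /= coefXn eqxx rn1 big1 ?add0r // => i _.
by rewrite coefXn ltn_eqF // rn0.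
Qed.

Lemma rn_horner p z : rn z <= 1 -> rn p.[z] <= pn p.
Proof.
move=> z1; rewrite horner_coef; apply: le_trans (rn_sum _ _ _) _.
apply: ler_sum => i _; rewrite rnM rnX ler_piMr ?rn_ge0 //.
by apply: exprn_ile1 => //; exact: rn_ge0.
Qed.

Lemma pn_take m p : pn (take_poly m p) <= pn p.
Proof.
rewrite (@pnE (maxn m (size p)) (take_poly _ _)); last first.
  by apply: leq_trans (size_take_poly _ _) _; exact: leq_maxl.
rewrite (@pnE (maxn m (size p)) p) ?leq_maxr //; apply: ler_sum => i _.
by rewrite coef_take_poly; case: ifP => // _; rewrite rn0 rn_ge0.
Qed.

Lemma pn_drop m p : pn (drop_poly m p) <= pn p.
Proof.
rewrite (@pnE (size p)); last by rewrite size_drop_poly leq_subr.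
rewrite (@pnE (m + size p) p) ?leq_addl // big_split_ord /=.
rewrite -[leLHS]add0r; apply: lerD.
  by apply: sumr_ge0 => *; exact: rn_ge0.
by apply: ler_sum => i _; rewrite coef_drop_poly addnC.
Qed.

End PolyNorm.

(** * A majorant for quadratic recursions *)

Section Majorant.
Variable R : realType.

(** Rescaled by s = 1/T, the partial sums S of y satisfy S (N + 1) <= K * (2 * M * tau * s + S N ^+
    2). The bound e = 1/(2K) is stable under this inequality, each of the two terms contributing at
    most e / 2. Bounded partial sums mean geometric growth of x. *)
Lemma convolution_majorant (x : nat -> R) (K M tau : R) :
  0 < K -> 0 <= M -> 0 < tau -> (forall n, 0 <= x n) ->
  (forall n, x n.+1 <= K * (M * tau ^+ n.+1 + \sum_(l < n) x l.+1 * x (n - l)%N)) ->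
  exists M' tau' : R, [/\ 0 <= M', 1 <= tau' & forall n, x n <= M' * tau' ^+ n].
Proof.
move=> K0 M0 tau0 x0 xr.
(* The term 2 * tau makes the ratio tau * s at most 1/2, the last term makes the contribution of M
   at most e / 2, and 1 ensures T >= 1. *)
pose T := 1 + 2 * tau + 8 * K ^+ 2 * M * tau.
have h1 : 0 <= 8 * K ^+ 2 * M * tau.
  by rewrite !mulr_ge0 // ?exprn_ge0 // ltW.
have T1 : 1 <= T by rewrite /T; lra.
have T0 : 0 < T by lra.
pose s := T^-1; have s0 : 0 < s by rewrite invr_gt0.
pose y n := x n * s ^+ n.
have y0 n : 0 <= y n by rewrite mulr_ge0 // exprn_ge0 // ltW.
pose e := (2 * K)^-1.
have e0 : 0 < e by rewrite invr_gt0 mulr_gt0.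
have ts : tau * s <= 2^-1.
  rewrite /s ler_pdivrMr // /T; lra.
have ts0 : 0 <= tau * s by rewrite mulr_ge0 // ltW.
have Ks : 8 * K ^+ 2 * M * (tau * s) <= 1.
  rewrite mulrA /s ler_pdivrMr // /T mul1r; lra.
have geo N : \sum_(i < N) M * (tau * s) ^+ i.+1 <= M * (tau * s) * 2.
  apply: (@le_trans _ _ (\sum_(i < N) M * (tau * s) * 2^-1 ^+ i)).
    apply: ler_sum => i _; rewrite exprS mulrA; apply: ler_wpM2l.
      by rewrite mulr_ge0.
    by apply: lerXn2r; rewrite ?nnegrE ?invr_ge0.
  rewrite -big_distrr /=; apply: ler_wpM2l; first by rewrite mulr_ge0.
  exact: half_sum.
have yr n : y n.+1 <= K * (M * (tau * s) ^+ n.+1 + \sum_(l < n) y l.+1 * y (n - l)%N).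
  rewrite /y; apply: le_trans (ler_wpM2r _ (xr n)) _.
    by rewrite exprn_ge0 // ltW.
  rewrite -mulrA; apply: ler_wpM2l; first exact: ltW.
  rewrite mulrDl exprMn mulrA lerD2l big_distrl /=; apply: ler_sum => l _.
  by rewrite mulrACA -exprD addSn subnKC // ltnW.
have S N : \sum_(i < N) y i.+1 <= e.
  elim: N => [|N IH]; first by rewrite big_ord0 ltW.
  apply: (@le_trans _ _ (\sum_(i < N.+1) K * (M * (tau * s) ^+ i.+1 +
      \sum_(l < i) y l.+1 * y (i - l)%N))).
    by apply: ler_sum => i _; exact: yr.
  rewrite -big_distrr big_split /=.
  have h2 : \sum_(i < N.+1) \sum_(l < i) y l.+1 * y (i - l)%N <= e * e.
    rewrite big_ord_recl big_ord0 add0r /=.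
    rewrite (eq_bigr (fun i : 'I_N => \sum_(l < i.+1) y l.+1 * y (i - l).+1)); last first.
      move=> i _; transitivity (\sum_(l < i.+1) y l.+1 * y (i.+1 - l)%N) => //.
      by apply: eq_bigr => l _; rewrite subSn // -ltnS.
    rewrite (cauchy_sum (fun l => y l.+1) (fun l => y l.+1)).
    apply: (@le_trans _ _ (\sum_(i < N) y i.+1 * e)).
      apply: ler_sum => i _; apply: ler_wpM2l => //.
      apply: le_trans IH.
      have -> : \sum_(j < N) y j.+1 = \sum_(j < (N - i) + (N - (N - i))) y j.+1.
        by rewrite subnKC // leq_subr.
      by rewrite big_split_ord /= lerDl; apply: sumr_ge0.
    by rewrite -big_distrl /=; apply: ler_wpM2r => //; exact: ltW.
  apply: le_trans (ler_wpM2l (ltW K0) (lerD (geo N.+1) h2)) _.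
  have Ke : K * e = 2^-1 by rewrite /e; field; rewrite gt_eqF.
  have : K * (M * (tau * s) * 2) <= 2^-1 * e.
    have -> : K * (M * (tau * s) * 2) = 8 * K ^+ 2 * M * (tau * s) * (2^-1 * e).
      by rewrite /e; field; rewrite gt_eqF.
    by apply: ler_piMl => //; rewrite mulr_ge0 // ltW.
  have -> : K * (M * (tau * s) * 2 + e * e) = K * (M * (tau * s) * 2) + K * e * e by ring.
  rewrite Ke; lra.
exists (x 0%N + e), T; split => //; first by rewrite addr_ge0 // ltW.
case=> [|n]; first by rewrite expr0 mulr1 lerDl ltW.
have : y n.+1 <= e.
  apply: le_trans (S n.+1); rewrite big_ord_recr /= lerDr.
  by apply: sumr_ge0.
rewrite /y /s exprVn ler_pdivrMr ?exprn_gt0 // => h.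
apply: le_trans h _; apply: ler_wpM2r; first by rewrite exprn_ge0 // ltW.
by rewrite lerDr.
Qed.

End Majorant.

(** * Hensel lifting with estimates *)

Section Hensel.
Variable R : realType.
Local Notation C := (Cplx R).
Variables (phi : nat -> {poly C}) (m : nat) (b : {poly C}).
Hypothesis phi0 : phi 0%N = 'X^m * b.
Hypothesis b0 : b`_0 != 0.

Lemma inverse_modXn : exists bs u : {poly C}, bs * b + u * 'X^m = 1.
Proof.
have cop : coprimep b 'X^m.
  apply: coprimep_expr; rewrite -['X]subr0 -polyC0 coprimep_XsubC.
  by rewrite /root horner_coef0.
by have /Bezout_eq1_coprimepP[[u v] /= h] := cop; exists u, v.
Qed.

(** [bs] inverts b modulo the m-th power of the variable, so r - A * b is divisible by that power
    when A is the truncation of r * bs. *)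
Lemma hensel_step (r : {poly C}) (bs u : {poly C}) : bs * b + u * 'X^m = 1 ->
  let A := take_poly m (r * bs) in
  'X^m * drop_poly m (r - A * b) + A * b = r.
Proof.
move=> h A; rewrite mulrC.
suff e : r - A * b = (r * u + drop_poly m (r * bs) * b) * 'X^m.
  have := poly_take_drop m (r - A * b).
  by rewrite {1}e take_polyMXn_0 add0r => ->; rewrite subrK.
have := poly_take_drop m (r * bs); rewrite -/A => h2.
have -> : A = r * bs - drop_poly m (r * bs) * 'X^m by rewrite -{1}h2 addrK.
set q := drop_poly m (r * bs).
have hr : r = r * (bs * b + u * 'X^m) by rewrite h mulr1.
rewrite {1}hr; ring.
Qed.

(** The new pair depends linearly on the residue left by the earlier ones, with a constant K
    independent of N; this puts the recursion in the form that [convolution_majorant] controls. *)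
Lemma hensel_formal : exists (K : R) (A B : nat -> {poly C}),
  [/\ 0 < K,
    A 0%N = 'X^m /\ B 0%N = b,
    forall N, (size (A N.+1) <= m)%N,
    forall N, phi N = \sum_(i < N.+1) A i * B (N - i)%N &
    forall N, pn (A N.+1) + pn (B N.+1) <=
      K * pn (phi N.+1 - \sum_(i < N) A i.+1 * B (N - i)%N)].
Proof.
have [bs [u hbs]] := inverse_modXn.
pose next (h : seq ({poly C} * {poly C})) N :=
  let r := phi N.+1 - \sum_(i < N) (nth (0, 0) h i.+1).1 * (nth (0, 0) h (N - i)%N).2 in
  let A := take_poly m (r * bs) in (A, drop_poly m (r - A * b)).
(* Course-of-values recursion: a step uses all earlier pairs, so the whole list is carried along. *)
pose fix hs N := if N is N'.+1 then rcons (hs N') (next (hs N') N')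
  else [:: ('X^m, b)].
have szhs N : size (hs N) = N.+1.
  by elim: N => //= N IH; rewrite size_rcons IH.
pose AB N := nth (0, 0) (hs N) N.
have hsE N i : (i <= N)%N -> nth (0, 0) (hs N) i = AB i.
  elim: N => [|N IH]; first by rewrite leqn0 => /eqP ->.
  rewrite leq_eqVlt => /orP[/eqP ->//|]; rewrite ltnS => iN.
  by rewrite /= nth_rcons szhs ltnS iN IH.
pose A N := (AB N).1; pose B N := (AB N).2.
pose r N := phi N.+1 - \sum_(i < N) A i.+1 * B (N - i)%N.
have ABS N : AB N.+1 = (take_poly m (r N * bs), drop_poly m (r N - take_poly m (r N * bs) * b)).
  rewrite /AB /= nth_rcons szhs ltnn eqxx /next.
  suff -> : \sum_(i < N) (nth (0, 0) (hs N) i.+1).1 * (nth (0, 0) (hs N) (N - i)%N).2 =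
    \sum_(i < N) A i.+1 * B (N - i)%N by [].
  by apply: eq_bigr => i _; rewrite !hsE // ?leq_subr.
have AS N : A N.+1 = take_poly m (r N * bs) by rewrite /A ABS.
have BS N : B N.+1 = drop_poly m (r N - A N.+1 * b) by rewrite /B ABS AS.
exists (1 + pn bs + pn bs * pn b), A, B; split => //.
- by rewrite -addrA ltr_wpDr // addr_ge0 ?mulr_ge0 ?pn_ge0.
- by move=> N; rewrite AS size_take_poly.
- case=> [|N]; first by rewrite big_ord1 phi0.
  rewrite big_ord_recl big_ord_recr /= subn0 /bump /= add1n subnn.
  have := hensel_step (r N) hbs; rewrite /= -AS -BS => h.
  rewrite (eq_bigr (fun i : 'I_N => A i.+1 * B (N - i)%N)); last first.
    by move=> i _; rewrite add1n subSS.
  have -> : phi N.+1 = r N + \sum_(i < N) A i.+1 * B (N - i)%N by rewrite subrK.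
  by rewrite -{1}h -!addrA; congr (_ + _); rewrite addrC.
- move=> N; rewrite BS -/(r N).
  have hA : pn (A N.+1) <= pn (r N) * pn bs.
    by rewrite AS; apply: le_trans (pn_take _ _) (pnM _ _).
  have hB : pn (drop_poly m (r N - A N.+1 * b)) <= pn (r N) + pn (r N) * pn bs * pn b.
    apply: le_trans (pn_drop _ _) _; apply: le_trans (pnD _ _) _.
    rewrite pnN lerD2l; apply: le_trans (pnM _ _) _.
    by apply: ler_wpM2r; rewrite ?pn_ge0.
  apply: le_trans (lerD hA hB) _; lra.
Qed.

Lemma hensel (M tau : R) : 0 <= M -> 0 < tau ->
  (forall N, pn (phi N) <= M * tau ^+ N) ->
  exists (A B : nat -> {poly C}) (M' tau' : R),
  [/\ A 0%N = 'X^m /\ B 0%N = b,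
    forall N, (size (A N.+1) <= m)%N,
    forall N, phi N = \sum_(i < N.+1) A i * B (N - i)%N,
    0 <= M' /\ 1 <= tau' &
    forall N, pn (A N) <= M' * tau' ^+ N /\ pn (B N) <= M' * tau' ^+ N].
Proof.
move=> M0 tau0 hphi.
have [K [A [B [K0 AB0 sA hAB hK]]]] := hensel_formal.
pose x N := pn (A N) + pn (B N).
have [] := @convolution_majorant R x K M tau K0 M0 tau0.
- by move=> n; rewrite addr_ge0 ?pn_ge0.
- move=> n; apply: le_trans (hK n) _; apply: ler_wpM2l; first exact: ltW.
  apply: le_trans (pnD _ _) _; rewrite pnN; apply: lerD; first exact: hphi.
  apply: le_trans (pn_sum _ _ _) _; apply: ler_sum => l _.
  apply: le_trans (pnM _ _) _; apply: ler_pM; rewrite ?pn_ge0 //.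
    by rewrite lerDl pn_ge0.
  by rewrite lerDr pn_ge0.
move=> M' [tau' [M'0 tau'1 hx]]; exists A, B, M', tau'; split => // N.
by split; apply: le_trans (hx N); rewrite ?lerDl ?lerDr pn_ge0.
Qed.

(* The lifted factors inherit the bound on the degree in [z] which makes them
   power series in [w = t ^+ k * z]. *)
Lemma hensel_degree (k D : nat) (A B : nat -> {poly C}) : (0 < k)%N ->
  A 0%N = 'X^m -> B 0%N = b -> (forall N, (size (A N.+1) <= m)%N) ->
  (forall N, phi N = \sum_(i < N.+1) A i * B (N - i)%N) ->
  (forall N j, (N + D < k * j)%N -> (phi N)`_j = 0) ->
  forall N j, (N + D < k * (j + m))%N -> (B N)`_j = 0.
Proof.
(* Coefficients of degree j + m are compared. The product with A 0 gives the j-th coefficient of B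
   N. In the others A i.+1 has degree below m, so the coefficient of B has index above j and
   vanishes by induction. *)
clear b0 phi0; move=> k0 A0 B0 sA hAB hphi; elim/ltn_ind => N IH j Nj.
have := hphi N (j + m)%N Nj; rewrite hAB big_ord_recl /= subn0 A0.
rewrite coefD coefXnM ltnNge leq_addl /= addnK coef_sum big1 ?addr0 // => i _.
rewrite /bump /= add1n coefM big1 // => l _.
have [lm|lm] := ltnP l m; last first.
  by rewrite nth_default ?mul0r // (leq_trans (sA _)).
rewrite (IH (N - i.+1)%N) ?mulr0 //; have := ltn_ord i; have := ltn_ord l; nia.
Qed.

End Hensel.

(** * Factorization along the initial form *)

Section Weierstrass.
Variable R : realType.
Local Notation C := (Cplx R).
Implicit Types (c : nat -> nat -> C) (F G : C -> C -> C) (t w z : C).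

Lemma poly_eq0_disk (p : {poly C}) : (forall z, rn z <= 1 -> p.[z] = 0) -> p = 0.
Proof.
move=> p0; apply/eqP; apply: contraT => pn0.
pose rs : seq C := [seq n.+1%:R^-1 | n <- iota 0 (size p)].
have : (size rs < size p)%N.
  apply: max_poly_roots => //.
    apply/allP => _ /mapP[n _ ->]; apply/rootP/p0.
    rewrite rnV (_ : n.+1%:R = (n.+1%:R : R)%:C :> C); last by rewrite rmorph_nat.
    by rewrite rn_real normr_nat invf_le1 ?ler1n ?ltr0n.
  rewrite map_inj_uniq ?iota_uniq // => n n' /invr_inj /eqP.
  by rewrite eqr_nat => /eqP [].
by rewrite size_map size_iota ltnn.
Qed.

Lemma small_real (dl : R) : 0 < dl -> exists t : C, 0 < rn t < dl.
Proof.
move=> d0; exists ((dl / 2)%:C : C); rewrite rn_real gtr0_norm ?divr_gt0 //=.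
by rewrite ltr_pdivrMr //; lra.
Qed.

(** The weight N and the power j of z determine the power N - k * j of t, so each coefficient has a
    single source. *)
Lemma wpoly_coef k c N j : (0 < k)%N ->
  (wpoly k c N)`_j = if (k * j <= N)%N then c (N - k * j)%N j else 0.
Proof.
move=> k0; pose K := (maxn N j).+1.
have NK : (N < K)%N by rewrite ltnS leq_maxl.
have jK : (j < K)%N by rewrite ltnS leq_maxr.
rewrite /wpoly (wpart_widen k0 _ NK NK) coef_sum.
rewrite (eq_bigr (fun i : 'I_K => if (i + k * j == N)%N then c i j else 0)); last first.
  move=> i _; rewrite coef_sum big_mkcond (bigD1 (Ordinal jK)) //= big1 ?addr0.
    by case: ifP => // _; rewrite coefZ coefXn eqxx mulr1.
  move=> j' j'j; case: ifP => // _; rewrite coefZ coefXn.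
  suff -> : (j == j') = false by rewrite mulr0.
  by apply/negbTE; rewrite eq_sym; exact: j'j.
case: ifP => h; last by rewrite big1 // => i _; case: eqP => //; lia.
have h' : (N - k * j < K)%N by lia.
rewrite (bigD1 (Ordinal h')) //= subnK // eqxx big1 ?addr0 // => i ih.
case: eqP => // e; case/eqP: ih; apply: val_inj => /=; lia.
Qed.

Lemma wpoly_inj k c d : (0 < k)%N -> (forall N, wpoly k c N = wpoly k d N) ->
  forall i j, c i j = d i j.
Proof.
move=> k0 h i j; have := congr1 (fun p : {poly C} => p`_j) (h (i + k * j)%N).
by rewrite !wpoly_coef // leq_addl addnK.
Qed.

Lemma wpoly_conv k c d N : (0 < k)%N ->
  wpoly k (conv2 c d) N = \sum_(n < N.+1) wpoly k c n * wpoly k d (N - n)%N.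
Proof.
move=> k0; rewrite /wpoly -wpart_conv //; apply: wpart_ext => i j.
rewrite /conv2 scaler_suml; apply: eq_bigr => i1 _.
rewrite scaler_suml; apply: eq_bigr => j1 _.
by rewrite -scalerAl -scalerAr scalerA -exprD subnKC // -ltnS.
Qed.

Lemma pn_wpoly k c : (0 < k)%N -> bdd c ->
  exists M tau : R, [/\ 0 <= M, 1 <= tau & forall N, pn (wpoly k c N) <= M * tau ^+ N].
Proof.
move=> k0 [M [tau [M0 tau1 cM]]].
have t0 : 0 <= tau by apply: le_trans tau1.
exists M, (4 * tau); split => //; first by lra.
move=> N; rewrite /wpoly /wpart; apply: le_trans (pn_sum _ _ _) _.
apply: (@le_trans _ _ (\sum_(i < N.+1) \sum_(j < N.+1) M * tau ^+ N)).
  apply: ler_sum => i _; apply: le_trans (pn_sum _ _ _) _.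
  rewrite big_mkcond; apply: ler_sum => j _.
  case: eqP => [e|_]; last by rewrite mulr_ge0 // exprn_ge0.
  rewrite -mul_polyC; apply: le_trans (pnM _ _) _; rewrite pnXn mulr1.
  apply: (@le_trans _ _ (rn (c i j))).
    rewrite (@pnE _ 1) ?size_polyC_leq1 // big_ord1 coefC eqxx //.
  apply: le_trans (cM _ _) _; apply: ler_wpM2l => //.
  by apply: ler_weXn2l => //; nia.
rewrite !sumr_const !card_ord -mulrnA -[leLHS]mulr_natl.
rewrite [in leRHS]exprMn [leLHS]mulrCA.
apply: ler_wpM2l => //; apply: ler_wpM2r; first exact: exprn_ge0.
have n2 n : (n.+1 <= 2 ^ n)%N by exact: ltn_expl.
rewrite (_ : (4 : R) = (2 * 2)%N%:R) // -natrX ler_nat expnMn.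
by apply: leq_mul; exact: n2.
Qed.

(** Uniqueness of asymptotic expansions, one weight at a time: once the lower parts are known, t ^+
    N times the difference of actual and expected part is o(t ^+ N), so the difference vanishes at
    each z of the unit disk. *)
Lemma initial_part k D c F (P : {poly C}) : (0 < k)%N -> AG c F ->
  (forall z, rn z <= 1 -> small_o D (fun t => F t (t ^+ k * z) - t ^+ D * P.[z])) ->
  wpoly k c D = P /\ forall N, (N < D)%N -> wpoly k c N = 0.
Proof.
move=> k0 hc lim.
suff h N : (N <= D)%N -> wpoly k c N = if N == D then P else 0.
  split; first by rewrite (h _ (leqnn D)) eqxx.
  by move=> N ND; rewrite (h _ (ltnW ND)) (ltn_eqF ND).
elim/ltn_ind: N => N IH ND; apply/eqP; rewrite -subr_eq0; apply/eqP.
apply: poly_eq0_disk => z z1; set E := if _ then _ else _.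
have [dl [A [tau [dl0 A0 tau1 exp]]]] := weight_expansion k0 hc.
(* Below weight D the expected part is 0, and t ^+ D * P.[z] is itself o(t ^+ N). *)
have limN (eta : R) : 0 < eta -> exists2 d : R, 0 < d & forall t, 0 < rn t < d ->
    rn (F t (t ^+ k * z) - t ^+ N * E.[z]) <= eta * rn t ^+ N.
  move=> eta0; rewrite /E; case: (eqVneq N D) => [->|NneD]; first exact: lim.
  have {}ND : (N < D)%N by rewrite ltn_neqAle NneD.
  have [d1 d10 h1] := lim z z1 1 ltr01.
  have rP : 0 < 1 + rn P.[z] by rewrite ltr_pwDl // rn_ge0.
  exists (Num.min (Num.min d1 1) (eta / (1 + rn P.[z]))).
    by rewrite !lt_min d10 ltr01 divr_gt0.
  move=> t; rewrite !lt_min => /andP[t0 /andP[/andP[td1 t1] te]].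
  rewrite horner0 mulr0 subr0.
  have := h1 t; rewrite t0 td1 mul1r => /(_ isT) h2.
  apply: le_trans (_ : (1 + rn P.[z]) * rn t ^+ D <= _).
    rewrite -[F t _](subrK (t ^+ D * P.[z])); apply: le_trans (rnD _ _) _.
    by rewrite mulrDl mul1r rnM rnX [X in _ <= _ + X]mulrC lerD2r.
  rewrite -(subnKC ND) addSnnS exprD mulrA mulrAC; apply: ler_wpM2r.
    by rewrite exprn_ge0 // ltW.
  apply: (@le_trans _ _ ((1 + rn P.[z]) * rn t)); last first.
    by rewrite mulrC -ler_pdivlMr // ltW.
  apply: ler_wpM2l; first exact: ltW.
  by rewrite exprS; apply: ler_piMr; [exact: ltW | apply: exprn_ile1 => //; exact: ltW].
rewrite hornerD hornerN; apply: rn_eq0_eps => e e0.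
have e20 : 0 < e / 2 by rewrite divr_gt0.
have [d1 d10 h1] := limN _ e20.
have tau0 : 0 < tau by apply: lt_le_trans tau1.
have AT0 : 0 < A * tau ^+ N.+1 + 1 by rewrite ltr_wpDl // mulr_ge0 // exprn_ge0 // ltW.
have [|t /andP[t0]] := @small_real (Num.min (Num.min d1 dl) (e / 2 / (A * tau ^+ N.+1 + 1))).
  by rewrite !lt_min d10 dl0 divr_gt0.
rewrite !lt_min => /andP[/andP[td1 tdl] te].
have := h1 t; rewrite t0 td1 => /(_ isT) h2.
have [_ [_ /(_ N.+1)]] := exp t z tdl z1.
rewrite big_ord_recr big1 /= => [|i _]; last first.
  have iD : (i < D)%N by apply: leq_trans (ltn_ord i) ND.
  by rewrite IH ?ltn_ord ?(ltnW iD) // (ltn_eqF iD) horner0 mulr0.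
rewrite add0r => h3.
have tN : 0 < rn t ^+ N by rewrite exprn_gt0.
have : rn (t ^+ N * ((wpoly k c N).[z] - E.[z])) <= e * rn t ^+ N.
  rewrite mulrBr; apply: le_trans (rn_tri (F t (t ^+ k * z)) _ _) _.
  rewrite [e]splitr mulrDl; apply: lerD => //.
  rewrite rnBC; apply: le_trans h3 _.
  rewrite exprMn [rn t ^+ N.+1]exprS !mulrA; apply: ler_wpM2r; first exact: ltW.
  exact: rn_absorb.
by rewrite rnM rnX mulrC ler_pM2r.
Qed.

(** Meant for the two lifted sequences, shifted by k * m and by D - k * m. *)
Lemma sum_shift (A B : nat -> {poly C}) (a b N : nat) :
  \sum_(n < N.+1) (if (a <= n)%N then A (n - a)%N else 0) *
     (if (b <= N - n)%N then B (N - n - b)%N else 0) =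
  if (a + b <= N)%N then \sum_(i < (N - (a + b)).+1) A i * B (N - (a + b) - i)%N else 0.
Proof.
case: leqP => abN; last first.
  apply: big1 => n _; case: leqP => an; last by rewrite mul0r.
  by case: leqP => bn; rewrite ?mulr0 //; have := ltn_ord n; lia.
pose G n := (if (a <= n)%N then A (n - a)%N else 0) *
     (if (b <= N - n)%N then B (N - n - b)%N else 0).
have -> : \sum_(n < N.+1) (if (a <= n)%N then A (n - a)%N else 0) *
     (if (b <= N - n)%N then B (N - n - b)%N else 0) =
  \sum_(n < a + ((N - (a + b)).+1 + b)) G n.
  have <- : N.+1 = (a + ((N - (a + b)).+1 + b))%N by lia.
  by [].
rewrite big_split_ord /= [X in X + _]big1 ?add0r; last first.
  by move=> i _; rewrite /G leqNgt ltn_ord mul0r.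
rewrite big_split_ord /= [X in _ + X]big1 ?addr0; last first.
  move=> i _; rewrite /G; case: (leqP b) => h; last by rewrite mulr0.
  by have := ltn_ord i; lia.
apply: eq_bigr => i _; rewrite /G leq_addr; have := ltn_ord i => iN.
have -> : (b <= N - (a + i))%N by lia.
by congr (A _ * B _); lia.
Qed.

(** The array has no column beyond m, and column m is the constant 1. Each lower column is placed as
    column 0 of an array of its own, whose germ is taken at w = 0: functions of t alone thus stay
    within the two-variable setting. *)
Lemma fin_arr c m (Z : nat -> C -> C -> C) :
  (forall e, c e m = (e == 0)%N%:R) -> (forall e j, (m < j)%N -> c e j = 0) ->
  (forall i, (i < m)%N -> arr (fun e j => if j == 0%N then c e i else 0) (Z i)) ->
  arr c (fun t w => w ^+ m + \sum_(i < m) Z i t 0 * w ^+ i).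
Proof.
move=> cm c0 hZ.
have [d1 d10 hd] := finite_bidisk (fun i : 'I_m => hZ i (ltn_ord i)).
exists (Num.min d1 1); first by rewrite lt_min d10 ltr01.
move=> t w; rewrite !lt_min => /andP[td _] /andP[_ wd] eta eta0.
have e0 : 0 < eta / m.+1%:R by rewrite divr_gt0 // ltr0n.
have /choice[K0 K0P] (i : 'I_m) : exists K0 : nat, forall K1 K2, (K0 <= K1)%N ->
  (K0 <= K2)%N ->
  rn (Z i t 0 - rect (fun e j => if j == 0%N then c e i else 0) K1 K2 t 0) < eta / m.+1%:R.
  by apply: hd; rewrite ?rn0.
exists (maxn (\max_i K0 i) m.+1) => K1 K2.
rewrite !geq_max => /andP[K1a K1b] /andP[K2a K2b].
have K10 : (0 < K1)%N by apply: leq_trans K1b.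
have K20 : (0 < K2)%N by apply: leq_trans K2b.
have -> : rect c K1 K2 t w = w ^+ m + \sum_(i < m)
   rect (fun e j => if j == 0%N then c e i else 0) K1 K2 t 0 * w ^+ i.
  have recti (i : 'I_m) : rect (fun e j => if j == 0%N then c e i else 0) K1 K2 t 0 =
      \sum_(e < K1) c e i * t ^+ e.
    apply: eq_bigr => e _; rewrite (bigD1 (Ordinal K20)) //= big1 ?addr0.
      by rewrite /tm /= expr0 mulr1.
    by move=> j; rewrite -val_eqE /= /tm => /negbTE ->; rewrite !mul0r.
  rewrite [LHS]exchange_big /=.
  rewrite (sum_widen (F := fun j => \sum_(e < K1) tm c t w e j) K2b); last first.
    by move=> j mj; rewrite big1 // => e _; rewrite /tm c0 // !mul0r.
  rewrite big_ord_recr /= addrC; congr (_ + _).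
    rewrite (bigD1 (Ordinal K10)) //= big1 ?addr0.
      by rewrite /tm cm eqxx expr0 !mul1r.
    by move=> e; rewrite -val_eqE /= /tm cm => /negbTE ->; rewrite !mul0r.
  apply: eq_bigr => i _.
  rewrite recti big_distrl /=; apply: eq_bigr => e _.
  by [].
rewrite opprD addrACA subrr add0r -sumrB; apply: le_lt_trans (rn_sum _ _ _) _.
apply: (@le_lt_trans _ _ (\sum_(i < m) eta / m.+1%:R)).
  apply: ler_sum => i _; rewrite -mulrBl rnM.
  have Ki : (K0 i <= \max_i K0 i)%N by exact: leq_bigmax.
  have := K0P i K1 K2 (leq_trans Ki K1a) (leq_trans Ki K2a) => h.
  apply: le_trans (_ : eta / m.+1%:R * 1 <= _); last by rewrite mulr1.
  apply: ler_pM; rewrite ?rn_ge0 ?(ltW h) // rnX.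
  by apply: exprn_ile1; rewrite ?rn_ge0 // ltW.
by rewrite sumr_const card_ord -[ltLHS]mulr_natr mulrAC ltr_pdivrMr ?ltr0n // ltr_pM2l // ltr_nat.
Qed.

Lemma GH2_fst F : GH2 F -> GH2 (fun t _ => F t 0).
Proof.
move=> hF.
pose X (i : 'I_2) (x : 'cV[C]_2) := if i == 0 then x 0 0 else 0.
have hX i : GH (X i) by rewrite /X; case: (i == 0); [exact: GH_coord|exact: GH_cst].
have X0 i : X i 0 = 0 by rewrite /X; case: ifP => // _; rewrite mxE.
apply: GH_ext (GH_comp hF hX X0) => x; rewrite /fun2 !mxE /X /=.
by [].
Qed.

(* [P = 'X^m * b] is the initial form of [F] in the chart [w = t ^+ k * z].
   Lifting this factorization along the weighted degree splits [F] into a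
   Weierstrass polynomial, which collects the branches with [w = o(t ^+ k)], and
   a cofactor [Z2], which does not vanish on them. *)
Theorem weierstrass_hensel F k D (P : {poly C}) :
  (0 < k)%N -> GH2 F -> P != 0 -> P.[0] = 0 ->
  (forall z, rn z <= 1 -> small_o D (fun t => F t (t ^+ k * z) - t ^+ D * P.[z])) ->
  exists (m : nat) (zeta : nat -> C -> C) (Z2 : C -> C -> C),
  [/\ (0 < m)%N /\ (exists2 b : {poly C}, b.[0] != 0 & P = 'X^m * b),
      (forall i, GH2 (fun t _ => zeta i t)) /\ (forall i : 'I_m, zeta i 0 = 0),
      GH2 Z2 /\ (exists2 dl : R, 0 < dl & forall t w, rn t < dl -> rn w < dl ->
        F t w = (w ^+ m + \sum_(i < m) zeta i t * w ^+ i) * Z2 t w),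
      (forall e : R, 0 < e -> exists2 dl : R, 0 < dl & forall t, 0 < rn t < dl ->
        (exists w, w ^+ m + \sum_(i < m) zeta i t * w ^+ i = 0) /\
        (forall w, w ^+ m + \sum_(i < m) zeta i t * w ^+ i = 0 -> rn w <= e * rn t ^+ k)) &
      exists2 e : R, 0 < e & exists2 dl : R, 0 < dl & forall t w, 0 < rn t < dl ->
        rn w <= e * rn t ^+ k -> Z2 t w != 0].
Proof.
move=> k0 hF Pn0 P0 lim.
have [c hc] := GH2_AG hF; have bc : bdd c by case: hc.
have [cD cN] := initial_part k0 hc lim.
have [m [b b00 Pb]] : exists m, exists2 b : {poly C}, b.[0] != 0 & P = 'X^m * b.
  have [m [b h1 h2]] := multiplicity_XsubC P 0.
  exists m, b; first by move: h1; rewrite Pn0.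
  by rewrite h2 subr0 mulrC.
have m0 : (0 < m)%N.
  rewrite lt0n; apply: contra_neqN b00 => /eqP m0.
  by move: P0; rewrite Pb m0 expr0 mul1r.
have b0 : b`_0 != 0 by rewrite -horner_coef0.
have [M [tau [M0 tau1 hM]]] := pn_wpoly k0 bc.
have tau0 : 0 < tau by apply: lt_le_trans tau1.
(* Amounts to dividing by t ^+ D: the parts of weight below D vanish, and the part of weight D is
   P. *)
pose phi N := wpoly k c (N + D).
have phi0 : phi 0%N = 'X^m * b by rewrite /phi add0n cD Pb.
have [A [B [M' [tau' [[A0 B0] sA hAB [M'0 tau'1] hM']]]]] :
  exists (A B : nat -> {poly C}) (M' tau' : R),
  [/\ A 0%N = 'X^m /\ B 0%N = b, forall N, (size (A N.+1) <= m)%N,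
    forall N, phi N = \sum_(i < N.+1) A i * B (N - i)%N, 0 <= M' /\ 1 <= tau' &
    forall N, pn (A N) <= M' * tau' ^+ N /\ pn (B N) <= M' * tau' ^+ N].
  apply: (hensel phi0 b0 (M := M * tau ^+ D) (tau := tau)) => //.
    by rewrite mulr_ge0 // exprn_ge0 // ltW.
  by move=> N; apply: le_trans (hM _) _; rewrite exprD -mulrA [X in _ * X]mulrC mulrA mulrAC -mulrA.
have phideg N j : (N + D < k * j)%N -> (phi N)`_j = 0.
  by move=> h; rewrite /phi wpoly_coef // leqNgt h.
have Bdeg := hensel_degree k0 A0 B0 sA hAB phideg.
(* The nonzero coefficient b(0) of z ^+ m in the part of weight D comes from a monomial containing w
   ^+ m, whose weight is at least k * m. *)
have kmD : (k * m <= D)%N.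
  rewrite leqNgt; apply: contraNN b0 => h; apply/eqP.
  by have := phideg 0%N m h; rewrite phi0 coefXnM ltnn subnn.
have sA' N : (size (A N) <= m.+1)%N.
  by case: N => [|N]; [rewrite A0 size_polyXn | rewrite ltnW // ltnS].
pose D' := (D - k * m)%N.
(* Back from z to w: t ^+ (N + k * m) * z ^+ i equals t ^+ (N + k * m - k * i) * w ^+ i, a monomial
   because A N has degree at most m. For B N, shifted by D', the exponent of t is nonnegative by
   [Bdeg]. *)
pose c1 e i := if (k * m <= e + k * i)%N then (A (e + k * i - k * m)%N)`_i else 0.
pose c2 e i := if (D' <= e + k * i)%N then (B (e + k * i - D')%N)`_i else 0.
have tau'0 : 0 < tau' by apply: lt_le_trans tau'1.
have bdd12 (X : nat -> {poly C}) a : (forall N, pn (X N) <= M' * tau' ^+ N) ->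
    bdd (fun e i => if (a <= e + k * i)%N then (X (e + k * i - a)%N)`_i else 0).
  move=> hX; exists M', (tau' ^+ k); split => //; first exact: exprn_ege1.
  move=> e i; case: ifP => _; last first.
    by rewrite rn0 mulr_ge0 // !exprn_ge0 // ltW.
  apply: le_trans (rn_coef _ _) _; apply: le_trans (hX _) _.
  apply: ler_wpM2l => //; rewrite -exprM; apply: ler_weXn2l => //.
  by apply: leq_trans (leq_subr _ _) _; rewrite mulnDr leq_add2r leq_pmull.
have bc1 : bdd c1 by apply: bdd12 => N; have [] := hM' N.
have bc2 : bdd c2 by apply: bdd12 => N; have [] := hM' N.
have wc1 N : wpoly k c1 N = if (k * m <= N)%N then A (N - k * m)%N else 0.
  apply/polyP => j; rewrite wpoly_coef // /c1.
  case: (leqP (k * j)%N N) => h; first by rewrite subnK //; case: ifP; rewrite ?coef0.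
  case: ifP => h2; last by rewrite coef0.
  rewrite nth_default // (leq_trans (sA' _)) //.
  by rewrite -(ltn_pmul2l k0); exact: leq_ltn_trans h2 h.
have wc2 N : wpoly k c2 N = if (D' <= N)%N then B (N - D')%N else 0.
  apply/polyP => j; rewrite wpoly_coef // /c2.
  case: (leqP (k * j)%N N) => h; first by rewrite subnK //; case: ifP; rewrite ?coef0.
  case: ifP => h2; last by rewrite coef0.
  rewrite Bdeg // mulnDr -[X in (_ + X < _)%N](subnK kmD) -/D' addnA subnK //.
  by rewrite ltn_add2r.
have conv12 i j : conv2 c1 c2 i j = c i j.
  apply: (wpoly_inj k0) => N; rewrite wpoly_conv //.
  under eq_bigr do rewrite wc1 wc2.
  rewrite sum_shift subnKC //; case: leqP => ND; last by rewrite cN.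
  by rewrite -hAB /phi subnK.
have [F1 hF1] := AG_exists bc1; have [F2 hF2] := AG_exists bc2.
have arrF : arr (conv2 c1 c2) F.
  have [dl dl0 h] := AG_arr hc; exists dl => // t w td wd eta eta0.
  have [K0 K0P] := h t w td wd eta eta0; exists K0 => K1 K2 h1 h2.
  have := K0P K1 K2 h1 h2; congr (rn (_ - _) < _).
  by apply: eq_bigr => i _; apply: eq_bigr => j _; rewrite /tm conv12.
have [d1 d10 FE] := arr_unique arrF (AG_arr (AGM hF1 hF2)).
pose col i e j : C := if j == 0%N then c1 e i else 0.
have bcol i : bdd (col i).
  have [M1 [tau2 [M10 tau21 h]]] := bc1.
  have tau20 : 0 < tau2 by apply: lt_le_trans tau21.
  exists (M1 * tau2 ^+ i), tau2; split => //.
    by rewrite mulr_ge0 // exprn_ge0 // ltW.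
  move=> e j; rewrite /col; case: eqP => [->|_]; last first.
    by rewrite rn0 !mulr_ge0 // exprn_ge0 // ltW.
  by apply: le_trans (h _ _) _; rewrite addn0 -mulrA -exprD addnC.
have /choice[Z hZ] i := AG_exists (bcol i).
pose zeta i t := Z i t 0.
have c1m e : c1 e m = (e == 0)%N%:R.
  rewrite /c1 leq_addl addnK; case: e => [|e]; first by rewrite A0 coefXn eqxx.
  by rewrite nth_default.
have c1gt e j : (m < j)%N -> c1 e j = 0.
  move=> mj; rewrite /c1; case: ifP => // _; rewrite nth_default //.
  exact: leq_trans (sA' _) mj.
have arr1 := fin_arr c1m c1gt (fun i _ => AG_arr (hZ i)).
have [d2 d20 F1E] := arr_unique (AG_arr hF1) arr1.
(* Up to the order k * (m - i) in t, column i of [c1] sees only A 0, a pure m-th power without term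
   of degree i < m. *)
have zsmall (e : R) : 0 < e -> exists2 dl : R, 0 < dl & forall t, rn t < dl ->
    forall i : 'I_m, rn (zeta i t) <= e * rn t ^+ (k * (m - i)).
  move=> e0; suff [dl dl0 h] : exists2 dl : R, 0 < dl & forall (i : 'I_m) t, rn t < dl ->
      rn (zeta i t) <= e * rn t ^+ (k * (m - i)) by exists dl => // t td i; exact: h.
  apply: finite_min => [i da db /andP[_ dba] h t td|i]; first by apply: h; exact: lt_le_trans dba.
  have [dl [A1 [tau2 [dl0 A10 tau21 exp]]]] := weight_expansion k0 (hZ i).
  have tau20 : 0 < tau2 by apply: lt_le_trans tau21.
  pose K := (k * (m - i))%N.
  have Q0 : 0 < A1 * tau2 ^+ K.+1 + 1 by rewrite ltr_wpDl // mulr_ge0 // exprn_ge0 // ltW.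
  exists (Num.min dl (e / (A1 * tau2 ^+ K.+1 + 1))); first by rewrite lt_min dl0 divr_gt0.
  move=> t; rewrite lt_min => /andP[tdl te].
  have [_ [_ /(_ K.+1)]] := exp t 0 tdl (ltac:(by rewrite rn0 ler01)).
  rewrite mulr0 big1 ?subr0 => [h|N _].
    apply: le_trans h _; rewrite -/K exprMn [rn t ^+ K.+1]exprS !mulrA.
    apply: ler_wpM2r; first by rewrite exprn_ge0 // rn_ge0.
    exact: rn_absorb.
  rewrite horner_coef0 wpoly_coef // muln0 leq0n subn0 /col eqxx /c1.
  case: ifP => h; last by rewrite mulr0.
  have -> : (N + k * i - k * m = 0)%N.
    have NK : (N <= K)%N by rewrite -ltnS; exact: ltn_ord.
    apply/eqP; rewrite subn_eq0; apply: leq_trans (leq_add NK (leqnn _)) _.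
    by rewrite /K -mulnDr subnK // ltnW.
  by rewrite A0 coefXn (ltn_eqF (ltn_ord i)) mulr0.
exists m, zeta, F2; split.
- by split => //; exists b.
- split; first by move=> i; exact: GH2_fst (AG_GH2 (hZ i)).
  move=> i; have [dl dl0 h] := zsmall 1 ltr01.
  have := h 0; rewrite rn0 dl0 => /(_ isT i).
  rewrite mul1r expr0n muln_eq0 subn_eq0 leqNgt ltn_ord orbF gtn_eqF // => h0.
  by apply: rn_le0; rewrite h0.
- split; first exact: AG_GH2 hF2.
  exists (Num.min d1 d2); first by rewrite lt_min d10.
  move=> t w; rewrite !lt_min => /andP[t1 t2] /andP[w1 w2].
  by rewrite FE // F1E.
- move=> e e0.
  (* If |w| > e1 * |t| ^+ k, each lower term is at most |w| ^+ m / (m + 1), and m such terms cannot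
     balance w ^+ m. The bound e1 <= 1 serves to compare e1 ^+ m with e1 ^+ (m - i). *)
  pose e1 := Num.min 1 e; have e10 : 0 < e1 by rewrite lt_min ltr01.
  have e11 : e1 <= 1 by rewrite ge_min lexx.
  pose e' := e1 ^+ m / m.+1%:R.
  have e'0 : 0 < e' by rewrite divr_gt0 ?ltr0n // exprn_gt0.
  have [dl dl0 hz] := zsmall e' e'0.
  exists dl => // t /andP[t0 td]; split.
    pose q : {poly C} := 'X^m + \sum_(i < m) zeta i t *: 'X^i.
    have sq : size q = m.+1.
      rewrite /q size_polyDl size_polyXn //; apply: leq_ltn_trans (size_sum _ _ _) _.
      rewrite ltnS; apply/bigmax_leqP => i _.
      by apply: leq_trans (size_scale_leq _ _) _; rewrite size_polyXn.
    have /closed_rootP[w /rootP] : size q != 1%N by rewrite sq; case: (m) m0.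
    rewrite /q hornerD hornerXn horner_sum => h; exists w; rewrite -[RHS]h.
    by congr (_ + _); apply: eq_bigr => i _; rewrite hornerZ hornerXn.
  move=> w hw; rewrite leNgt; apply/negP => wt.
  have {}wt : e1 * rn t ^+ k < rn w.
    apply: le_lt_trans wt; apply: ler_wpM2r; first by rewrite exprn_ge0 // ltW.
    by rewrite /e1 ge_min lexx orbT.
  have w0 : 0 < rn w.
    by apply: le_lt_trans wt; rewrite mulr_ge0 ?exprn_ge0 // ltW.
  have : rn w ^+ m <= \sum_(i < m) rn w ^+ m / m.+1%:R.
    move/eqP : hw; rewrite addr_eq0 => /eqP hw.
    rewrite -[leLHS]rnX hw rnN; apply: le_trans (rn_sum _ _ _) _.
    apply: ler_sum => i _; rewrite rnM rnX.
    apply: le_trans (ler_wpM2r _ (hz t td i)) _; first by rewrite exprn_ge0 // ltW.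
    have -> : e' * rn t ^+ (k * (m - i)) * rn w ^+ i =
        (e1 ^+ m * (rn t ^+ k) ^+ (m - i)) * rn w ^+ i / m.+1%:R.
      by rewrite /e' exprM; ring.
    apply: ler_wpM2r; first by rewrite invr_ge0 ler0n.
    have -> : rn w ^+ m = rn w ^+ (m - i) * rn w ^+ i.
      by rewrite -exprD subnK // ltnW.
    apply: ler_wpM2r; first by rewrite exprn_ge0 // ltW.
    apply: (@le_trans _ _ ((e1 * rn t ^+ k) ^+ (m - i))).
      rewrite exprMn; apply: ler_wpM2r; first by rewrite !exprn_ge0 // ltW.
      by apply: ler_wiXn2l; [exact: ltW | exact: e11 | exact: leq_subr].
    by apply: lerXn2r; rewrite ?nnegrE ?(ltW wt) ?(ltW w0) // mulr_ge0 ?exprn_ge0 // ltW.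
  rewrite sumr_const card_ord -[X in _ <= X]mulr_natr mulrAC ler_pdivlMr ?ltr0n //.
  by rewrite ler_pM2l ?exprn_gt0 // ler_nat ltnn.
- have [dl [A1 [tau2 [dl0 A10 tau21 exp]]]] := weight_expansion k0 hF2.
  have tau20 : 0 < tau2 by apply: lt_le_trans tau21.
  pose q := drop_poly 1 b.
  have bq z : b.[z] = b`_0 + q.[z] * z.
    have h := poly_take_drop 1 b; rewrite -{1}h hornerD.
    rewrite hornerM hornerXn expr1 -/q; congr (_ + _).
    have -> : take_poly 1 b = (b`_0)%:P.
      by apply/polyP => -[|i]; rewrite coef_take_poly coefC.
    by rewrite hornerC.
  (* For small z the value b(z) stays within be / 4 of b(0), and the remainder of the expansion
     divided by t ^+ D' is at most another be / 4, so Z2 cannot vanish. *)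
  pose be := rn b`_0; have be0 : 0 < be by rewrite rn_gt0.
  have be4 : 0 < be / 4 by rewrite divr_gt0.
  have q1 : 0 < pn q + 1 by rewrite ltr_wpDl // pn_ge0.
  pose e := Num.min 1 (be / 4 / (pn q + 1)).
  have e0 : 0 < e by rewrite lt_min ltr01 divr_gt0.
  pose Q := A1 * tau2 ^+ D'.+1.
  have Q0 : 0 < Q + 1 by rewrite ltr_wpDl // mulr_ge0 // exprn_ge0 // ltW.
  exists e => //; exists (Num.min dl (be / 4 / (Q + 1))); first by rewrite lt_min dl0 divr_gt0.
  move=> t w; rewrite lt_min => /andP[t0 /andP[td tq]] wt.
  have tn0 : t != 0 by rewrite -rn_gt0.
  pose z := w / t ^+ k.
  have wE : w = t ^+ k * z by rewrite /z mulrC divfK // expf_neq0.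
  have ze : rn z <= e.
    by rewrite /z rnM rnV rnX ler_pdivrMr // exprn_gt0.
  have z1 : rn z <= 1 by apply: le_trans ze _; rewrite ge_min lexx.
  have [_ [_ /(_ D'.+1)]] := exp t z td z1.
  rewrite -wE big_ord_recr big1 /= => [|N _]; last first.
    by rewrite wc2 leqNgt ltn_ord horner0 mulr0.
  rewrite add0r wc2 leqnn subnn B0 => h.
  apply/eqP => Z0; move: h; rewrite Z0 sub0r rnN rnM rnX => h.
  have tD : 0 < rn t ^+ D' by rewrite exprn_gt0.
  have : rn b.[z] <= be / 4.
    rewrite -(ler_pM2l tD); apply: le_trans h _.
    have -> : A1 * (tau2 * rn t) ^+ D'.+1 = rn t ^+ D' * (Q * rn t).
      by rewrite exprMn [rn t ^+ D'.+1]exprS /Q; ring.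
    apply: ler_wpM2l; first exact: ltW.
    exact: rn_absorb.
  have : rn (q.[z] * z) <= be / 4.
    rewrite rnM; apply: (@le_trans _ _ ((pn q + 1) * e)).
      apply: ler_pM; rewrite ?rn_ge0 //.
      by apply: le_trans (rn_horner _ z1) _; rewrite lerDl.
    by rewrite mulrC -ler_pdivlMr // ge_min lexx orbT.
  have : be <= rn b.[z] + rn (q.[z] * z).
    by rewrite /be -[b`_0](addrK (q.[z] * z)) -bq rnB.
  lra.
Qed.

End Weierstrass.

(** * Images of branches are analytic *)

Section Norm.
Variable R : realType.
Local Notation C := (Cplx R).

Lemma sum_residue (A : nmodType) (F : nat -> A) k K :
  \sum_(i < k * K) F i = \sum_(j < k) \sum_(m < K) F (k * m + j)%N.
Proof.
elim: K => [|K IH].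
  by rewrite muln0 big_ord0 big1 // => j _; rewrite big_ord0.
have -> : \sum_(i < k * K.+1) F i = \sum_(i < k * K + k) F i by rewrite mulnS addnC.
rewrite big_split_ord /= IH -big_split /=; apply: eq_bigr => j _.
by rewrite big_ord_recr.
Qed.

(** Grouping the powers of s by residue modulo k leaves series in s ^+ k, for which a function of x
    can be substituted. *)
Lemma split_residue k (Z : C -> C -> C) : (0 < k)%N -> GH2 Z ->
  exists Y : nat -> C -> C -> C, (forall j, GH2 (Y j)) /\
  exists2 dl : R, 0 < dl & forall s w, rn s < dl -> rn w < dl ->
    Z s w = \sum_(j < k) s ^+ j * Y j (s ^+ k) w.
Proof.
move=> k0 /GH2_AG[c hc].
pose cj j m e := c (k * m + j)%N e.
have bcj j : bdd (cj j).
  have [[M [tau [M0 tau1 h]]] _] := hc.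
  have tau0 : 0 < tau by apply: lt_le_trans tau1.
  exists (M * tau ^+ j), (tau ^+ k); split.
  - by rewrite mulr_ge0 // exprn_ge0 // ltW.
  - exact: exprn_ege1.
  - move=> m e; apply: le_trans (h _ _) _; rewrite -mulrA; apply: ler_wpM2l => //.
    rewrite -exprM -exprD; apply: ler_weXn2l => //.
    rewrite mulnDr addnAC addnC leq_add2l leq_add2l leq_pmull //.
have /choice[Y hY] j := AG_exists (bcj j).
exists Y; split; first by move=> j; exact: AG_GH2 (hY j).
have [d0 d00 h0] := AG_arr hc.
have [dm dm0 hm] := finite_bidisk (fun j : 'I_k => AG_arr (hY j)).
exists (Num.min (Num.min d0 dm) 1); first by rewrite !lt_min d00 dm0 ltr01.
move=> s w; rewrite !lt_min => /andP[/andP[s0 sm] /ltW s1] /andP[/andP[w0 wm] _].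
have skm : rn (s ^+ k) < dm.
  apply: le_lt_trans sm; rewrite rnX -{2}(expr1 (rn s)).
  by apply: ler_wiXn2l => //; exact: rn_ge0.
apply: subr0_eq; apply: rn_eq0_eps => e e0.
have e20 : 0 < e / 2 by rewrite divr_gt0.
have ek0 : 0 < e / 2 / k%:R by rewrite divr_gt0 // ltr0n.
have /choice[Kj KjP] (j : 'I_k) : exists K0 : nat, forall K1 K2, (K0 <= K1)%N ->
  (K0 <= K2)%N -> rn (Y j (s ^+ k) w - rect (cj j) K1 K2 (s ^+ k) w) < e / 2 / k%:R.
  exact: hm.
have [K0 K0P] := h0 s w s0 w0 _ e20.
pose K := maxn K0 (\max_j Kj j).
have KK0 : (K0 <= K)%N by rewrite leq_maxl.
have KkK : (K0 <= k * K)%N by apply: leq_trans KK0 _; rewrite leq_pmull.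
apply: le_trans (rn_tri (rect c (k * K) K s w) _ _) _.
rewrite [leRHS]splitr; apply: lerD; first by apply: ltW; exact: K0P.
have -> : rect c (k * K) K s w = \sum_(j < k) s ^+ j * rect (cj j) K K (s ^+ k) w.
  rewrite /rect (sum_residue (fun i => \sum_(j < K) tm c s w i j)).
  apply: eq_bigr => j _; rewrite big_distrr /=; apply: eq_bigr => m _.
  rewrite big_distrr /=; apply: eq_bigr => i _.
  by rewrite /tm /cj exprD exprM; ring.
rewrite -sumrB; apply: le_trans (rn_sum _ _ _) _.
apply: (@le_trans _ _ (\sum_(j < k) e / 2 / k%:R)); last first.
  by rewrite sumr_const card_ord -[leLHS]mulr_natr divfK // pnatr_eq0 -lt0n.
apply: ler_sum => j _; rewrite -mulrBr rnM rnX.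
have Kjle : (Kj j <= K)%N.
  by apply: leq_trans (leq_maxr _ _); exact: (leq_bigmax j).
have := KjP j K K Kjle Kjle; rewrite rnBC => h.
apply: le_trans (ltW h); rewrite ler_piMl ?rn_ge0 //.
by apply: exprn_ile1; rewrite ?rn_ge0.
Qed.

Lemma GH2_comp d (Y : C -> C -> C) (l h : 'cV[C]_d -> C) : GH2 Y ->
  GH l -> GH h -> l 0 = 0 -> h 0 = 0 -> GH (fun x => Y (l x) (h x)).
Proof.
move=> hY hl hh l0 h0.
pose X (i : 'I_2) := if i == 0 then l else h.
have hX i : GH (X i) by rewrite /X; case: (i == 0).
have X0 i : X i 0 = 0 by rewrite /X; case: (i == 0).
by apply: GH_ext (GH_comp hY hX X0) => x; rewrite /fun2 !mxE /X /=.
Qed.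

(** * Norms from C[T]/(T^k - y) as determinants *)

Section Companion.
Variable k' : nat.
Local Notation k := k'.+1.

(* Multiplication by T on C[T]/(T^k - y), in the basis 1, T, ..., T^(k-1). *)
Definition cyclic_mx (y : C) : 'M[C]_k :=
  \matrix_(i, j) (if (i == k' :> nat) then (if j == 0 then y else 0)
                  else (j == i.+1 :> nat)%:R).

Lemma row_cyclic_mx (y : C) (i : 'I_k) (ik : (i.+1 < k)%N) :
  delta_mx 0 i *m cyclic_mx y = delta_mx 0 (Ordinal ik) :> 'rV_k.
Proof.
rewrite -rowE; apply/rowP => j; rewrite !mxE eqxx /=.
by rewrite ltn_eqF.
Qed.

Lemma row_last_cyclic_mx (y : C) :
  delta_mx 0 ord_max *m cyclic_mx y = y *: delta_mx 0 0 :> 'rV_k.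
Proof.
rewrite -rowE; apply/rowP => j; rewrite !mxE !eqxx /=.
by case: (j == 0); rewrite ?mulr1 ?mulr0.
Qed.

Lemma row0_cyclic_mx (y : C) j (jk : (j < k)%N) :
  delta_mx 0 0 *m cyclic_mx y ^+ j = delta_mx 0 (Ordinal jk) :> 'rV_k.
Proof.
elim: j jk => [|j IH] jk.
  by rewrite expr0 mulmx1; congr delta_mx; apply: val_inj.
have jk' : (j < k)%N by apply: ltnW.
rewrite exprSr -mulmxE mulmxA (IH jk').
have := @row_cyclic_mx y (Ordinal jk') jk => ->.
by congr delta_mx; apply: val_inj.
Qed.

Lemma cyclic_mxX (y : C) : cyclic_mx y ^+ k = y%:M.
Proof.
apply/row_matrixP => i; rewrite !rowE mul_mx_scalar.
have -> : delta_mx 0 i = delta_mx 0 0 *m cyclic_mx y ^+ i :> 'rV_k.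
  rewrite (row0_cyclic_mx y (ltn_ord i)); congr delta_mx; exact: val_inj.
rewrite -mulmxA mulmxE -exprD addnC exprD -mulmxE mulmxA.
rewrite exprSr -mulmxE mulmxA (row0_cyclic_mx y (ltnSn k')).
have -> : Ordinal (ltnSn k') = ord_max by apply: val_inj.
by rewrite row_last_cyclic_mx -scalemxAl.
Qed.

Lemma cyclic_mx_eigen (y s : C) : s ^+ k = y ->
  cyclic_mx y *m \col_j s ^+ j = s *: \col_j s ^+ j.
Proof.
move=> sk; apply/colP => i; rewrite !mxE.
case: (eqVneq (i : nat) k') => ik.
  rewrite (bigD1 0) //= !mxE ik eqxx mulr1 big1 ?addr0; first by rewrite -sk exprS.
  by move=> j /negbTE j0; rewrite !mxE ik eqxx j0 mul0r.
have ik' : (i.+1 < k)%N by rewrite ltnS ltn_neqAle ik -ltnS ltn_ord.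
rewrite (bigD1 (Ordinal ik')) //= !mxE (negbTE ik) eqxx mul1r exprS big1 ?addr0 //.
move=> j; rewrite -val_eqE /= => /negbTE ji.
by rewrite !mxE (negbTE ik) ji mul0r.
Qed.

Lemma horner_mx_eigen (M : 'M[C]_k) (v : 'cV[C]_k) (s : C) (Q : {poly C}) :
  M *m v = s *: v -> horner_mx M Q *m v = Q.[s] *: v.
Proof.
move=> Mv; elim/poly_ind: Q => [|Q c IH].
  by rewrite rmorph0 mul0mx horner0 scale0r.
rewrite rmorphD rmorphM /= horner_mx_X horner_mx_C -mulmxE mulmxDl -mulmxA Mv.
by rewrite -scalemxAr IH mul_scalar_mx hornerMXaddC scalerDl scalerA mulrC.
Qed.

(** The determinant is the norm of Q. A common root s gives the eigenvector (s ^+ j); without one,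
    Bezout makes Q invertible modulo T^k - y, a polynomial which the matrix annihilates. *)
Lemma cyclic_det_eq0 (y : C) (Q : {poly C}) :
  \det (horner_mx (cyclic_mx y) Q) = 0 <-> exists2 s, s ^+ k = y & Q.[s] = 0.
Proof.
split; last first.
  move=> [s sk Qs]; apply/eqP/det0P.
  pose v : 'cV[C]_k := \col_j s ^+ j.
  have v0 : v != 0.
    apply/eqP => /colP/(_ 0); rewrite !mxE expr0 => /eqP; by rewrite oner_eq0.
  have h : horner_mx (cyclic_mx y) Q *m v = 0.
    by rewrite (horner_mx_eigen _ (cyclic_mx_eigen sk)) Qs scale0r.
  apply/det0P; apply: contra_eqT h => nz.
  have u : horner_mx (cyclic_mx y) Q \in unitmx by rewrite unitmxE unitfE.
  apply: contra_neq v0 => h.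
  by rewrite -(mulKmx u v) h mulmx0.
move=> det0; pose P : {poly C} := 'X^k - y%:P.
have PM : horner_mx (cyclic_mx y) P = 0.
  by rewrite rmorphB rmorphXn /= horner_mx_X horner_mx_C cyclic_mxX subrr.
have ncop : ~~ coprimep P Q.
  apply/negP => /Bezout_eq1_coprimepP[[u v] /= uv].
  have := congr1 (horner_mx (cyclic_mx y)) uv.
  rewrite rmorphD !rmorphM /= PM mulr0 add0r rmorph1 => h.
  have := congr1 determinant h; rewrite -mulmxE det_mulmx det0 mulr0 det1 => /eqP.
  by rewrite eq_sym oner_eq0.
have /closed_rootP[s] : size (gcdp P Q) != 1%N by [].
rewrite root_gcd => /andP[/rootP Ps /rootP Qs]; exists s => //.
by apply/eqP; move: Ps; rewrite !hornerE => /eqP; rewrite subr_eq0.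
Qed.

Lemma GH_cyclic_det d (l : 'cV[C]_d -> C) (q : 'I_k -> 'cV[C]_d -> C) : GH l ->
  (forall m, GH (q m)) ->
  GH (fun x => \det (horner_mx (cyclic_mx (l x)) (\sum_(m < k) q m x *: 'X^m))).
Proof.
move=> hl hq.
have hM a b : GH (fun x => cyclic_mx (l x) a b).
  apply: (@GH_ext _ _ (fun x => if a == k' :> nat then (if b == 0 then l x else 0)
                  else (b == a.+1 :> nat)%:R)); first by move=> x; rewrite mxE.
  case: (a == k' :> nat); last exact: GH_cst.
  by case: (b == 0) => //; exact: GH_cst.
have hMX m a b : GH (fun x => (cyclic_mx (l x) ^+ m) a b).
  elim: m a b => [|m IH] a b; first by apply: GH_ext (GH_cst _ (1%:M a b)).
  apply: (@GH_ext _ _ (fun x => \sum_c cyclic_mx (l x) a c * (cyclic_mx (l x) ^+ m) c b)).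
    by move=> x; rewrite exprS -mulmxE mxE.
  by apply: GH_sum => c _; apply: GHM.
apply: (@GH_ext _ _ (fun x => \sum_(s : 'S_k) (-1) ^+ s *
   \prod_i (\sum_(m < k) q m x * (cyclic_mx (l x) ^+ m) i (s i)))).
  move=> x; apply: eq_bigr => s _; congr (_ * _); apply: eq_bigr => i _.
  rewrite linear_sum /= summxE; apply: eq_bigr => m _.
  by rewrite linearZ /= mxE rmorphXn /= horner_mx_X.
apply: GH_sum => s _; apply: GHM; first exact: GH_cst.
apply: GH_prod => i _; apply: GH_sum => m _; exact: GHM.
Qed.

End Companion.

(* Otherwise the product over [s] of the nonzero polynomials [\sum_i Q i s *: 'X^i]
   would have more roots than its degree allows. *)
Lemma common_root (rs : seq C) N (Q : 'I_N -> C -> C) :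
  (forall j, (j < (size rs * N).+1)%N ->
     exists2 s, s \in rs & \sum_(i < N) j%:R ^+ i * Q i s = 0) ->
  exists2 s, s \in rs & forall i, Q i s = 0.
Proof.
move=> h.
pose T s : {poly C} := \sum_(i < N) Q i s *: 'X^i.
have sT s : (size (T s) <= N)%N.
  apply: leq_trans (size_sum _ _ _) _; apply/bigmax_leqP => i _.
  by apply: leq_trans (size_scale_leq _ _) _; rewrite size_polyXn.
pose P : {poly C} := \prod_(s <- rs) T s.
have sP : (size P <= (size rs * N).+1)%N.
  rewrite /P; elim: (rs) => [|s r IH]; first by rewrite big_nil size_poly1.
  rewrite big_cons; apply: leq_trans (size_polyMleq _ _) _.
  case: (_ + _)%N (leq_add (sT s) IH) => [//|n] /=; rewrite addnS mulSn ltnS => h'.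
  exact: leqW.
have P0 : P = 0.
  apply/eqP; apply: contraT => Pn0.
  have : (size [seq n%:R : C | n <- iota 0 (size rs * N).+1] < size P)%N.
    apply: max_poly_roots => //.
      apply/allP => z /mapP[n]; rewrite mem_iota add0n => /andP[_ nN] ->.
      have [s srs hs] := h n nN; rewrite /P /root horner_prod.
      rewrite (big_rem s) //= mulf_eq0; apply/orP; left.
      rewrite /T horner_sum -[X in _ == X]hs; apply/eqP; apply: eq_bigr => i _.
      by rewrite hornerZ hornerXn mulrC.
    rewrite map_inj_uniq ?iota_uniq // => n n' /eqP.
    by rewrite eqr_nat => /eqP.
  by rewrite size_map size_iota ltnNge sP.
have /eqP := P0; rewrite /P prodf_seq_eq0 => /hasP[s srs /= /eqP Ts].
exists s => // i; have := congr1 (fun p : {poly C} => p`_i) Ts.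
rewrite coef0 /T coef_sum (bigD1 i) //= coefZ coefXn eqxx mulr1 big1 ?addr0 //.
by move=> j ji; rewrite coefZ coefXn eq_sym -[_ == _]/(j == i) (negbTE ji) mulr0.
Qed.

(* Modulo [T ^+ k = l x] each equation is a polynomial of degree < k in [T], and
   the norm of a combination of these vanishes iff it has a root [s] with
   [s ^+ k = l x]; by [common_root] finitely many combinations suffice. *)
Lemma analytic_image d k N (l h : 'cV[C]_d -> C) (lam : 'I_N -> 'cV[C]_d -> C)
    (Z : 'I_N -> C -> C -> C) : (0 < k)%N -> GH l -> l 0 = 0 -> GH h -> h 0 = 0 ->
  (forall i, GH (lam i)) -> (forall i, GH2 (Z i)) ->
  analytic_germ [set x | exists s, s ^+ k = l x /\ forall i, lam i x = Z i s (h x)].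
Proof.
case: k => // k' _ hl l0 hh h0 hlam hZ; set k := k'.+1.
have /choice[Y hY] i := split_residue (ltn0Sn k') (hZ i).
(* The coefficient of T^m in the i-th equation; [lam i] does not involve T and enters at m = 0
   only. *)
pose q (i : 'I_N) (m : 'I_k) x := (m == 0)%:R * lam i x - Y i m (l x) (h x).
have hq i m : GH (q i m).
  apply: GHD; first by apply: GHM => //; exact: GH_cst.
  apply: (@GH_ext _ _ (fun x => (-1) * Y i m (l x) (h x))).
    by move=> x; rewrite mulN1r.
  by apply: GHM; [exact: GH_cst|apply: GH2_comp => //; have [] := hY i].
(* The number of combinations that [common_root] asks for when there are k roots. *)
pose M := (k * N).+1.
pose qc (j : nat) (m : 'I_k) x := \sum_(i < N) j%:R ^+ i * q i m x.
exists M, (fun j x => \det (horner_mx (cyclic_mx k' (l x)) (\sum_(m < k) qc j m x *: 'X^m))).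
split.
  move=> j; apply: GH_holo_germ; apply: GH_cyclic_det => // m.
  by apply: GH_sum => i _; apply: GHM => //; exact: GH_cst.
have [dl dl0 ZE] : exists2 dl : R, 0 < dl & forall i s w, rn s < dl -> rn w < dl ->
    Z i s w = \sum_(j < k) s ^+ j * Y i j (s ^+ k) w.
  by apply: finite_bidisk => i; have [] := hY i.
have dk0 : 0 < dl ^+ k by rewrite exprn_gt0.
have [d1 d10 hd1] := GH_small hl l0 dk0.
have [d2 d20 hd2] := GH_small hh h0 dl0.
apply/near0P; exists (Num.min d1 d2); first by rewrite lt_min d10.
move=> x; rewrite lt_min => /andP[x1 x2].
(* A small x makes l x, hence s, small, so that the splitting of [Z i] is valid at s. *)
have sd s : s ^+ k = l x -> rn s < dl.
  move=> sk; have := hd1 x x1; rewrite -sk rnX ltr_pXn2r ?nnegrE ?rn_ge0 ?ltW //.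
have QE i s : s ^+ k = l x -> \sum_(m < k) q i m x * s ^+ m = lam i x - Z i s (h x).
  move=> sk; rewrite (ZE i s (h x) (sd s sk) (hd2 x x2)) sk.
  rewrite /q; under eq_bigr do rewrite mulrBl.
  rewrite sumrB; congr (_ - _); last by apply: eq_bigr => m _; rewrite mulrC.
  rewrite (bigD1 0) //= ?eqxx ?mulr1n mul1r expr0 mulr1 big1 ?addr0 // => m /negbTE m0.
  by rewrite m0 !mul0r.
have QcE j s : (\sum_(m < k) qc j m x *: 'X^m).[s] =
    \sum_(i < N) j%:R ^+ i * \sum_(m < k) q i m x * s ^+ m.
  rewrite horner_sum.
  under eq_bigr do rewrite hornerZ hornerXn /qc big_distrl.
  rewrite exchange_big /=; apply: eq_bigr => i _; rewrite big_distrr /=.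
  by apply: eq_bigr => m _; rewrite mulrA.
split.
  move=> [s [sk hs]] j; apply/cyclic_det_eq0; exists s => //.
  by rewrite QcE big1 // => i _; rewrite QE // hs subrr mulr0.
move=> hdet.
(* The roots are listed with multiplicity, so [rs] has size k even where l x = 0. *)
have [rs rsE] := closed_field_poly_normal ('X^k - (l x)%:P : {poly C}).
have mP : 'X^k - (l x)%:P \is monic.
  rewrite monicE lead_coefDl ?lead_coefXn // size_polyXn size_polyN.
  by rewrite (leq_ltn_trans (size_polyC_leq1 _)).
have srs : size rs = k.
  have := size_polyXn C k; rewrite -(size_polyDl (q := - (l x)%:P)); last first.
    by rewrite size_polyXn size_polyN (leq_ltn_trans (size_polyC_leq1 _)).
  by rewrite rsE (monicP mP) scale1r size_prod_XsubC => -[].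
have inrs s : (s \in rs) = (s ^+ k == l x).
  have : root ('X^k - (l x)%:P) s = (s \in rs).
    by rewrite rsE (monicP mP) scale1r root_prod_XsubC.
  by move=> <-; rewrite /root !hornerE subr_eq0.
have [j jM|s srs' hs] := @common_root rs N (fun i s => \sum_(m < k) q i m x * s ^+ m).
  have jM' : (j < M)%N by rewrite /M -srs.
  have /cyclic_det_eq0[s sk Qs] := hdet (Ordinal jM').
  by exists s; [rewrite inrs sk | rewrite -QcE].
exists s; move: srs'; rewrite inrs => /eqP sk; split => // i.
by apply/eqP; rewrite -subr_eq0 -QE // hs.
Qed.

End Norm.

(** * Tangent cones and initial forms *)

Section Cones.
Variable R : realType.
Local Notation C := (Cplx R).

Lemma lin_expand d (V : lmodType C) (g : 'cV[C]_d -> V) :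
  (forall a x y, g (a *: x + y) = a *: g x + g y) ->
  forall x, g x = \sum_i x i 0 *: g (delta_mx i 0).
Proof.
move=> glin x.
have g0 : g 0 = 0.
  by apply: (addrI (g 0)); have := glin 1 0 0; rewrite !scale1r !addr0 => <-.
have {1}-> : x = \sum_i x i 0 *: delta_mx i 0.
  by rewrite {1}(matrix_sum_delta x); apply: eq_bigr => i _; rewrite big_ord1.
by elim/big_rec2: _ => // i y1 y2 _ <-; rewrite glin.
Qed.

Lemma lin_bound d e (g : 'cV[C]_d -> 'cV[C]_e) :
  (forall a x y, g (a *: x + y) = a *: g x + g y) ->
  exists2 K : R, 0 < K & forall x, rn (g x) <= K * rn x.
Proof.
move=> glin; exists (1 + \sum_i rn (g (delta_mx i 0))).
  by rewrite ltr_pwDl // sumr_ge0 // => i _; exact: rn_ge0.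
move=> x; rewrite (lin_expand glin); apply: le_trans (rn_sum _ _ _) _.
rewrite mulrDl mul1r; apply: ler_wpDl; first exact: rn_ge0.
rewrite big_distrl /=; apply: ler_sum => i _; rewrite rnZ mulrC.
by apply: ler_wpM2l; [exact: rn_ge0 | exact: rn_coord].
Qed.

Lemma GH_lin d (g : 'cV[C]_d -> C^o) :
  (forall a x y, g (a *: x + y) = a *: g x + g y) -> GH (g : 'cV[C]_d -> C) /\ g 0 = 0.
Proof.
move=> glin; split.
  apply: (@GH_ext _ _ (fun x => \sum_i x i 0 * g (delta_mx i 0))).
    by move=> x; rewrite [RHS](lin_expand glin).
  by apply: GH_sum => i _; apply: GHM; [exact: GH_coord|exact: GH_cst].
by apply: (addrI (g 0)); have := glin 1 0 0; rewrite !scale1r !addr0 => <-.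
Qed.

Lemma GH2_compf d (f : 'cV[C]_d -> C) (X : C -> C -> 'cV[C]_d) : GH f ->
  (forall i, GH2 (fun t w => X t w i 0)) -> X 0 0 = 0 ->
  GH2 (fun t w => f (X t w)).
Proof.
move=> hf hX X0.
have h0 i : X ((0 : 'cV[C]_2) 0 0) ((0 : 'cV[C]_2) 1 0) i 0 = 0.
  by rewrite !mxE X0 mxE.
apply: GH_ext (GH_comp hf hX h0) => x; rewrite /fun2; congr f.
by apply/colP => i; rewrite mxE.
Qed.

(** * Points of projective space and limits of secants *)

Section Lines.
Variable k : nat.
Implicit Types (l : projC R k) (e v : 'cV[C]_k).

Lemma line_exists v : v != 0 -> exists l : projC R k, \val l = <[v]>%VS.
Proof.
move=> v0; have h : \dim <[v]>%VS == 1%N by rewrite dim_vline v0.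
by exists (exist (fun l : {vspace 'cV[C]_k} => \dim l == 1%N) _ h).
Qed.

Lemma line_scale v (a : C) : a != 0 -> <[a *: v]>%VS = <[v]>%VS.
Proof.
move=> a0; apply/eqP; rewrite eqEsubv -!memvE memvZ ?memv_line //=.
by apply/vlineP; exists a^-1; rewrite scalerA mulVf // scale1r.
Qed.

Lemma line_gen_neq0 l e : \val l = <[e]>%VS -> e != 0.
Proof.
by move=> le; apply: contraTneq (valP l) => e0; rewrite le e0 dim_vline eqxx.
Qed.

Lemma vpick_gen l e : \val l = <[e]>%VS -> exists2 a : C, a != 0 & vpick (\val l) = a *: e.
Proof.
move=> le; have : vpick (\val l) \in <[e]>%VS by rewrite -le memv_pick.
case/vlineP => a ea; exists a => //; apply: contraNneq (vpick_neq0 l) => a0.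
by rewrite ea a0 scale0r.
Qed.

Lemma proj_nbhsP l e (U : set (projC R k)) : \val l = <[e]>%VS ->
  nbhs l U <-> exists2 dl : R, 0 < dl & forall v, rn (v - e) < dl ->
    forall m : projC R k, \val m = <[v]>%VS -> U m.
Proof.
move=> le; have [a a0 pE] := vpick_gen le.
have na0 : 0 < rn a by rewrite rn_gt0.
have E : nbhs l U <-> exists2 dl : R, 0 < dl & forall v, rn (v - vpick (\val l)) < dl ->
    forall m : projC R k, \val m = <[v]>%VS -> U m.
  exact: (nearvP (vpick (\val l)) (fun v => forall m : projC R k, \val m = <[v]>%VS -> U m)).
rewrite E; split=> [][dl dl0 h].
- exists (dl / rn a); first by rewrite divr_gt0.
  move=> v vd m mv; apply: (h (a *: v)); last by rewrite line_scale.
  by rewrite pE -scalerBr rnZ mulrC -ltr_pdivlMr.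
- exists (dl * rn a); first by rewrite mulr_gt0.
  move=> v vd m mv; apply: (h (a^-1 *: v)); last by rewrite line_scale ?invr_eq0.
  have -> : a^-1 *: v - e = a^-1 *: (v - vpick (\val l)).
    by rewrite scalerBr pE scalerA mulVf // scale1r.
  by rewrite rnZ rnV mulrC ltr_pdivrMr.
Qed.

(** Secants converge to the line of e exactly when suitable multiples of the points converge to e;
    sequences of projective points disappear. *)
Lemma tangent_coneP (S : set 'cV[C]_k) l e : \val l = <[e]>%VS ->
  tangent_cone S l <-> forall eps : R, 0 < eps ->
    exists x, [/\ S x, rn x < eps & exists c : C, rn (c *: x - e) < eps].
Proof.
move=> le; have e0 := line_gen_neq0 le; split.
- move=> [x_ [l_ [Sx lx x0 ll]]] eps eps0.
  pose U : set (projC R k) := [set m | exists2 v, \val m = <[v]>%VS & rn (v - e) < eps].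
  have lU : nbhs l U.
    by apply/(proj_nbhsP _ le); exists eps => // v ve m mv; exists v.
  have [N1 _ N1P] := ll U lU.
  have [N2 N2P] := (cvg_rnP x_ 0).1 x0 _ eps0.
  pose N := maxn N1 N2; exists (x_ N); split => //.
    by have := N2P N (leq_maxr _ _); rewrite subr0.
  have [v lv ve] := N1P N (leq_maxl _ _).
  have : v \in <[x_ N]>%VS by rewrite -lx lv memv_line.
  by case/vlineP => c vE; exists c; rewrite -vE.
- move=> h.
  have ne0 : 0 < rn e by rewrite rn_gt0.
  have /choice[f fP] (j : nat) : exists u : 'cV[C]_k * projC R k,
      [/\ S u.1, \val u.2 = <[u.1]>%VS, rn u.1 < j.+1%:R^-1 &
          exists c, c != 0 /\ rn (c *: u.1 - e) < j.+1%:R^-1].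
    have j0 : 0 < (j.+1%:R^-1 : R) by rewrite invr_gt0 ltr0n.
    (* A distance below [rn e] forces c *: x to be nonzero, so that x spans a line. *)
    have [|x [Sx xs [c cx]]] := h (Num.min j.+1%:R^-1 (rn e)).
      by rewrite lt_min j0.
    move: xs cx; rewrite !lt_min => /andP[x1 _] /andP[c1 c2].
    have cx0 : c *: x != 0.
      by apply: contraTneq c2 => ->; rewrite sub0r rnN ltxx.
    have x0 : x != 0 by apply: contraNneq cx0 => ->; rewrite scaler0.
    have c0 : c != 0 by apply: contraNneq cx0 => ->; rewrite scale0r.
    have [m mx] := line_exists x0.
    by exists (x, m); split => //; exists c.
  exists (fun j => (f j).1), (fun j => (f j).2); split.
  + by move=> j; have [] := fP j.
  + by move=> j; have [] := fP j.
  + apply/cvg_rnP => eps eps0.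
    have [N NP] := natSinv_small eps0.
    exists N => n Nn; rewrite subr0; have [_ _ fn _] := fP n.
    exact: lt_trans fn (NP n Nn).
  + move=> U /(proj_nbhsP _ le)[dl dl0 hU].
    have [N NP] := natSinv_small dl0.
    exists N => // n /= Nn; have [_ fv _ [c [c0 cx]]] := fP n.
    apply: (hU (c *: (f n).1)); last by rewrite line_scale.
    exact: lt_trans cx (NP n Nn).
Qed.

(** A generator of a line in L can be moved by an arbitrarily small multiple of an independent w in
    L, so no point of the pencil is isolated. *)
Lemma not_isolated_pencil (T : set (projC R k)) (L : {vspace 'cV[C]_k}) :
  \dim L = 2%N -> proj_line L `<=` T ->
  ~ (T `&` proj_line L `<=` isolated (T `&` proj_line L)).
Proof.
move=> dL LT iso.
have L0 : L != 0%VS by rewrite -dimv_eq0 dL.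
have e0 : vpick L != 0 by rewrite vpick0.
have [l le] := line_exists e0.
have [w wL we] : exists2 w, w \in L & w \notin <[vpick L]>%VS.
  apply/subvPn; apply/negP => /dimvS; rewrite dL dim_vline; by case: (vpick L != 0).
have Ll : proj_line L l by rewrite /proj_line /= le -memvE memv_pick.
have [_ [V lV VA]] := iso l (conj (LT _ Ll) Ll).
have [dl dl0 hV] := (proj_nbhsP V le).1 lV.
have w0 : 0 < rn w + 1 by rewrite ltr_wpDl // rn_ge0.
pose ep : C := (dl / 2 / (rn w + 1))%:C.
have ep0 : 0 < rn ep by rewrite rn_real gtr0_norm !divr_gt0.
pose v := vpick L + ep *: w.
have v0 : v != 0.
  apply: contraNneq we => v0; apply/vlineP; exists (- ep^-1).
  have : ep *: w = - vpick L by apply/eqP; rewrite -addr_eq0 addrC; apply/eqP.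
  move=> h; rewrite scaleNr -scalerN -h scalerA mulVf ?scale1r // -rn_gt0 //.
have [m mv] := line_exists v0.
have vd : rn (v - vpick L) < dl.
  rewrite /v addrC addKr rnZ /ep rn_real gtr0_norm ?divr_gt0 //.
  apply: (@le_lt_trans _ _ (dl / 2 / (rn w + 1) * (rn w + 1))).
    by apply: ler_wpM2l; [rewrite !divr_ge0 ?ltW // | rewrite lerDl].
  by rewrite divfK ?gt_eqF // ltr_pdivrMr //; lra.
have Lm : proj_line L m.
  by rewrite /proj_line /= mv -memvE memvD ?memv_pick // memvZ.
have : (V `&` (T `&` proj_line L)) m by split; [exact: (hV v vd) | split => //; exact: LT].
rewrite VA /= => ml; move/negP: we; apply.
have : v \in <[vpick L]>%VS by rewrite -le -ml mv memv_line.
case/vlineP => c vc; apply/vlineP; exists (ep^-1 * (c - 1)).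
rewrite -scalerA scalerBl scale1r -vc /v addrC addKr scalerA mulVf ?scale1r //.
by rewrite -rn_gt0.
Qed.

End Lines.

(** * Homogeneous initial forms *)

Section InitialForm.
Variable d : nat.
Implicit Types (psi f : 'cV[C]_d -> C).

Lemma hp_cont N B psi b (eta : R) : hp N B psi -> 0 < eta ->
  exists2 dl : R, 0 < dl & forall y, rn (y - b) < dl -> rn (psi y - psi b) < eta.
Proof.
move=> [s [_ _ hs]] eta0.
have hf : GH (fun x => psi (b + x) - psi b).
  apply: (@GH_ext _ _ (fun x => \sum_(u <- s) u.1 * \prod_i (b i 0 + x i 0) ^+ u.2 i
      + (-1) * psi b)).
    move=> x; rewrite mulN1r (hs (b + x)); congr (_ - _); apply: eq_bigr => u _; congr (_ * _).
    by apply: eq_bigr => i _; rewrite mxE.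
  apply: GHD; last exact: GH_cst.
  apply: GH_sum => u _; apply: GHM; first exact: GH_cst.
  by apply: GH_prod => i _; apply: GHX; apply: GHD; [exact: GH_cst|exact: GH_coord].
have [|dl dl0 h] := GH_small hf _ eta0; first by rewrite addr0 subrr.
by exists dl => // y yd; have := h _ yd; rewrite addrCA subrr addr0.
Qed.

Lemma hp_line N B psi (b1 b2 : 'cV[C]_d) : hp N B psi ->
  exists p : {poly C}, forall z, psi (b1 + z *: b2) = p.[z].
Proof.
move=> [s [_ _ hs]].
exists (\sum_(u <- s) u.1 *: \prod_i ((b1 i 0)%:P + b2 i 0 *: 'X) ^+ u.2 i).
move=> z; rewrite hs horner_sum; apply: eq_bigr => u _; rewrite hornerZ; congr (_ * _).
rewrite /mon horner_prod; apply: eq_bigr => i _.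
by rewrite horner_exp hornerD hornerC hornerZ hornerX !mxE [b2 i 0 * z]mulrC.
Qed.

(** Homogeneity covers the combinations with a != 0; the multiples of b2 are reached through the
    polynomial that psi becomes along b1. *)
Lemma hp_vanish_span N B psi (b1 b2 : 'cV[C]_d) : hp N B psi ->
  (forall z, psi (b1 + z *: b2) = 0) -> forall a c, psi (a *: b1 + c *: b2) = 0.
Proof.
move=> hpsi h.
have ne a c : a != 0 -> psi (a *: b1 + c *: b2) = 0.
  move=> a0; have -> : a *: b1 + c *: b2 = a *: (b1 + (a^-1 * c) *: b2).
    by rewrite scalerDr scalerA mulVKf.
  by rewrite (hp_hom _ _ hpsi) h mulr0.
move=> a c; have [->|] := eqVneq a 0; last exact: ne.
have [p pE] := hp_line (c *: b2) b1 hpsi.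
suff p0 : p = 0.
  by have := pE 0; rewrite p0 horner0 !scale0r addr0 add0r.
(* The factor 'X takes care of z = 0, where the case a != 0 says nothing. *)
have : p * 'X = 0.
  apply: poly_eq0_disk => z _; rewrite hornerM hornerX -pE.
  have [->|z0] := eqVneq z 0; first by rewrite mulr0.
  by rewrite addrC ne ?mul0r.
by move/eqP; rewrite mulf_eq0 polyX_eq0 orbF => /eqP.
Qed.

Lemma initial_form f : GH f -> ~ (\forall x \near (0 : 'cV[C]_d), f x = 0) ->
  exists (m : nat) (B : R) psi, [/\ hp m B psi, exists b, psi b != 0 &
    exists A : R, 0 <= A /\ exists2 dl : R, 0 < dl & forall x, rn x < dl ->
      rn (f x - psi x) <= A * rn x ^+ m.+1].
Proof.
move=> [rho [M [phi [B [r0 h]]]]] fn0; have M0 := GHr_M0 h; have [h1 h2 h3] := h.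
have [m [hm hmin]] : exists m, (exists b, phi m b != 0) /\
    forall i, (i < m)%N -> forall x, phi i x = 0.
  apply: contra_notP fn0 => H.
  have phi0 : forall n x, phi n x = 0.
    elim/ltn_ind => n IH x; apply: contra_notP H => /eqP nx.
    by exists n; split => //; exists x.
  apply/near0P; exists (2^-1 * rho); first by rewrite mulr_gt0.
  move=> x xr; apply: rn_le0.
  have q01 := half01 R.
  apply: (@le_geo _ _ _ M 2^-1) => // n; rewrite add0r.
  have := h3 2^-1 x q01 (ltW xr) n.
  by rewrite big1 ?subr0 // => i _; exact: phi0.
exists m, (B m), (phi m); split => //.
exists (M * rho^-1 ^+ m.+1); split.
  by rewrite mulr_ge0 // exprn_ge0 // invr_ge0 ltW.
exists rho => // x xr.
pose q := rn x / rho.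
have q01 : 0 <= q < 1.
  by rewrite divr_ge0 ?rn_ge0 ?ltW //= ltr_pdivrMr // mul1r.
have xq : rn x <= q * rho by rewrite /q divfK // gt_eqF.
have := h3 q x q01 xq m.+1; rewrite big_ord_recr big1 /= => [|i _]; last exact: hmin.
by rewrite add0r; congr (_ <= _); rewrite /q exprMn; ring.
Qed.

(** With X t = t ^+ k *: y and y tending to b, homogeneity gives psi (X t) = t ^+ (k * m) * psi y,
    and f - psi is smaller by one more factor of the size of X t. *)
Lemma limit_along (f psi : 'cV[C]_d -> C) m B (A dl : R) (k : nat) (X : C -> 'cV[C]_d) b :
  (0 < k)%N -> hp m B psi -> 0 <= A -> 0 < dl ->
  (forall x, rn x < dl -> rn (f x - psi x) <= A * rn x ^+ m.+1) ->
  small_o k (fun t => X t - t ^+ k *: b) ->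
  small_o (k * m) (fun t => f (X t) - t ^+ (k * m) * psi b).
Proof.
move=> k0 hpsi A0 dl0 hf hX eta eta0.
have e2 : 0 < eta / 2 by rewrite divr_gt0.
have [d1 d10 hc] := hp_cont b hpsi e2.
pose e := Num.min 1 (d1 / 2).
have e0 : 0 < e by rewrite lt_min ltr01 divr_gt0.
have [d2 d20 h2] := hX e e0.
pose K := rn b + 1; have K0 : 0 < K by rewrite ltr_wpDl // rn_ge0.
pose Q := A * K ^+ m.+1 + 1.
have Q0 : 0 < Q by rewrite ltr_wpDl // mulr_ge0 // exprn_ge0 // ltW.
exists (Num.min (Num.min d2 1) (Num.min (dl / K) (eta / 2 / Q))).
  by rewrite !lt_min d20 ltr01 !divr_gt0.
move=> t; rewrite !lt_min => /andP[t0 /andP[/andP[td2 t1] /andP[tdl tQ]]].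
have tn0 : t != 0 by rewrite -rn_gt0.
have tk0 : t ^+ k != 0 by rewrite expf_neq0.
have ntk : 0 < rn t ^+ k by rewrite exprn_gt0.
have tkt : rn t ^+ k <= rn t.
  by rewrite -{2}(expr1 (rn t)); apply: ler_wiXn2l => //; exact: ltW.
pose y := (t ^+ k)^-1 *: X t.
have XE : X t = t ^+ k *: y by rewrite /y scalerA mulfV // scale1r.
have {}h2 := h2 t; rewrite t0 td2 in h2; have {}h2 := h2 isT.
have yb : rn (y - b) <= e.
  by move: h2; rewrite XE -scalerBr rnZ rnX mulrC ler_pM2r.
have yK : rn y <= K.
  rewrite -(subrK b y) /K addrC; apply: le_trans (rnD _ _) _; rewrite lerD2l.
  by apply: le_trans yb _; rewrite ge_min lexx.
have Xs : rn (X t) <= K * rn t ^+ k.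
  by rewrite XE rnZ rnX mulrC; apply: ler_wpM2r => //; exact: ltW.
have Xdl : rn (X t) < dl.
  apply: le_lt_trans Xs _; apply: (@le_lt_trans _ _ (K * rn t)).
    by apply: ler_wpM2l => //; exact: ltW.
  by rewrite mulrC -ltr_pdivlMr.
apply: le_trans (rn_tri (psi (X t)) _ _) _.
rewrite [eta]splitr mulrDl; apply: lerD.
  apply: le_trans (hf _ Xdl) _.
  apply: (@le_trans _ _ (A * (K * rn t ^+ k) ^+ m.+1)).
    by apply: ler_wpM2l => //; apply: lerX_rn.
  rewrite exprMn mulrA -exprM mulnSr exprD.
  rewrite [leLHS](_ : _ = (A * K ^+ m.+1 * rn t ^+ k) * rn t ^+ (k * m)); last by ring.
  apply: ler_wpM2r; first by rewrite exprn_ge0 // ltW.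
  apply: (@le_trans _ _ (Q * rn t)).
    apply: ler_pM; last exact: tkt.
    - by rewrite mulr_ge0 // exprn_ge0 // ltW.
    - exact: ltW.
    - by rewrite lerDl.
  by rewrite mulrC -ler_pdivlMr // ltW.
rewrite XE (hp_hom _ _ hpsi) -exprM -mulrBr rnM rnX mulrC.
apply: ler_wpM2r; first by rewrite exprn_ge0 // ltW.
apply: ltW; apply: hc; apply: le_lt_trans yb _.
have : e <= d1 / 2 by rewrite ge_min lexx orbT.
lra.
Qed.

(** At a zero x of f, psi x is of order |x| ^+ (m + 1). After scaling, psi (c *: x) is of order |c
    *: x| ^+ m * |x|, which tends to 0 while c *: x tends to e. *)
Lemma tangent_cone_initial (f psi : 'cV[C]_d -> C) m B (A dl : R) (X : set 'cV[C]_d)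
    (l : projC R d) e :
  hp m B psi -> 0 <= A -> 0 < dl ->
  (forall x, rn x < dl -> rn (f x - psi x) <= A * rn x ^+ m.+1) ->
  (forall x, rn x < dl -> X x -> f x = 0) ->
  \val l = <[e]>%VS -> tangent_cone X l -> psi e = 0.
Proof.
move=> hpsi A0 dl0 hf Xf le /(tangent_coneP _ le) h.
apply: rn_eq0_eps => eta eta0; have e2 : 0 < eta / 2 by rewrite divr_gt0.
have [d1 d10 hc] := hp_cont e hpsi e2.
pose K := rn e + 1; have K0 : 0 < K by rewrite ltr_wpDl // rn_ge0.
pose Q := A * K ^+ m + 1.
have Q0 : 0 < Q by rewrite ltr_wpDl // mulr_ge0 // exprn_ge0 // ltW.
have [|x [Xx + [c]]] := h (Num.min (Num.min d1 1) (Num.min dl (eta / 2 / Q))).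
  by rewrite !lt_min d10 ltr01 dl0 !divr_gt0.
rewrite !lt_min => /andP[_ /andP[xdl xQ]] /andP[/andP[c1 c2] _].
have cxK : rn (c *: x) <= K.
  rewrite -(subrK e (c *: x)) /K addrC; apply: le_trans (rnD _ _) _.
  by rewrite lerD2l ltW.
have := hf x xdl; rewrite (Xf x xdl Xx) sub0r rnN => hx.
have hcx : rn (psi (c *: x)) <= eta / 2.
  rewrite (hp_hom _ _ hpsi) rnM rnX.
  apply: (@le_trans _ _ (rn c ^+ m * (A * rn x ^+ m.+1))).
    by apply: ler_wpM2l => //; rewrite exprn_ge0 // rn_ge0.
  rewrite exprS [leLHS](_ : _ = A * (rn c * rn x) ^+ m * rn x); last by rewrite exprMn; ring.
  rewrite -rnZ; apply: (@le_trans _ _ (Q * rn x)).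
    apply: ler_wpM2r; first exact: rn_ge0.
    apply: (@le_trans _ _ (A * K ^+ m)); last by rewrite lerDl.
    apply: ler_wpM2l => //; exact: lerX_rn.
  by rewrite mulrC -ler_pdivlMr // ltW.
rewrite -(subrK (psi (c *: x)) (psi e)); apply: le_trans (rnD _ _) _.
rewrite [eta]splitr; apply: lerD => //.
by rewrite rnBC ltW // hc.
Qed.

End InitialForm.

End Cones.

(** * Normal form of an arc *)

Section Arcs.
Variable R : realType.
Local Notation C := (Cplx R).

Lemma geo_sum (q : R) n : 0 <= q < 1 -> \sum_(i < n) q ^+ i <= (1 - q)^-1.
Proof.
move=> /andP[q0 q1]; have h : 0 < 1 - q by rewrite subr_gt0.
rewrite -[leRHS]mul1r ler_pdivlMr //.
have -> : (\sum_(i < n) q ^+ i) * (1 - q) = 1 - q ^+ n.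
  by rewrite -[RHS]opprB subrX1 -mulNr opprB mulrC.
by rewrite gerBl exprn_ge0.
Qed.

Lemma root_exists (c : C) k : (0 < k)%N -> exists z, z ^+ k = c.
Proof.
move=> k0; have /closed_rootP[z /rootP] : size ('X^k - c%:P) != 1%N.
  rewrite size_polyDl size_polyXn; first by rewrite eqSS -lt0n.
  by rewrite size_polyN (leq_ltn_trans (size_polyC_leq1 _)).
by rewrite !hornerE => /eqP; rewrite subr_eq0 => /eqP; exists z.
Qed.

Lemma arc_expansion n (alpha : C -> 'cV[C]_n) r : 0 < r ->
  arc_representative alpha r ->
  exists (a : nat -> 'cV[C]_n) (r1 M : R), [/\ r < r1, 0 <= M,
    forall j, rn (a j) * r1 ^+ j <= M &
    forall q t, 0 <= q < 1 -> rn t <= q * r1 -> forall K,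
      rn (alpha t - \sum_(j < K) t ^+ j *: a j) <= M / (1 - q) * q ^+ K].
Proof.
move=> r0 [[rho rrho [a ha]] _].
(* Convergence at the point r1 < rho bounds the terms of the series there, and r < r1 leaves room
   for a geometric ratio on the closed disk. *)
pose r1 := (r + rho) / 2; have rr1 : r < r1 by rewrite /r1 ltr_pdivlMr //; lra.
have r10 : 0 < r1 by apply: lt_trans rr1.
have r1rho : r1 < rho by rewrite /r1 ltr_pdivrMr //; lra.
have cvS t : rn t < rho -> forall e : R, 0 < e -> exists N, forall m, (N <= m)%N ->
    rn (\sum_(j < m) t ^+ j *: a j - alpha t) < e.
  move=> tr e e0; have := ha t; rewrite rn_lt => /(_ tr) cv.
  have [N NP] := (cvg_rnP _ _).1 cv e e0; exists N => m Nm.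
  by have := NP m Nm; rewrite /series /= big_mkord.
pose t0 : C := r1%:C.
have rt0 : rn t0 = r1 by rewrite rn_real gtr0_norm.
have [N NP] := cvS t0 (ltac:(by rewrite rt0)) 1 ltr01.
(* Beyond N two consecutive partial sums are within 1 of the limit, so a term is at most 2. *)
pose M := 2 + \sum_(j < N) rn (t0 ^+ j *: a j).
have M0 : 0 <= M by rewrite addr_ge0 // sumr_ge0 // => j _; exact: rn_ge0.
have aM j : rn (a j) * r1 ^+ j <= M.
  have -> : rn (a j) * r1 ^+ j = rn (t0 ^+ j *: a j) by rewrite rnZ rnX rt0 mulrC.
  have [jN|Nj] := ltnP j N.
    rewrite /M (bigD1 (Ordinal jN)) //= addrCA lerDl addr_ge0 //.
    by apply: sumr_ge0 => i _; exact: rn_ge0.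
  have h1 := NP j Nj; have h2 := NP j.+1 (leqW Nj).
  have -> : t0 ^+ j *: a j = (\sum_(i < j.+1) t0 ^+ i *: a i - alpha t0) -
      (\sum_(i < j) t0 ^+ i *: a i - alpha t0).
    by rewrite big_ord_recr /= opprB addrA subrK addrAC subrr add0r.
  apply: le_trans (rnB _ _) _; apply: (@le_trans _ _ (1 + 1)).
    by apply: lerD; exact: ltW.
  by rewrite /M lerDl; apply: sumr_ge0 => i _; exact: rn_ge0.
exists a, r1, M; split => // q t /andP[q0 q1] tq K.
apply/ler_addgt0Pr => e e0.
have trho : rn t < rho.
  by apply: le_lt_trans tq _; apply: le_lt_trans r1rho; rewrite ler_piMl ?ltW.
have [N1 N1P] := cvS t trho e e0.
pose m := maxn N1 K; have Km : (K <= m)%N by rewrite leq_maxr.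
apply: le_trans (rn_tri (\sum_(j < m) t ^+ j *: a j) _ _) _.
rewrite addrC; apply: lerD; last first.
  by rewrite rnBC; apply: ltW; apply: N1P; rewrite leq_maxl.
rewrite -(subnKC Km) big_split_ord /= addrAC subrr add0r.
apply: le_trans (rn_sum _ _ _) _.
apply: (@le_trans _ _ (\sum_(i < m - K) M * q ^+ K * q ^+ i)).
  apply: ler_sum => i _; rewrite rnZ rnX -mulrA -exprD.
  apply: (@le_trans _ _ ((q * r1) ^+ (K + i) * rn (a (K + i)%N))).
    apply: ler_wpM2r; first exact: rn_ge0.
    exact: lerX_rn.
  rewrite exprMn -mulrA mulrC; apply: ler_wpM2r; first by rewrite exprn_ge0.
  by rewrite mulrC; exact: aM.
rewrite -big_distrr /= [leRHS]mulrAC; apply: ler_wpM2l; first by rewrite mulr_ge0 ?exprn_ge0.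
by apply: geo_sum; rewrite q0.
Qed.

Lemma expn_lipschitz (rho : R) j : 0 <= rho -> exists2 c : R, 0 <= c &
  forall s t : C, rn s <= rho -> rn t <= rho -> rn (s ^+ j - t ^+ j) <= c * rn (s - t).
Proof.
move=> rho0; elim: j => [|j [c c0 hc]].
  by exists 0 => // s t _ _; rewrite subrr rn0 mul0r.
exists (rho * c + rho ^+ j); first by rewrite addr_ge0 ?mulr_ge0 ?exprn_ge0.
move=> s t sr tr.
have -> : s ^+ j.+1 - t ^+ j.+1 = s * (s ^+ j - t ^+ j) + (s - t) * t ^+ j.
  by rewrite !exprS; ring.
apply: le_trans (rnD _ _) _; rewrite !rnM rnX mulrDl; apply: lerD.
  by rewrite -mulrA; apply: ler_pM; rewrite ?rn_ge0 // hc.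
rewrite mulrC; apply: ler_wpM2r; first exact: rn_ge0.
exact: lerX_rn.
Qed.

Lemma arc_continuous n (alpha : C -> 'cV[C]_n) r : 0 < r ->
  arc_representative alpha r -> forall t0, rn t0 <= r -> forall eta : R, 0 < eta ->
  exists2 dl : R, 0 < dl & forall t, rn t <= r -> rn (t - t0) < dl ->
    rn (alpha t - alpha t0) < eta.
Proof.
move=> r0 ha t0 t0r eta eta0.
have [a [r1 [M [rr1 M0 _ exp]]]] := arc_expansion r0 ha.
have r10 : 0 < r1 by apply: lt_trans rr1.
pose q := r / r1.
have q01 : 0 <= q < 1.
  by rewrite divr_ge0 ?ltW //= ltr_pdivrMr // mul1r.
have e4 : 0 < eta / 4 by rewrite divr_gt0.
have rE : q * r1 = r by rewrite /q divfK // gt_eqF.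
have [K KP] := geo_small (M / (1 - q)) q01 e4.
have [c c0 hc] : exists2 c : R, 0 <= c & forall s t : C, rn s <= r -> rn t <= r ->
    rn (\sum_(j < K) s ^+ j *: a j - \sum_(j < K) t ^+ j *: a j) <= c * rn (s - t).
  elim: (K) => [|k [c c0 hc]].
    by exists 0 => // s t _ _; rewrite !big_ord0 subrr rn0 mul0r.
  have [c' c'0 hc'] := expn_lipschitz k (ltW r0).
  exists (c + c' * rn (a k)); first by rewrite addr_ge0 // mulr_ge0 // rn_ge0.
  move=> s t sr tr; rewrite !big_ord_recr /= opprD addrACA.
  apply: le_trans (rnD _ _) _; rewrite mulrDl; apply: lerD; first exact: hc.
  rewrite -scalerBl rnZ mulrAC; apply: ler_wpM2r; [exact: rn_ge0 | exact: hc'].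
have c1 : 0 < c + 1 by rewrite ltr_wpDl.
exists (eta / 4 / (c + 1)); first by rewrite divr_gt0.
move=> t tr tt.
have h1 : rn (alpha t - \sum_(j < K) t ^+ j *: a j) < eta / 4.
  by apply: le_lt_trans (KP K (leqnn _)); apply: exp => //; rewrite rE.
have h2 : rn (\sum_(j < K) t0 ^+ j *: a j - alpha t0) < eta / 4.
  by rewrite rnBC; apply: le_lt_trans (KP K (leqnn _)); apply: exp => //; rewrite rE.
have h3 : rn (\sum_(j < K) t ^+ j *: a j - \sum_(j < K) t0 ^+ j *: a j) <= eta / 4.
  by apply: le_trans (hc _ _ tr t0r) _; exact: rn_absorb.
have h4 := le_trans (rn_tri (\sum_(j < K) t0 ^+ j *: a j) _ _) (lerD h3 (ltW h2)).
apply: le_lt_trans (le_trans (rn_tri (\sum_(j < K) t ^+ j *: a j) _ _) (lerD (ltW h1) h4)) _.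
by move: eta0; clear; lra.
Qed.

(** By injectivity alpha vanishes only at 0, so compactness keeps |alpha t| away from 0 on the
    annulus e <= |t| <= r. *)
Lemma arc_away n (alpha : C -> 'cV[C]_n) r : 0 < r -> alpha 0 = 0 ->
  arc_representative alpha r -> forall e : R, 0 < e ->
  exists2 dl : R, 0 < dl & forall t, rn t <= r -> rn (alpha t) < dl -> rn t < e.
Proof.
move=> r0 a0 ha e e0.
pose K := (`[-r, r]%classic `*` `[-r, r]%classic : set (R * R)).
have cK : compact K by apply: compact_setX; exact: segment_compact.
pose cx (p : R * R) : C := p.1 +i* p.2.
have cxB (p p' : R * R) : rn (cx p - cx p') <= `|p.1 - p'.1| + `|p.2 - p'.2|.
  by apply: le_trans (rn_ReIm _) _.
(* Outside the annulus the condition is vacuous, which allows the covering argument to run on a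
   whole real square. *)
pose P (i : nat) (p : R * R) := e <= rn (cx p) -> rn (cx p) <= r ->
  i.+1%:R^-1 <= rn (alpha (cx p)).
have [N _ NP] : \forall i \near \oo, K `<=` P i.
  apply: (compact_near_coveringP _).1 cK _ _ _ _ _ => p0 Kp0.
  suff [dl dl0 [N hN]] : exists2 dl : R, 0 < dl & exists N, forall p i,
      rn (cx p - cx p0) < dl -> (N <= i)%N -> P i p.
    exists (ball p0 (dl / 2), [set i | (N <= i)%N]).
      split => /=; last by exists N.
      by apply: nbhsx_ballx; rewrite divr_gt0.
    move=> [p i] [/= [/= b1 b2] Ni]; apply: hN => //.
    apply: le_lt_trans (cxB _ _) _; rewrite [dl]splitr; apply: ltrD.
      by rewrite distrC.
    by rewrite distrC.
  have [h|h1] := ltP (rn (cx p0)) e.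
    exists (e - rn (cx p0)); first by rewrite subr_gt0.
    exists 0%N => p i hp _ ep; exfalso; move: ep; apply/negP; rewrite -ltNge.
    have := rnD (cx p - cx p0) (cx p0); rewrite subrK; move: hp; lra.
  have [h|h2] := ltP r (rn (cx p0)).
    exists (rn (cx p0) - r); first by rewrite subr_gt0.
    exists 0%N => p i hp _ _ ep; exfalso; move: ep; apply/negP; rewrite -ltNge.
    have := rnD (cx p0 - cx p) (cx p); rewrite subrK rnBC; move: hp; lra.
  have an0 : alpha (cx p0) != 0.
    apply/eqP => h; have [_ inj] := ha.
    have : cx p0 = 0.
      apply: inj; first by rewrite /disk /= rn_le.
        by rewrite /disk /= rn_le rn0 ltW.
      by rewrite h a0.
    by move=> c0; move: h1; rewrite c0 rn0 leNgt e0.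
  have na : 0 < rn (alpha (cx p0)) / 2 by rewrite divr_gt0 // rn_gt0.
  have [dl dl0 hd] := arc_continuous r0 ha h2 na.
  have [N NP] := natSinv_small na.
  exists dl => //; exists N => p i hp Ni _ pr.
  have := hd _ pr hp; rewrite rnBC => h3.
  have := rnD (alpha (cx p0) - alpha (cx p)) (alpha (cx p)); rewrite subrK => h4.
  have h5 := NP i Ni; apply: le_trans (ltW h5) _.
  by move: h3 h4; clear; lra.
have hN := NP N (leqnn N).
exists (N.+1%:R^-1); first by rewrite invr_gt0 ltr0n.
move=> t tr at1; rewrite ltNge; apply/negP => et.
have tE : cx (complex.Re t, complex.Im t) = t by case: (t).
have : P N (complex.Re t, complex.Im t).
  apply: hN; split; rewrite /= in_itv /= -ler_norml.
    by apply: le_trans (rn_Re _) tr.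
  by apply: le_trans (rn_Im _) tr.
rewrite /P tE => /(_ et tr); rewrite leNgt; by move/negP; apply.
Qed.

(** Functions of the arc parameter are treated as germs of two variables constant in the second, so
    that one set of tools serves both. *)
Lemma arc_GH2 n (alpha : C -> 'cV[C]_n) r i : 0 < r -> arc_representative alpha r ->
  GH2 (fun t _ => alpha t i 0).
Proof.
move=> r0 ha; have [a [r1 [M [rr1 M0 aM exp]]]] := arc_expansion r0 ha.
have r10 : 0 < r1 by apply: lt_trans rr1.
have hpX N : hp N 1 (fun x : 'cV[C]_2 => x 0 0 ^+ N).
  elim: N => [|N IH]; first by have := hp_cst 2 (1 : C); rewrite rn1.
  have := hpM (hp_coord R 0) IH; rewrite mul1r add1n.
  by apply: hp_ext => x; rewrite exprS.
exists (2^-1 * r1), (M * 2), (fun N x => x 0 0 ^+ N * a N i 0), (fun N => rn (a N i 0)).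
split; first by rewrite mulr_gt0.
apply: (@GHr_improve _ _ _ _ (M * 2)).
- by rewrite ltW // mulr_gt0.
- move=> N; have := hpZ (a N i 0) (hpX N); rewrite mulr1.
  by apply: hp_ext => x; rewrite mulrC.
- move=> K; apply: (@le_trans _ _ (\sum_(N < K) M * 2^-1 ^+ N)); last first.
    by rewrite -big_distrr /=; apply: ler_wpM2l => //; exact: half_sum.
  apply: ler_sum => N _; rewrite exprMn mulrCA mulrC; apply: ler_wpM2r.
    by rewrite exprn_ge0.
  apply: le_trans (aM N); apply: ler_wpM2r; first by rewrite exprn_ge0 // ltW.
  exact: rn_coord.
- move=> q x /andP[q0 q1] xq K.
  have q2 : 0 <= q / 2 < 1 by rewrite divr_ge0 //= ltr_pdivrMr //; lra.
  have tq : rn (x 0 0) <= q / 2 * r1.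
    by apply: le_trans (rn_coord _ _) _; rewrite -mulrA.
  have := exp _ _ q2 tq K => h.
  apply: le_trans (_ : M / (1 - q / 2) * (q / 2) ^+ K <= _).
    apply: le_trans h; have := rn_coord (alpha (x 0 0) - \sum_(j < K) x 0 0 ^+ j *: a j) i.
    rewrite !mxE summxE; congr (rn (_ - _) <= _).
    by apply: eq_bigr => j _; rewrite mxE.
  apply: ler_pM; rewrite ?exprn_ge0 ?divr_ge0 //.
  + by rewrite subr_ge0 ltW //; case/andP: q2.
  + apply: ler_wpM2l => //; rewrite -[leRHS]invrK lef_pV2 ?posrE ?invr_gt0 //.
      by rewrite lerBrDr -lerBrDl; lra.
    by rewrite subr_gt0; case/andP: q2.
  + apply: lerXn2r; rewrite ?nnegrE ?divr_ge0 //.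
    by rewrite ler_pdivrMr //; lra.
Qed.

(** Some coefficient is nonzero, for otherwise alpha would vanish on the disk, against injectivity;
    alpha 0 = 0 makes its index positive. *)
Lemma arc_leading n (alpha : C -> 'cV[C]_n) r : 0 < r -> alpha 0 = 0 ->
  arc_representative alpha r ->
  exists k (b : 'cV[C]_n), [/\ (0 < k)%N, b != 0 &
    exists A : R, 0 <= A /\ exists2 dl : R, 0 < dl & forall t, rn t < dl ->
      rn (alpha t - t ^+ k *: b) <= A * rn t ^+ k.+1].
Proof.
move=> r0 al0 ha; have [a [r1 [M [rr1 M0 aM exp]]]] := arc_expansion r0 ha.
have r10 : 0 < r1 by apply: lt_trans rr1.
have a0 : a 0%N = 0.
  have := exp 0 0; rewrite lexx ltr01 rn0 mul0r lexx => /(_ isT isT 1%N).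
  rewrite big_ord1 al0 expr0 scale1r sub0r rnN expr1 mulr0 => h.
  by apply: rn_le0; rewrite h.
have [k [ak kmin]] : exists k, a k != 0 /\ forall i, (i < k)%N -> a i = 0.
  have [[k ak]|H] := pselect (exists k, a k != 0).
    have ex : exists k, a k != 0 by exists k.
    exists (ex_minn ex); case: ex_minnP => m am mmin; split => // i im.
    by apply/eqP; apply: contraTT im => ai; rewrite -leqNgt; exact: mmin.
  have az i : a i = 0 by apply: contra_notP H => /eqP ai; exists i.
  have alz t : rn t <= r -> alpha t = 0.
    move=> tr; apply: rn_le0.
    pose q := r / r1.
    have q01 : 0 <= q < 1.
      by rewrite divr_ge0 ?ltW //= ltr_pdivrMr // mul1r.
    apply: (@le_geo _ _ _ (M / (1 - q)) q q01) => m; rewrite add0r.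
    have := exp q t q01; rewrite /q divfK ?gt_eqF // => /(_ tr m).
    by rewrite big1 ?subr0 // => i _; rewrite az scaler0.
  have [_ inj] := ha; have : (r%:C : C) = 0.
    apply: inj; first by rewrite /disk /= rn_le rn_real gtr0_norm.
      by rewrite /disk /= rn_le rn0 ltW.
    by rewrite al0 alz // rn_real gtr0_norm.
  by move=> /rc_inj rz; move: r0; rewrite rz ltxx.
exists k, (a k); split => //.
  by rewrite lt0n; apply: contraNneq ak => ->; rewrite a0.
exists (M * 2 * r1^-1 ^+ k.+1); split.
  by rewrite !mulr_ge0 // exprn_ge0 // invr_ge0 ltW.
exists (r1 / 2); first by rewrite divr_gt0.
move=> t tr.
pose q := rn t / r1.
have q2 : q <= 2^-1 by rewrite /q ler_pdivrMr // mulrC ltW.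
have q0 : 0 <= q by rewrite divr_ge0 ?rn_ge0 // ltW.
have q01 : 0 <= q < 1 by rewrite q0 /=; lra.
have tq : rn t <= q * r1 by rewrite /q divfK // gt_eqF.
have := exp q t q01 tq k.+1; rewrite big_ord_recr big1 /= => [|i _]; last first.
  by rewrite kmin // scaler0.
rewrite add0r => h; apply: le_trans h _.
have -> : q ^+ k.+1 = r1^-1 ^+ k.+1 * rn t ^+ k.+1 by rewrite /q exprMn mulrC.
rewrite mulrA; apply: ler_wpM2r; first by rewrite exprn_ge0 // rn_ge0.
apply: ler_wpM2r; first by rewrite exprn_ge0 // invr_ge0 ltW.
apply: ler_wpM2l => //; rewrite -[leRHS]invrK lef_pV2 ?posrE ?invr_gt0 //; lra.
Qed.

End Arcs.

(** * Reparametrization of an arc by a root of a coordinate *)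

Section NormalForm.
Variable R : realType.
Local Notation C := (Cplx R).

Lemma GH_fst (Y : C -> C) d (l : 'cV[C]_d -> C) : GH2 (fun t _ => Y t) ->
  GH l -> l 0 = 0 -> GH (fun x => Y (l x)).
Proof.
move=> hY hl l0.
exact: (@GH2_comp R d (fun t _ => Y t) l (fun=> 0) hY hl (GH_cst _ 0) l0).
Qed.

Lemma GH_sub d (f g : 'cV[C]_d -> C) : GH f -> GH g -> GH (fun x => f x - g x).
Proof.
move=> hf hg; apply: GH_ext (GHD hf (GHM (GH_cst d (-1)) hg)) => x.
by rewrite mulN1r.
Qed.

(* The Weierstrass polynomial has degree 1 because the k-th root [z0] of [be^-1] is
   a simple root of the initial form. *)
Lemma kth_root_parameter (beta : C -> C) (be : C) k (A dl : R) : (0 < k)%N -> be != 0 ->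
  GH2 (fun t _ => beta t) -> 0 <= A -> 0 < dl ->
  (forall t, rn t < dl -> rn (beta t - t ^+ k * be) <= A * rn t ^+ k.+1) ->
  exists (z0 : C) (zeta : C -> C), [/\ z0 != 0, GH2 (fun s _ => zeta s), zeta 0 = 0,
    forall e : R, 0 < e -> exists2 d1 : R, 0 < d1 & forall s, rn s < d1 ->
      rn (zeta s) <= e * rn s &
    exists2 d1 : R, 0 < d1 & forall s, rn s < d1 -> beta (z0 * s - zeta s) = s ^+ k].
Proof.
move=> k0 be0 hbeta A0 dl0 hA.
have [z0 z0k] := root_exists be^-1 k0.
have z00 : z0 != 0.
  by apply: contra_eq_neq z0k => ->; rewrite expr0n gtn_eqF // eq_sym invr_eq0.
(* In the chart t = s * z the initial form is be * (z0 + z) ^+ k - 1, which vanishes at z = 0 by the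
   choice of z0. *)
pose F (s t : C) := beta (z0 * s + t) - s ^+ k.
have hF : GH2 F.
  apply: GH_sub; last by apply: GHX; exact: GH_coord.
  apply: (@GH_fst beta 2 (fun x => z0 * x 0 0 + x 1 0)) => //.
    by apply: GHD; [apply: GHM; [exact: GH_cst|exact: GH_coord]|exact: GH_coord].
  by rewrite !mxE mulr0 addr0.
pose P : {poly C} := be *: (z0%:P + 'X) ^+ k - 1.
have PE z : P.[z] = be * (z0 + z) ^+ k - 1.
  by rewrite /P hornerD hornerN hornerZ horner_exp hornerD !hornerC hornerX.
have Pn0 : P != 0.
  apply: contraTneq (oner_neq0 C) => P0.
  have := PE (- z0); rewrite P0 horner0 subrr expr0n gtn_eqF //= mulr0 sub0r => /eqP.
  by rewrite eq_sym oppr_eq0 => /eqP ->; rewrite eqxx.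
have P0 : P.[0] = 0 by rewrite PE addr0 z0k mulfV // subrr.
have P'0 : P^`().[0] != 0.
  rewrite /P derivB derivC subr0 derivZ deriv_exp derivD derivC derivX add0r mul1r.
  rewrite hornerZ hornerMn horner_exp hornerD hornerC hornerX addr0.
  by rewrite mulf_neq0 // -mulr_natr mulf_neq0 ?expf_neq0 // pnatr_eq0 -lt0n.
pose K := rn z0 + 1.
have K1 : 1 <= K by rewrite lerDr rn_ge0.
have K0 : 0 < K by apply: lt_le_trans K1.
have lim z : rn z <= 1 -> small_o k (fun t => F t (t ^+ 1 * z) - t ^+ k * P.[z]).
  move=> z1 eta eta0.
  have Q0 : 0 < A * K ^+ k.+1 + 1 by rewrite ltr_wpDl // mulr_ge0 // exprn_ge0 // ltW.
  exists (Num.min (dl / K) (eta / (A * K ^+ k.+1 + 1))).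
    by rewrite lt_min !divr_gt0.
  move=> t; rewrite lt_min => /andP[t0 /andP[td te]].
  have -> : F t (t ^+ 1 * z) - t ^+ k * P.[z] =
      beta (t * (z0 + z)) - (t * (z0 + z)) ^+ k * be.
    rewrite PE /F expr1 exprMn (_ : z0 * t + t * z = t * (z0 + z)); last by ring.
    ring.
  have tK : rn (t * (z0 + z)) <= K * rn t.
    rewrite rnM mulrC; apply: ler_wpM2r; first exact: rn_ge0.
    by apply: le_trans (rnD _ _) _; rewrite lerD2l.
  apply: le_trans (hA _ _) _.
    by apply: le_lt_trans tK _; rewrite mulrC -ltr_pdivlMr.
  apply: (@le_trans _ _ (A * (K * rn t) ^+ k.+1)).
    apply: ler_wpM2l => //; exact: lerX_rn.
  have -> : A * (K * rn t) ^+ k.+1 = A * K ^+ k.+1 * rn t * rn t ^+ k.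
    by rewrite exprMn [rn t ^+ k.+1]exprS; ring.
  apply: ler_wpM2r; first by rewrite exprn_ge0 // ltW.
  exact: rn_absorb.
have [m [zeta [Z2 [[m0 [b b0 Pb]] [hz hz0] [hZ2 [d1 d10 FE]] roots _]]]] :=
  weierstrass_hensel (ltn0Sn 0) hF Pn0 P0 lim.
have m1 : m = 1%N.
  apply/eqP; rewrite eqn_leq m0 andbT leqNgt; apply: contraNN P'0.
  case: m {m0 hz0 FE roots} Pb => [|[|m]] // -> _.
  rewrite derivM derivXn hornerD !hornerM hornerMn !hornerXn hornerX.
  by rewrite -[m.+2.-1]/(m.+1) exprS !mul0r mul0rn mul0r addr0.
subst m.
have z10 : zeta 0%N 0 = 0 by exact: (hz0 ord0).
have zsmall (e : R) : 0 < e -> exists2 d1 : R, 0 < d1 & forall s, rn s < d1 ->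
    rn (zeta 0%N s) <= e * rn s.
  move=> e0; have [d2 d20 h] := roots e e0; exists d2 => // s sd.
  have [->|s0] := eqVneq s 0; first by rewrite z10 rn0 mulr0.
  have [|_ h2] := h s; first by rewrite rn_gt0 s0.
  have := h2 (- zeta 0%N s); rewrite big_ord1 expr1 expr0 mulr1 addNr => /(_ erefl).
  by rewrite rnN expr1.
exists z0, (zeta 0%N); split => //.
have [d2 d20 h2] := zsmall 1 ltr01.
exists (Num.min d1 d2); first by rewrite lt_min d10.
move=> s; rewrite lt_min => /andP[s1 s2].
have zs : rn (- zeta 0%N s) < d1.
  by rewrite rnN; apply: le_lt_trans (h2 s s2) _; rewrite mul1r.
have := FE s (- zeta 0%N s) s1 zs.
by rewrite big_ord1 expr1 expr0 mulr1 addNr mul0r /F => /eqP; rewrite subr_eq0 => /eqP.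
Qed.

(** Writing s = z0^-1 * t + w gives an equation with initial form z0 * z; its Weierstrass factor has
    a root w of size at most |t|, which also bounds s. *)
Lemma parameter_surjective (z0 : C) (zeta : C -> C) : z0 != 0 ->
  GH2 (fun s _ => zeta s) -> zeta 0 = 0 ->
  (forall e : R, 0 < e -> exists2 d1 : R, 0 < d1 & forall s, rn s < d1 ->
      rn (zeta s) <= e * rn s) ->
  forall e : R, 0 < e -> exists2 d1 : R, 0 < d1 & forall t, rn t < d1 ->
    exists2 s, rn s < e & z0 * s - zeta s = t.
Proof.
move=> z00 hz zeta0 zs e e0.
pose F (t w : C) := (z0 * (z0^-1 * t + w) - zeta (z0^-1 * t + w)) - t.
have hl : GH (fun x : 'cV[C]_2 => z0^-1 * x 0 0 + x 1 0).
  by apply: GHD; [apply: GHM; [exact: GH_cst|exact: GH_coord]|exact: GH_coord].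
have hF : GH2 F.
  apply: GH_sub; last exact: GH_coord.
  apply: GH_sub; first by apply: GHM => //; exact: GH_cst.
  by apply: (@GH_fst zeta) => //; rewrite !mxE mulr0 addr0.
pose P : {poly C} := z0 *: 'X.
have PE z : P.[z] = z0 * z by rewrite /P hornerZ hornerX.
have Pn0 : P != 0 by rewrite scaler_eq0 negb_or z00 polyX_eq0.
pose K := rn z0^-1 + 1.
have K0 : 0 < K by rewrite ltr_wpDl // rn_ge0.
have lim z : rn z <= 1 -> small_o 1 (fun t => F t (t ^+ 1 * z) - t ^+ 1 * P.[z]).
  move=> z1 eta eta0.
  have [d1 d10 h1] := zs (eta / K) (divr_gt0 eta0 K0).
  exists (d1 / K); first by rewrite divr_gt0.
  move=> t /andP[t0 td].
  have -> : F t (t ^+ 1 * z) - t ^+ 1 * P.[z] = - zeta (t * (z0^-1 + z)).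
    rewrite PE /F !expr1 (_ : z0^-1 * t + t * z = t * (z0^-1 + z)); last by ring.
    have -> : z0 * (t * (z0^-1 + z)) = t * (z0 * z0^-1) + t * (z0 * z) by ring.
    rewrite mulfV //; ring.
  have tK : rn (t * (z0^-1 + z)) <= K * rn t.
    rewrite rnM mulrC; apply: ler_wpM2r; first exact: rn_ge0.
    by apply: le_trans (rnD _ _) _; rewrite lerD2l.
  rewrite rnN; apply: le_trans (h1 _ _) _.
    by apply: le_lt_trans tK _; rewrite mulrC -ltr_pdivlMr.
  apply: (@le_trans _ _ (eta / K * (K * rn t))).
    by apply: ler_wpM2l => //; rewrite divr_ge0 // ltW.
  by rewrite mulrA divfK ?gt_eqF // expr1.
have P0 : P.[0] = 0 by rewrite PE mulr0.
have [m [ze [Z2 [_ _ [_ [d1 d10 FE]] roots _]]]] :=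
  weierstrass_hensel (ltn0Sn 0) hF Pn0 P0 lim.
have [d2 d20 h2] := roots 1 ltr01.
exists (Num.min (Num.min d1 d2) (e / K)); first by rewrite !lt_min d10 d20 divr_gt0.
move=> t; rewrite !lt_min => /andP[/andP[t1 t2] te].
have [->|t0] := eqVneq t 0.
  by exists 0; [rewrite rn0 | rewrite mulr0 zeta0 subr0].
have [|[w w0] wr] := h2 t; first by rewrite rn_gt0 t0.
have := wr w w0; rewrite mul1r expr1 => wt.
have := FE t w t1 (le_lt_trans wt t1); rewrite w0 mul0r /F => /eqP.
rewrite subr_eq0 => /eqP sE; exists (z0^-1 * t + w) => //.
apply: le_lt_trans (rnD _ _) _; rewrite rnM; apply: (@le_lt_trans _ _ (K * rn t)).
  by rewrite /K mulrDl mul1r lerD2l.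
by rewrite mulrC -ltr_pdivlMr.
Qed.

(** Substituting t = tau s makes coordinate i0 equal to s ^+ k, so that s is a k-th root of a linear
    function of the point. The last two clauses say that [gam] and [alpha] have the same image
    germ. *)
Lemma arc_normal_form n (alpha : C -> 'cV[C]_n) r : 0 < r -> alpha 0 = 0 ->
  arc_representative alpha r ->
  exists k (i0 : 'I_n) (a : 'cV[C]_n) (gam : C -> 'cV[C]_n),
  [/\ (0 < k)%N /\ a i0 0 = 1, gam 0 = 0 /\ forall i, GH2 (fun s _ => gam s i 0),
    exists A : R, 0 <= A /\ exists2 dl : R, 0 < dl & forall s, rn s < dl ->
      gam s i0 0 = s ^+ k /\ rn (gam s - s ^+ k *: a) <= A * rn s ^+ k.+1,
    exists2 dl : R, 0 < dl & forall s, rn s < dl ->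
      exists2 t, disk r t & alpha t = gam s &
    forall e : R, 0 < e -> exists2 dl : R, 0 < dl & forall t, disk r t ->
      rn (alpha t) < dl -> exists2 s, rn s < e & gam s = alpha t].
Proof.
move=> r0 al0 ha.
have [k [b [k0 bn0 [A [A0 [dl dl0 hA]]]]]] := arc_leading r0 al0 ha.
have [i0 bi0] : exists i0, b i0 0 != 0.
  have [//|H] := pselect (exists i0, b i0 0 != 0).
  case/eqP: bn0; apply/colP => i; rewrite mxE; apply/eqP.
  by apply: contra_notT H => h; exists i.
pose be := b i0 0; pose beta t := alpha t i0 0.
have hbeta : GH2 (fun t _ => beta t) by exact: arc_GH2 r0 ha.
have hAb t : rn t < dl -> rn (beta t - t ^+ k * be) <= A * rn t ^+ k.+1.
  move=> td; apply: le_trans (hA t td).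
  by have := rn_coord (alpha t - t ^+ k *: b) i0; rewrite !mxE.
have [z0 [zeta [z00 hz zeta0 zs [d1 d10 root]]]] :=
  kth_root_parameter k0 bi0 hbeta A0 dl0 hAb.
pose tau s := z0 * s - zeta s.
have tau0 : tau 0 = 0 by rewrite /tau mulr0 zeta0 subr0.
pose K := rn z0 + 1.
have K0 : 0 < K by rewrite ltr_wpDl // rn_ge0.
have [d2 d20 h2] := zs 1 ltr01.
have tauK s : rn s < d2 -> rn (tau s) <= K * rn s.
  move=> sd; apply: le_trans (rnB _ _) _; rewrite rnM /K mulrDl.
  by apply: lerD => //; exact: h2.
exists k, i0, (be^-1 *: b), (fun s => alpha (tau s)); split.
- by rewrite mxE mulVf.
- split; first by rewrite tau0.
  move=> i; apply: (@GH_fst (fun t => alpha t i 0) 2 (fun x => tau (x 0 0))).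
  + exact: arc_GH2 r0 ha.
  + apply: GH_sub; first by apply: GHM; [exact: GH_cst|exact: GH_coord].
    by apply: (@GH_fst zeta) => //; [exact: GH_coord | rewrite mxE].
  + by rewrite mxE.
- exists (rn be^-1 * ((rn be + rn b) * (A * K ^+ k.+1))); split.
    by rewrite !mulr_ge0 ?rn_ge0 ?addr_ge0 ?rn_ge0 ?exprn_ge0 // ltW.
  exists (Num.min (Num.min d1 d2) (dl / K)); first by rewrite !lt_min d10 d20 divr_gt0.
  move=> s; rewrite !lt_min => /andP[/andP[s1 s2] sl].
  have bs : beta (tau s) = s ^+ k := root s s1.
  split=> //.
  have tl : rn (tau s) < dl.
    by apply: le_lt_trans (tauK s s2) _; rewrite mulrC -ltr_pdivlMr.
  have hT : A * rn (tau s) ^+ k.+1 <= A * K ^+ k.+1 * rn s ^+ k.+1.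
    rewrite -mulrA -exprMn; apply: ler_wpM2l => //.
    by apply: lerX_rn; exact: tauK.
  (* Replacing s ^+ k by coordinate i0 of the arc splits the error into the one of the vector and
     the one of that coordinate, both of order k + 1. *)
  have -> : alpha (tau s) - s ^+ k *: (be^-1 *: b) = be^-1 *:
      (be *: (alpha (tau s) - tau s ^+ k *: b) - (beta (tau s) - tau s ^+ k * be) *: b).
    by rewrite bs; apply/colP => i; rewrite !mxE; field; exact: bi0.
  rewrite rnZ -mulrA; apply: ler_wpM2l; first exact: rn_ge0.
  apply: le_trans (rnB _ _) _; rewrite !rnZ -mulrA mulrDl; apply: lerD.
    apply: ler_wpM2l; first exact: rn_ge0.
    exact: le_trans (hA _ tl) hT.
  rewrite mulrC; apply: ler_wpM2l; first exact: rn_ge0.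
  exact: le_trans (hAb _ tl) hT.
- exists (Num.min d2 (r / K)); first by rewrite lt_min d20 divr_gt0.
  move=> s; rewrite lt_min => /andP[s2 sr]; exists (tau s) => //.
  rewrite /disk /= rn_le; apply: le_trans (tauK s s2) _.
  by rewrite mulrC -ler_pdivlMr // ltW.
- move=> e e0; have [d3 d30 h3] := parameter_surjective z00 hz zeta0 zs e0.
  have [d4 d40 h4] := arc_away r0 al0 ha d30.
  exists d4 => // t; rewrite /disk /= rn_le => tr at4.
  by have [s se st] := h3 t (h4 t tr at4); exists s => //; rewrite /tau st.
Qed.

End NormalForm.

(** * Zeros of an equation along a parametrized surface *)

Section Along.
Variable R : realType.
Local Notation C := (Cplx R).
Variables (d : nat) (f psi : 'cV[C]_d -> C) (m : nat) (B A df : R).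
Hypothesis hf : GH f.
Hypothesis hpsi : hp m B psi.
Hypothesis A0 : 0 <= A.
Hypothesis df0 : 0 < df.
Hypothesis hfpsi : forall x, rn x < df -> rn (f x - psi x) <= A * rn x ^+ m.+1.

Lemma weierstrass_along (Y : C -> C -> 'cV[C]_d) (k K : nat) (V : C -> 'cV[C]_d)
    (P : {poly C}) : (0 < k)%N -> (0 < K)%N ->
  (forall i, GH2 (fun t w => Y t w i 0)) -> Y 0 0 = 0 ->
  (forall z, rn z <= 1 -> small_o K (fun t => Y t (t ^+ k * z) - t ^+ K *: V z)) ->
  (forall z, psi (V z) = P.[z]) -> P != 0 -> P.[0] = 0 ->
  exists (q : nat) (zeta : nat -> C -> C) (Z2 : C -> C -> C),
  [/\ (forall i, GH2 (fun t _ => zeta i t)) /\ (forall i : 'I_q, zeta i 0 = 0),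
      GH2 Z2,
      exists2 dl : R, 0 < dl & forall t w, rn t < dl -> rn w < dl ->
        f (Y t w) = (w ^+ q + \sum_(i < q) zeta i t * w ^+ i) * Z2 t w,
      (forall e : R, 0 < e -> exists2 dl : R, 0 < dl & forall t, 0 < rn t < dl ->
        (exists w, w ^+ q + \sum_(i < q) zeta i t * w ^+ i = 0) /\
        (forall w, w ^+ q + \sum_(i < q) zeta i t * w ^+ i = 0 -> rn w <= e * rn t ^+ k)) &
      exists2 e : R, 0 < e & exists2 dl : R, 0 < dl & forall t w, 0 < rn t < dl ->
        rn w <= e * rn t ^+ k -> Z2 t w != 0].
Proof.
move=> k0 K0 hY Y0 hV VP Pn0 P0.
have hF : GH2 (fun t w => f (Y t w)) by exact: GH2_compf.
have lim z : rn z <= 1 ->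
    small_o (K * m) (fun t => f (Y t (t ^+ k * z)) - t ^+ (K * m) * P.[z]).
  move=> z1 eta eta0; rewrite -VP.
  exact: (limit_along K0 hpsi A0 df0 hfpsi (hV z z1) eta0).
have [q [zeta [Z2 [_ hz [hZ2 hFE] roots nonv]]]] :=
  weierstrass_hensel k0 hF Pn0 P0 lim.
by exists q, zeta, Z2; split.
Qed.

(** The roots w of the Weierstrass factor are o(t ^+ k), and so close to slope 0 the points of the
    chart have directions tending to v. *)
Lemma zeros_along (Y : C -> C -> 'cV[C]_d) (k K : nat) (V : C -> 'cV[C]_d)
    (P : {poly C}) (v : 'cV[C]_d) : (0 < k)%N -> (0 < K)%N ->
  (forall i, GH2 (fun t w => Y t w i 0)) -> Y 0 0 = 0 ->
  (forall z, rn z <= 1 -> small_o K (fun t => Y t (t ^+ k * z) - t ^+ K *: V z)) ->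
  (forall z, psi (V z) = P.[z]) -> P != 0 -> P.[0] = 0 ->
  (forall eta : R, 0 < eta -> exists2 e : R, 0 < e & exists2 dl : R, 0 < dl &
     forall t w, 0 < rn t < dl -> rn w <= e * rn t ^+ k ->
     rn (Y t w - t ^+ K *: v) <= eta * rn t ^+ K) ->
  forall eta : R, 0 < eta -> exists t w, [/\ rn t < eta, rn w < eta, f (Y t w) = 0,
    rn (Y t w) < eta & exists c : C, rn (c *: Y t w - v) < eta].
Proof.
move=> k0 K0 hY Y0 hV VP Pn0 P0 close eta eta0.
have [q [zeta [Z2 [_ _ [d1 d10 FE] roots _]]]] := weierstrass_along k0 K0 hY Y0 hV VP Pn0 P0.
have e2 : 0 < eta / 2 by rewrite divr_gt0.
have [e e0 [d2 d20 h2]] := close _ e2.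
pose e' := Num.min e 1; have e'0 : 0 < e' by rewrite lt_min e0 ltr01.
have [d3 d30 h3] := roots e' e'0.
have Q0 : 0 < rn v + eta by rewrite ltr_wpDl // rn_ge0.
have [|t /andP[t0]] := @small_real R (Num.min (Num.min (Num.min d1 d2) (Num.min d3 eta))
    (Num.min 1 (eta / (rn v + eta)))).
  by rewrite !lt_min d10 d20 d30 eta0 ltr01 divr_gt0.
rewrite !lt_min => /andP[/andP[/andP[t1 t2] /andP[t3 te]] /andP[tone tq]].
have [|[w w0] wr] := h3 t; first by rewrite t0 t3.
have we := wr w w0.
have pow_le j : (0 < j)%N -> rn t ^+ j <= rn t.
  by move=> j0; rewrite -[leRHS](expr1 (rn t)); apply: ler_wiXn2l => //; exact: ltW.
have wt : rn w <= rn t.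
  apply: le_trans we _; apply: le_trans (pow_le k k0).
  by rewrite ler_piMl ?exprn_ge0 ?ge_min ?lexx ?orbT // ltW.
have tK : 0 < rn t ^+ K by rewrite exprn_gt0.
have Yv : rn (Y t w - t ^+ K *: v) <= eta / 2 * rn t ^+ K.
  apply: h2; rewrite ?t0 ?t2 //; apply: le_trans we _.
  by apply: ler_wpM2r; rewrite ?exprn_ge0 ?ge_min ?lexx // ltW.
exists t, w; split => //; first exact: le_lt_trans wt te.
- by rewrite FE ?w0 ?mul0r // (le_lt_trans wt).
- rewrite -(subrK (t ^+ K *: v) (Y t w)); apply: le_lt_trans (rnD _ _) _.
  apply: (@le_lt_trans _ _ ((rn v + eta) * rn t ^+ K)).
    rewrite rnZ rnX [rn t ^+ K * _]mulrC mulrDl addrC lerD2l.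
    apply: le_trans Yv _; apply: ler_wpM2r; first exact: ltW.
    by rewrite ler_pdivrMr // ler_peMr ?ler1n // ltW.
  apply: (@le_lt_trans _ _ ((rn v + eta) * rn t)).
    by apply: ler_wpM2l; [exact: ltW | exact: pow_le].
  by rewrite mulrC -ltr_pdivlMr.
- exists (t ^+ K)^-1; have tn0 : t ^+ K != 0 by rewrite expf_neq0 // -rn_gt0.
  have -> : (t ^+ K)^-1 *: Y t w - v = (t ^+ K)^-1 *: (Y t w - t ^+ K *: v).
    by rewrite scalerBr scalerA mulVf // scale1r.
  rewrite rnZ rnV rnX mulrC ltr_pdivrMr //; apply: le_lt_trans Yv _.
  by rewrite ltr_pM2r // ltr_pdivrMr // ltr_pMr // ltr1n.
Qed.

(** Suppose psi vanishes on L and psi w != 0. For each e in L, psi (e + z *: w) is a nonzero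
    polynomial with root 0, so X has points in the plane of e and w whose secants tend to e. The
    whole pencil would lie in the cone, without isolated points. *)
Lemma initial_form_on_plane (X : set 'cV[C]_d) (L : {vspace 'cV[C]_d}) (dX : R) :
  0 < dX -> (forall x, rn x < dX -> f x = 0 -> X x) -> (exists b, psi b != 0) ->
  \dim L = 2%N ->
  tangent_cone X `&` proj_line L `<=` isolated (tangent_cone X `&` proj_line L) ->
  exists2 b, b \in L & psi b != 0.
Proof.
move=> dX0 fX [w pw] dL iso; apply: contrapT => H.
have pL b : b \in L -> psi b = 0.
  by move=> bL; apply/eqP; apply: contra_notT H => pb; exists b.
apply: (not_isolated_pencil dL _ iso) => l lL.
have le := proj_vpickE l; set e := vpick (\val l) in le.
have eL : e \in L by rewrite memvE -le; exact: lL.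
have [P PE] := hp_line e w hpsi.
have Pn0 : P != 0.
  apply: contraNneq pw => P0; apply/eqP.
  have := @hp_vanish_span R d m B psi e w hpsi _ 0 1.
  by rewrite scale0r add0r scale1r; apply => z; rewrite PE P0 horner0.
have P0 : P.[0] = 0 by rewrite -PE scale0r addr0 pL.
pose Y (t w' : C) := t *: e + w' *: w.
have hY i : GH2 (fun t w' => Y t w' i 0).
  apply: (@GH_ext _ _ (fun x : 'cV[C]_2 => x 0 0 * e i 0 + x 1 0 * w i 0)).
    by move=> x; rewrite /fun2 !mxE.
  by apply: GHD; apply: GHM; (exact: GH_coord || exact: GH_cst).
have Y0 : Y 0 0 = 0 by rewrite /Y !scale0r addr0.
have hV z : rn z <= 1 -> small_o 1 (fun t => Y t (t ^+ 1 * z) - t ^+ 1 *: (e + z *: w)).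
  move=> z1 eta eta0; exists 1 => // t _.
  rewrite /Y !expr1 scalerDr scalerA subrr rn0.
  by rewrite mulr_ge0 ?rn_ge0 // ltW.
have close (eta : R) : 0 < eta -> exists2 e' : R, 0 < e' & exists2 dl : R, 0 < dl &
     forall t w', 0 < rn t < dl -> rn w' <= e' * rn t ^+ 1 ->
     rn (Y t w' - t ^+ 1 *: e) <= eta * rn t ^+ 1.
  move=> eta0; have w1 : 0 < rn w + 1 by rewrite ltr_wpDl // rn_ge0.
  exists (eta / (rn w + 1)); first by rewrite divr_gt0.
  exists 1 => // t w' _; rewrite /Y !expr1 [t *: e + _]addrC addrK rnZ => h1.
  apply: (@le_trans _ _ (rn w' * (rn w + 1))).
    by apply: ler_wpM2l; rewrite ?rn_ge0 // lerDl.
  by rewrite -ler_pdivlMr // mulrAC.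
apply/(tangent_coneP _ le) => eps eps0.
have ed0 : 0 < Num.min eps dX by rewrite lt_min eps0.
have [t [w' [_ _ fY Ye Yc]]] :=
  zeros_along (ltn0Sn 0) (ltn0Sn 0) hY Y0 hV PE Pn0 P0 close ed0.
move: Ye; rewrite lt_min => /andP[Ye Yd]; exists (Y t w'); split => //.
  exact: fX.
by have [c] := Yc; rewrite lt_min => /andP[c1 _]; exists c.
Qed.

End Along.

(** * Arc-sections *)

Section Graphs.
Variable R : realType.
Local Notation C := (Cplx R).
Variables (n : nat) (p : 'Hom('cV[C]_n.+1, 'cV[C]_n)) (u : 'cV[C]_n.+1).
Hypotheses (keru : lker p = <[u]>%VS) (u0 : u != 0).
Variables (k : nat) (i0 : 'I_n) (a : 'cV[C]_n) (gam : C -> 'cV[C]_n) (A dl : R).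
Hypotheses (k0 : (0 < k)%N) (ai0 : a i0 0 = 1) (gam0 : gam 0 = 0).
Hypothesis hgam : forall i, GH2 (fun s _ => gam s i 0).
Hypotheses (A0 : 0 <= A) (dl0 : 0 < dl).
Hypothesis gamE : forall s, rn s < dl ->
  gam s i0 0 = s ^+ k /\ rn (gam s - s ^+ k *: a) <= A * rn s ^+ k.+1.
Variable sec : 'cV[C]_n -> 'cV[C]_n.+1.
Hypothesis sec_lin : forall c x y, sec (c *: x + y) = c *: sec x + sec y.
Hypothesis psec : forall y, p (sec y) = y.

Let pu : p u = 0.
Proof. by apply/eqP; rewrite -memv_ker keru memv_line. Qed.

Lemma sec0 : sec 0 = 0.
Proof. by apply: (addrI (sec 0)); have := sec_lin 1 0 0; rewrite !scale1r !addr0 => <-. Qed.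

Lemma secB x y c : sec (x - c *: y) = sec x - c *: sec y.
Proof. by rewrite addrC -scaleNr sec_lin scaleNr addrC. Qed.

Lemma sec_gam_GH2 i : GH2 (fun t _ => sec (gam t) i 0).
Proof.
apply: (@GH_ext _ _ (fun x : 'cV[C]_2 => \sum_j gam (x 0 0) j 0 * sec (delta_mx j 0) i 0)).
  move=> x; rewrite /fun2 [in RHS](lin_expand sec_lin) summxE.
  by apply: eq_bigr => j _; rewrite mxE.
by apply: GH_sum => j _; apply: GHM; [exact: hgam | exact: GH_cst].
Qed.

Lemma sec_gam_leading : exists2 Q : R, 0 <= Q & forall s, rn s < dl ->
  rn (sec (gam s) - s ^+ k *: sec a) <= Q * rn s ^+ k.+1.
Proof.
have [K K0 hK] := lin_bound sec_lin.
exists (K * A) => [|s sd]; first by rewrite mulr_ge0 // ltW.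
rewrite -secB; apply: le_trans (hK _) _; rewrite -mulrA; apply: ler_wpM2l; first exact: ltW.
by have [] := gamE sd.
Qed.

(* Charts of the surface swept by the lines parallel to [ker p] through the arc:
   [graph] is adapted to directions transverse to the kernel, and [graph'], with
   the height taken as [s ^+ k], to the kernel direction itself. *)
Definition graph (t w : C) := sec (gam t) + w *: u.
Definition graph' (s t : C) := sec (gam t) + s ^+ k *: u.

Lemma p_graph t w : p (graph t w) = gam t.
Proof. by rewrite /graph addrC linearP /= pu scaler0 add0r psec. Qed.

Lemma graph_GH2 i : GH2 (fun t w => graph t w i 0).
Proof.
apply: (@GH_ext _ _ (fun x : 'cV[C]_2 => sec (gam (x 0 0)) i 0 + x 1 0 * u i 0)).
  by move=> x; rewrite /fun2 /graph !mxE.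
apply: GHD; first exact: sec_gam_GH2.
by apply: GHM; [exact: GH_coord|exact: GH_cst].
Qed.

Lemma graph'_GH2 i : GH2 (fun s t => graph' s t i 0).
Proof.
apply: (@GH_ext _ _ (fun x : 'cV[C]_2 => sec (gam (x 1 0)) i 0 + x 0 0 ^+ k * u i 0)).
  by move=> x; rewrite /fun2 /graph' !mxE.
apply: GHD.
  apply: (@GH_fst R (fun t => sec (gam t) i 0) 2 (fun x => x 1 0)).
  - exact: sec_gam_GH2.
  - exact: GH_coord.
  - by rewrite mxE.
by apply: GHM; [apply: GHX; exact: GH_coord|exact: GH_cst].
Qed.

Lemma graph0 : graph 0 0 = 0.
Proof. by rewrite /graph gam0 sec0 scale0r addr0. Qed.

Lemma graph'0 : graph' 0 0 = 0.
Proof. by rewrite /graph' gam0 sec0 expr0n gtn_eqF // scale0r addr0. Qed.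

Lemma graph_limit z : rn z <= 1 ->
  small_o k (fun t => graph t (t ^+ k * z) - t ^+ k *: (sec a + z *: u)).
Proof.
move=> _ eta eta0; have [Q Q0 hQ] := sec_gam_leading.
have Q1 : 0 < Q + 1 by rewrite ltr_wpDl.
exists (Num.min dl (eta / (Q + 1))); first by rewrite lt_min dl0 divr_gt0.
move=> t; rewrite lt_min => /andP[t0 /andP[td te]].
have -> : graph t (t ^+ k * z) - t ^+ k *: (sec a + z *: u) =
    sec (gam t) - t ^+ k *: sec a.
  by rewrite /graph scalerDr scalerA opprD addrACA subrr addr0.
apply: le_trans (hQ t td) _; rewrite exprS mulrA; apply: ler_wpM2r.
  by rewrite exprn_ge0 // ltW.
exact: rn_absorb.
Qed.

Lemma graph_close (eta : R) : 0 < eta -> exists2 e : R, 0 < e & exists2 d1 : R, 0 < d1 &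
  forall t w, 0 < rn t < d1 -> rn w <= e * rn t ^+ k ->
    rn (graph t w - t ^+ k *: sec a) <= eta * rn t ^+ k.
Proof.
move=> eta0; have e2 : 0 < eta / 2 by rewrite divr_gt0.
have [Q Q0 hQ] := sec_gam_leading.
have Q1 : 0 < Q + 1 by rewrite ltr_wpDl.
have U1 : 0 < rn u + 1 by rewrite ltr_wpDl // rn_ge0.
exists (eta / 2 / (rn u + 1)); first by rewrite divr_gt0.
exists (Num.min dl (eta / 2 / (Q + 1))); first by rewrite lt_min dl0 divr_gt0.
move=> t w; rewrite lt_min => /andP[t0 /andP[td te]] we.
rewrite /graph addrAC; apply: le_trans (rnD _ _) _.
rewrite [X in X * _]splitr mulrDl; apply: lerD.
  apply: le_trans (hQ t td) _; rewrite exprS mulrA; apply: ler_wpM2r.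
    by rewrite exprn_ge0 // ltW.
  exact: rn_absorb.
rewrite rnZ; apply: (@le_trans _ _ (rn w * (rn u + 1))).
  by apply: ler_wpM2l; rewrite ?rn_ge0 // lerDl.
by rewrite -ler_pdivlMr // mulrAC.
Qed.

Lemma graph'_limit z : rn z <= 1 ->
  small_o k (fun s => graph' s (s ^+ 1 * z) - s ^+ k *: (u + z ^+ k *: sec a)).
Proof.
move=> z1 eta eta0; have [Q Q0 hQ] := sec_gam_leading.
have Q1 : 0 < Q + 1 by rewrite ltr_wpDl.
exists (Num.min dl (eta / (Q + 1))); first by rewrite lt_min dl0 divr_gt0.
move=> s; rewrite lt_min => /andP[s0 /andP[sd se]].
have szs : rn (s * z) <= rn s by rewrite rnM ler_piMr // ltW.
have -> : graph' s (s ^+ 1 * z) - s ^+ k *: (u + z ^+ k *: sec a) =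
    sec (gam (s * z)) - (s * z) ^+ k *: sec a.
  by rewrite /graph' expr1 scalerDr scalerA -exprMn opprD addrA addrK.
apply: le_trans (hQ _ (le_lt_trans szs sd)) _.
apply: (@le_trans _ _ (Q * rn s ^+ k.+1)).
  by apply: ler_wpM2l => //; exact: lerX_rn.
rewrite exprS mulrA; apply: ler_wpM2r; first by rewrite exprn_ge0 // ltW.
exact: rn_absorb.
Qed.

Lemma graph'_close (eta : R) : 0 < eta -> exists2 e : R, 0 < e & exists2 d1 : R, 0 < d1 &
  forall s t, 0 < rn s < d1 -> rn t <= e * rn s ^+ 1 ->
    rn (graph' s t - s ^+ k *: u) <= eta * rn s ^+ k.
Proof.
move=> eta0; have [Q Q0 hQ] := sec_gam_leading.
pose K := Q + rn (sec a); have K0 : 0 <= K by rewrite addr_ge0 // rn_ge0.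
have K1 : 0 < K + 1 by rewrite ltr_wpDl.
pose e := Num.min 1 (eta / (K + 1)).
have e0 : 0 < e by rewrite lt_min ltr01 divr_gt0.
have e1 : e <= 1 by rewrite ge_min lexx.
exists e => //; exists (Num.min dl 1); first by rewrite lt_min dl0 ltr01.
move=> s t; rewrite lt_min expr1 => /andP[s0 /andP[sd s1]] te.
have ts : rn t <= rn s by apply: le_trans te _; rewrite ler_piMl // ltW.
have t1 : rn t <= 1 by apply: le_trans ts (ltW s1).
rewrite /graph' addrK -(subrK (t ^+ k *: sec a) (sec (gam t))).
have tk0 : 0 <= rn t ^+ k by rewrite exprn_ge0 // rn_ge0.
apply: (@le_trans _ _ (K * rn t ^+ k)).
  apply: le_trans (rnD _ _) _; rewrite mulrDl; apply: lerD; last by rewrite rnZ rnX mulrC.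
  apply: le_trans (hQ _ (le_lt_trans ts sd)) _; apply: ler_wpM2l => //.
  by rewrite exprS ler_piMl.
apply: (@le_trans _ _ ((K + 1) * (e * rn s ^+ k))).
  apply: ler_pM => //; first by rewrite lerDl.
  apply: (@le_trans _ _ ((e * rn s) ^+ k)).
    exact: lerX_rn.
  rewrite exprMn; apply: ler_wpM2r; first by rewrite exprn_ge0 // ltW.
  rewrite -[leRHS](expr1 e); apply: ler_wiXn2l => //; exact: ltW.
rewrite mulrA; apply: ler_wpM2r; first by rewrite exprn_ge0 // ltW.
by rewrite mulrC -ler_pdivlMr // ge_min lexx orbT.
Qed.

(** x - sec (p x) lies in the kernel; dividing one of its coordinates by the same coordinate of u
    gives the linear function completing p to coordinates. *)
Lemma height_exists : exists h : 'cV[C]_n.+1 -> C,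
  [/\ forall c x y, h (c *: x + y) = c * h x + h y,
      forall x, x = sec (p x) + h x *: u, h u = 1 &
      exists2 K : R, 0 < K & forall x, rn (h x) <= K * rn x].
Proof.
have [j0 uj0] : exists j0, u j0 0 != 0.
  have [//|H] := pselect (exists j0, u j0 0 != 0).
  case/eqP: u0; apply/colP => i; rewrite mxE; apply/eqP.
  by apply: contra_notT H => h; exists i.
pose g (x : 'cV[C]_n.+1) := x - sec (p x).
have glin c x y : g (c *: x + y) = c *: g x + g y.
  by rewrite /g linearP sec_lin scalerBr opprD addrACA.
pose h x := g x j0 0 / u j0 0.
have hE x : g x = h x *: u.
  have : g x \in <[u]>%VS.
    rewrite -keru memv_ker /g linearB /= psec subrr //.
  by case/vlineP => c gE; rewrite /h gE mxE mulfK.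
have [K K0 hK] := lin_bound glin.
exists h; split.
- by move=> c x y; rewrite /h glin !mxE mulrDl mulrA.
- by move=> x; rewrite -hE /g addrC subrK.
- by rewrite /h /g pu sec0 subr0 mulfV.
exists (K * rn (u j0 0)^-1); first by rewrite mulr_gt0 // rn_gt0 invr_eq0.
move=> x; rewrite /h rnM mulrAC; apply: ler_wpM2r; first exact: rn_ge0.
exact: le_trans (rn_coord _ _) (hK x).
Qed.

Lemma branch_analytic (h : 'cV[C]_n.+1 -> C) (G : C -> C -> C) :
  (forall c x y, h (c *: x + y) = c * h x + h y) -> GH2 G ->
  analytic_germ [set x | exists s, [/\ s ^+ k = p x i0 0, p x = gam s & G s (h x) = 0]].
Proof.
move=> hlin hG.
have [hh h0] := @GH_lin R _ (h : 'cV[C]_n.+1 -> C^o) hlin.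
have hp i : GH (fun x => p x i 0) /\ p 0 i 0 = 0.
  apply: (@GH_lin R _ (fun x => p x i 0 : C^o)) => c x y.
  by rewrite linearP !mxE.
(* The index [ord0] carries the equation G = 0, the others the coordinates of p x = gam s. *)
pose lam (i : 'I_n.+1) x : C := if unlift ord0 i is Some j then p x j 0 else 0.
pose Z (i : 'I_n.+1) s w : C := if unlift ord0 i is Some j then gam s j 0 else G s w.
have hlam i : GH (lam i).
  by rewrite /lam; case: (unlift _ _) => [j|]; [have [] := hp j | exact: GH_cst].
have hZ i : GH2 (Z i) by rewrite /Z; case: (unlift _ _).
have := @analytic_image R _ k _ (fun x => p x i0 0) h lam Z k0
  (hp i0).1 (hp i0).2 hh h0 hlam hZ.
congr analytic_germ; apply/seteqP; split => x /= [s].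
- move=> [sk H]; exists s; split => //.
    apply/colP => j; have := H (lift ord0 j); rewrite /lam /Z liftK; exact.
  by have := H ord0; rewrite /lam /Z unlift_none.
- move=> [sk px Gs]; exists s; split => // i; rewrite /lam /Z.
  by case: (unlift _ _) => [j|]; rewrite ?px.
Qed.

End Graphs.

(** * Tangent cone and reducibility of the arc-section *)

Section ArcSection.
Variable R : realType.
Local Notation C := (Cplx R).
Variables (n : nat) (X : set 'cV[C]_n.+1) (p : 'Hom('cV[C]_n.+1, 'cV[C]_n)).
Variables (L : {vspace 'cV[C]_n.+1}) (alpha : C -> 'cV[C]_n) (r : R).
Hypotheses (limp : limg p = fullv) (dimL : \dim L = 2%N) (kerL : (lker p <= L)%VS).
Variables (f psi : 'cV[C]_n.+1 -> C) (m : nat) (B Af df dX : R).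
Hypotheses (hf : GH f) (hpsi : hp m B psi) (Af0 : 0 <= Af) (df0 : 0 < df).
Hypothesis hfpsi : forall x, rn x < df -> rn (f x - psi x) <= Af * rn x ^+ m.+1.
Hypotheses (dX0 : 0 < dX) (fX : forall x, rn x < dX -> (X x <-> f x = 0)).
Variables (k : nat) (i0 : 'I_n) (a : 'cV[C]_n) (gam : C -> 'cV[C]_n) (A dl d1 : R).
Hypotheses (k0 : (0 < k)%N) (ai0 : a i0 0 = 1) (gam0 : gam 0 = 0).
Hypothesis hgam : forall i, GH2 (fun s _ => gam s i 0).
Hypotheses (A0 : 0 <= A) (dl0 : 0 < dl).
Hypothesis gamE : forall s, rn s < dl ->
  gam s i0 0 = s ^+ k /\ rn (gam s - s ^+ k *: a) <= A * rn s ^+ k.+1.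
Hypothesis d10 : 0 < d1.
Hypothesis gam_arc : forall s, rn s < d1 -> exists2 t, disk r t & alpha t = gam s.
Hypothesis arc_gam : forall e : R, 0 < e -> exists2 d : R, 0 < d & forall t, disk r t ->
  rn (alpha t) < d -> exists2 s, rn s < e & gam s = alpha t.
Hypothesis cone_arc : tangent_cone (alpha @` disk r) = proj_image p L.
Variable b : 'cV[C]_n.+1.
Hypotheses (bL : b \in L) (psib : psi b != 0).

Local Notation S := (arc_section X p alpha r).

Lemma kernel_line : exists2 u, u != 0 & lker p = <[u]>%VS.
Proof.
have dk : \dim (lker p) = 1%N.
  have := limg_ker_dim p fullv; rewrite capfv limp !dimvf /dim /= !muln1 => h.
  by apply/eqP; rewrite -(eqn_add2r n) h add1n.
exists (vpick (lker p)); first by rewrite vpick0 -dimv_eq0 dk.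
apply/esym/eqP; rewrite eqEdim -memvE memv_pick /= dim_vline vpick0 -dimv_eq0 dk //.
Qed.

(** An arbitrary linear section is corrected by y i0 0 *: w with w in the kernel, a term equal to w
    at a since a i0 0 = 1. With sec a = v the direction v has slope 0 in the chart. *)
Lemma section_exists v : p v = a -> exists sec : 'cV[C]_n -> 'cV[C]_n.+1,
  [/\ forall c x y, sec (c *: x + y) = c *: sec x + sec y,
      forall y, p (sec y) = y & sec a = v].
Proof.
move=> pv; pose q y := (p^-1)%VF y.
have pq y : p (q y) = y by rewrite /q limg_lfunVK // limp memvf.
have [w pw wE] : exists2 w, p w = 0 & q a + w = v.
  by exists (v - q a); [rewrite linearB /= pq pv subrr|rewrite addrC subrK].
exists (fun y => q y + y i0 0 *: w); split.
- move=> c x y; have -> : q (c *: x + y) = c *: q x + q y by rewrite /q linearP.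
  by rewrite !mxE scalerDl -scalerA addrACA -scalerDr.
- by move=> y; rewrite linearD linearZ /= pq pw scaler0 addr0.
- by rewrite ai0 scale1r.
Qed.

Lemma L_pE x : (p x \in (p @: L)%VS) = (x \in L).
Proof.
apply/idP/idP => [/memv_imgP[y yL pxy]|]; last exact: memv_img.
have h : x - y \in L.
  by apply: (subvP kerL); rewrite memv_ker linearB /= pxy subrr.
by rewrite -(subrK y x) memvD.
Qed.

(** a spans a limit of secants of the arc, and [cone_arc] places that line in the image of L. *)
Lemma arc_direction : exists2 v, v \in L & p v = a.
Proof.
have a0 : a != 0 by apply/eqP => a0; move: ai0; rewrite a0 mxE => /eqP; rewrite eq_sym oner_eq0.
have [l la] := line_exists a0.
have : tangent_cone (alpha @` disk r) l.
  apply/(tangent_coneP _ la) => eps eps0.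
  have Q0 : 0 < A + rn a + 1 by rewrite ltr_wpDl // addr_ge0 // rn_ge0.
  have A1 : 0 < A + 1 by rewrite ltr_wpDl.
  have [|s /andP[s0]] := @small_real R (Num.min (Num.min dl d1) (Num.min 1
      (Num.min (eps / (A + rn a + 1)) (eps / (A + 1))))).
    by rewrite !lt_min dl0 d10 ltr01 !divr_gt0.
  rewrite !lt_min => /andP[/andP[sl sd] /andP[s1 /andP[se1 se2]]].
  have [_ gs] := gamE sl.
  have sk : rn s ^+ k <= rn s.
    by rewrite -[leRHS](expr1 (rn s)); apply: ler_wiXn2l => //; exact: ltW.
  have [t tr at_] := gam_arc sd.
  have sk0 : 0 < rn s ^+ k by rewrite exprn_gt0.
  exists (gam s); split; first by exists t.
    rewrite -(subrK (s ^+ k *: a) (gam s)); apply: le_lt_trans (rnD _ _) _.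
    apply: (@le_lt_trans _ _ ((A + rn a + 1) * rn s)); last by rewrite mulrC -ltr_pdivlMr.
    apply: (@le_trans _ _ ((A + rn a) * rn s ^+ k)).
      rewrite mulrDl; apply: lerD; last by rewrite rnZ rnX mulrC.
      apply: le_trans gs _; apply: ler_wpM2l => //.
      by rewrite exprS ler_piMl ?ltW.
    apply: ler_pM => //; [by rewrite addr_ge0 ?rn_ge0 | exact: ltW | by rewrite lerDl].
  exists (s ^+ k)^-1; have sn0 : s ^+ k != 0 by rewrite expf_neq0 // -rn_gt0.
  have -> : (s ^+ k)^-1 *: gam s - a = (s ^+ k)^-1 *: (gam s - s ^+ k *: a).
    by rewrite scalerBr scalerA mulVf // scale1r.
  rewrite rnZ rnV rnX mulrC ltr_pdivrMr //; apply: le_lt_trans gs _.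
  rewrite exprS mulrA ltr_pM2r //.
  apply: (@le_lt_trans _ _ ((A + 1) * rn s)); last by rewrite mulrC -ltr_pdivlMr.
  by apply: ler_wpM2r; rewrite ?rn_ge0 // lerDl.
rewrite cone_arc => -[l' [l'L _ la']].
have : a \in (p @: \val l')%VS by rewrite -la' la memv_line.
by case/memv_imgP => v vl ->; exists v => //; exact: (subvP l'L).
Qed.

Lemma plane_span u v : u != 0 -> lker p = <[u]>%VS -> v \in L -> p v = a ->
  forall x, x \in L -> exists c e, x = c *: v + e *: u.
Proof.
move=> u0 keru vL pv x xL.
have a0 : a != 0 by apply/eqP => a0; move: ai0; rewrite a0 mxE => /eqP; rewrite eq_sym oner_eq0.
have dp : \dim (p @: L) = 1%N.
  have := limg_ker_dim p L; rewrite (capv_idPr kerL) dimL.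
  by rewrite keru dim_vline u0 /= => -[].
have pL : (p @: L)%VS = <[a]>%VS.
  apply/esym/eqP; rewrite eqEdim -memvE -pv memv_img //= dp dim_vline pv a0 //.
have : p x \in <[a]>%VS by rewrite -pL memv_img.
case/vlineP => c pxc; exists c.
have : x - c *: v \in <[u]>%VS by rewrite -keru memv_ker linearB linearZ /= pv pxc subrr.
by case/vlineP => e xe; exists e; rewrite -xe addrC subrK.
Qed.

Lemma mem_section s x : rn s < d1 -> p x = gam s -> rn x < dX -> f x = 0 -> S x.
Proof.
move=> sd px xd fx; have [t tr at_] := gam_arc sd.
by split; [exists t => //; rewrite at_ px | apply/(fX xd)].
Qed.

(** Secants of the section are secants of X. Where p e != 0 they project to secants of the arc,
    whose limits lie in the image of L; the remaining direction is the kernel, contained in L. *)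
Lemma cone_sectionS : tangent_cone S `<=` tangent_cone X `&` proj_line L.
Proof.
move=> l lS; have le := proj_vpickE l; set e := vpick (\val l) in le.
have /(tangent_coneP _ le) h := lS; split.
  apply/(tangent_coneP _ le) => eps eps0; have [x [[_ Xx] xe xc]] := h eps eps0.
  by exists x.
rewrite /proj_line /= le -memvE -L_pE.
have [->|pe0] := eqVneq (p e) 0; first exact: mem0v.
have [l' l'e] := line_exists pe0.
have [K K0 hK] := lin_bound (fun c x y => linearP p c x y).
have : tangent_cone (alpha @` disk r) l'.
  apply/(tangent_coneP _ l'e) => eps eps0.
  have eK : 0 < eps / K by rewrite divr_gt0.
  have [x [[[t tr atx] _] xe [c xc]]] := h _ eK.
  exists (p x); split; first by exists t.
    by apply: le_lt_trans (hK _) _; rewrite mulrC -ltr_pdivlMr.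
  exists c; have := hK (c *: x - e); rewrite linearB linearZ /= => h1.
  by apply: le_lt_trans h1 _; rewrite mulrC -ltr_pdivlMr.
rewrite cone_arc => -[l2 [l2L _ l2e]].
by apply: (subvP (limgS p l2L)); rewrite -l2e l'e memv_line.
Qed.

Section Transverse.
Variables (u v : 'cV[C]_n.+1) (sec : 'cV[C]_n -> 'cV[C]_n.+1).
Hypotheses (u0 : u != 0) (keru : lker p = <[u]>%VS) (vL : v \in L) (pv : p v = a).
Hypothesis sec_lin : forall c x y, sec (c *: x + y) = c *: sec x + sec y.
Hypotheses (psec : forall y, p (sec y) = y) (seca : sec a = v).

(** v and u span L, so psi would vanish at b if it vanished along v + z *: u. *)
Lemma transverse_poly : psi v = 0 ->
  exists P : {poly C}, [/\ forall z, psi (sec a + z *: u) = P.[z], P != 0 & P.[0] = 0].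
Proof.
move=> psiv; rewrite seca; have [P PE] := hp_line v u hpsi; exists P; split => //.
  apply: contraNneq psib => P0; apply/eqP.
  have [c [e ->]] := plane_span u0 keru vL pv bL.
  by apply: (hp_vanish_span hpsi) => z; rewrite PE P0 horner0.
by rewrite -PE scale0r addr0.
Qed.

(** In the chart [graph'] the parameter t = s * z contributes (s * z) ^+ k *: sec a against the
    height s ^+ k, whence the power of z. *)
Lemma kernel_poly : psi u = 0 ->
  exists P : {poly C}, [/\ forall z, psi (u + z ^+ k *: sec a) = P.[z], P != 0 & P.[0] = 0].
Proof.
move=> psiu; rewrite seca; have [P PE] := hp_line u v hpsi; exists (P \Po 'X^k); split.
- by move=> z; rewrite horner_comp hornerXn PE.
- apply: contraNneq psib => P0; apply/eqP.
  have [c [e ->]] := plane_span u0 keru vL pv bL.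
  rewrite addrC; apply: (hp_vanish_span hpsi) => z; rewrite PE.
  have [y <-] := root_exists z k0.
  by have := congr1 (fun P : {poly C} => P.[y]) P0; rewrite horner_comp hornerXn horner0.
- by rewrite horner_comp hornerXn expr0n gtn_eqF // -PE scale0r addr0.
Qed.

Lemma cone_section_transverse l : \val l = <[v]>%VS -> psi v = 0 -> tangent_cone S l.
Proof.
move=> lv psiv; have [P [PE Pn0 P0]] := transverse_poly psiv.
apply/(tangent_coneP _ lv) => eps eps0.
have e0 : 0 < Num.min eps (Num.min d1 dX) by rewrite !lt_min eps0 d10.
have [t [w [td _ fY Yd [c Yc]]]] := zeros_along hf hpsi Af0 df0 hfpsi k0 k0
  (graph_GH2 u hgam sec_lin) (graph0 u gam0 sec_lin)
  (graph_limit u A0 dl0 gamE sec_lin) PE Pn0 P0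
  (graph_close u A0 dl0 gamE sec_lin) e0.
move: td Yd Yc; rewrite !lt_min => /and3P[_ td _] /and3P[Ye _ Yx] /and3P[Yc _ _].
exists (graph u gam sec t w); split => //.
  apply: (mem_section td) => //; exact: p_graph.
by exists c; rewrite -seca.
Qed.

Lemma cone_section_kernel l : \val l = <[u]>%VS -> psi u = 0 -> tangent_cone S l.
Proof.
move=> lu psiu; have [P [PE Pn0 P0]] := kernel_poly psiu.
apply/(tangent_coneP _ lu) => eps eps0.
have e0 : 0 < Num.min eps (Num.min d1 dX) by rewrite !lt_min eps0 d10.
have [s [t [_ td fY Yd [c Yc]]]] := zeros_along hf hpsi Af0 df0 hfpsi (ltn0Sn 0) k0
  (graph'_GH2 u k hgam sec_lin) (graph'0 u k0 gam0 sec_lin)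
  (graph'_limit u A0 dl0 gamE sec_lin) PE Pn0 P0
  (graph'_close u k0 A0 dl0 gamE sec_lin) e0.
move: td Yd Yc; rewrite !lt_min => /and3P[_ td _] /and3P[Ye _ Yx] /and3P[Yc _ _].
exists (graph' u k gam sec s t); split => //; last by exists c.
apply: (mem_section td) => //.
have pu : p u = 0 by apply/eqP; rewrite -memv_ker keru memv_line.
by rewrite /graph' addrC linearP /= pu scaler0 add0r psec.
Qed.

(** Near 0 the section is the union of the zero sets of G1 and Z2. On the first the height is o(s ^+
    k), so it misses the points approaching l2; the second has no point in a narrow cone around l1,
    so it misses those approaching l1. *)
Lemma reducible_section (l1 l2 : projC R n.+1) : \val l1 = <[v]>%VS -> psi v = 0 ->
  tangent_cone S l1 -> tangent_cone S l2 -> proj_line L l2 -> l1 <> l2 ->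
  reducible_germ S.
Proof.
move=> l1v psiv Sl1 Sl2 l2L l12.
have pu : p u = 0 by apply/eqP; rewrite -memv_ker keru memv_line.
have [P [PE Pn0 P0]] := transverse_poly psiv.
have [q [zeta [Z2 [[hz hz0] hZ2 [d2 d20 FE] roots nonv]]]] :=
  weierstrass_along hf hpsi Af0 df0 hfpsi k0 k0
  (graph_GH2 u hgam sec_lin) (graph0 u gam0 sec_lin)
  (graph_limit u A0 dl0 gamE sec_lin) PE Pn0 P0.
have [h [hlin xE hu [Kh Kh0 hKh]]] := height_exists keru u0 sec_lin psec.
pose G1 (s w : C) := w ^+ q + \sum_(i < q) zeta i s * w ^+ i.
have hG1 : GH2 G1.
  apply: GHD; first by apply: GHX; exact: GH_coord.
  apply: GH_sum => i _; apply: GHM; first exact: hz.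
  by apply: GHX; exact: GH_coord.
pose br (G : C -> C -> C) :=
  [set x | exists s, [/\ s ^+ k = p x i0 0, p x = gam s & G s (h x) = 0]].
have [Kp Kp0 hKp] := lin_bound (fun c x y => linearP p c x y).
have hB x y : h (x - y) = h x - h y.
  have := hlin (-1) y x; rewrite scaleN1r mulN1r addrC => ->; by rewrite addrC.
have hZ c x : h (c *: x) = c * h x.
  have h00 : h 0 = 0 by have := hB 0 0; rewrite subr0 subrr.
  by have := hlin c x 0; rewrite !addr0 h00 addr0.
have graph_x s x : p x = gam s -> graph u gam sec s (h x) = x.
  by move=> px; rewrite /graph -px -xE.
have hv : h v = 0.
  have : h v *: u = 0.
    by apply: (addrI (sec (p v))); rewrite -xE pv seca addr0.
  by move/eqP; rewrite scaler_eq0 (negbTE u0) orbF => /eqP.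
pose ds := Num.min (Num.min dl d1) d2.
have ds0 : 0 < ds by rewrite !lt_min dl0 d10.
(* s ^+ k is a coordinate of p x, so a small x forces a small s. *)
have small_s s x (e : R) : s ^+ k = p x i0 0 -> 0 < e -> rn x < e ^+ k / Kp -> rn s < e.
  rewrite ltr_pdivlMr // mulrC => sk e0 xd; have : rn s ^+ k < e ^+ k.
    rewrite -rnX sk; apply: le_lt_trans xd; apply: le_trans (hKp _); exact: rn_coord.
  by rewrite ltr_pXn2r // nnegrE ?rn_ge0 // ltW.
have [da da0 hda] := arc_gam ds0.
exists (br G1), (br Z2); split.
- exact: (branch_analytic p i0 k0 hgam hlin hG1).
- exact: (branch_analytic p i0 k0 hgam hlin hZ2).
- apply/near0P; exists (Num.min (Num.min (d2 / Kh) (ds ^+ k / Kp)) (Num.min dX (da / Kp))).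
    by rewrite !lt_min dX0 !divr_gt0 // exprn_gt0.
  move=> x; rewrite !lt_min => /andP[/andP[x1 x2] /andP[x3 x4]].
  have hx : rn (h x) < d2 by apply: le_lt_trans (hKh x) _; rewrite mulrC -ltr_pdivlMr.
  split.
  + move=> [[t tr atx] Xx].
    have [|s sd gs] := hda t tr.
      by rewrite atx; apply: le_lt_trans (hKp x) _; rewrite mulrC -ltr_pdivlMr.
    move: sd; rewrite !lt_min => /andP[/andP[sl s1] s2].
    have pgs : p x = gam s by rewrite gs atx.
    have [sk _] := gamE sl; have fx : f x = 0 by apply/(fX x3).
    have := FE s (h x) s2 hx; rewrite graph_x // fx => /esym/eqP.
    by rewrite mulf_eq0 => /orP[/eqP z|/eqP z]; [left|right]; exists s; rewrite pgs.
  + move=> [][s [sk pgs z]]; have := small_s s x _ sk ds0 x2;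
    rewrite !lt_min => /andP[/andP[sl s1] s2]; apply: (mem_section s1 pgs x3);
    by rewrite -(graph_x s x pgs) FE // -/(G1 s (h x)) z ?mul0r ?mulr0.
- move=> /near0P[dn dn0 S1S].
  have le := proj_vpickE l2; set e := vpick (\val l2) in le.
  have eL : e \in L by rewrite memvE -le.
  have [c0 [g eE]] := plane_span u0 keru vL pv eL.
  have e0 : e != 0 := line_gen_neq0 le.
  (* With height 0 the generator of l2 would be a multiple of v, and l2 would equal l1. *)
  have g0 : g != 0.
    apply/eqP => g0; apply: l12; apply: val_inj.
    have ev : e = c0 *: v by rewrite eE g0 scale0r addr0.
    rewrite /= l1v le ev line_scale //.
    by apply: contraNneq e0 => c00; rewrite ev c00 scale0r.
  have he : h e = g.
    have := hlin c0 v (g *: u); rewrite -eE hZ hv hu => ->.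
    by rewrite mulr0 mulr1 add0r.
  have pe : p e i0 0 = c0.
    by rewrite eE linearP linearZ /= pu scaler0 addr0 pv mxE ai0 mulr1.
  have ng : 0 < rn g by rewrite rn_gt0.
  have c1 : 0 < rn c0 + 1 by rewrite ltr_wpDl // rn_ge0.
  (* On the zero set of G1, |c * h x| is at most e' * |c * s ^+ k|, where |c * s ^+ k| <= |c0| + 1,
     hence at most |g| / 4; yet c * h x lies within |g| / 4 of g. *)
  pose e' := rn g / 4 / (rn c0 + 1).
  have e'0 : 0 < e' by rewrite !divr_gt0.
  have [d3 d30 h3] := roots e' e'0.
  pose d4 := Num.min ds d3; have d40 : 0 < d4 by rewrite lt_min ds0.
  have /(tangent_coneP _ le) hS := Sl2.
  have [|x [Sx + [c]]] := hS (Num.min (Num.min dn (d4 ^+ k / Kp))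
      (Num.min (Num.min 1 (Kp^-1)) (rn g / 4 / Kh))).
    by rewrite !lt_min dn0 ltr01 invr_gt0 Kp0 !divr_gt0 // exprn_gt0.
  rewrite !lt_min => /andP[/andP[xn xp] _] /andP[_ /andP[/andP[_ cx1] cx2]].
  have [s [sk pgs z]] := (S1S x xn).2 Sx.
  have sd3 : rn s < d3.
    by have := small_s s x _ sk d40 xp; rewrite lt_min => /andP[].
  have hw : rn (h x) <= e' * rn s ^+ k.
    (* [roots] speaks of s != 0 only; at s = 0 the polynomial is w ^+ q, so the height vanishes. *)
    have [s0|sn0] := eqVneq s 0; last by have [_] := h3 s (ltac:(by rewrite rn_gt0 sn0)); apply.
    move: z; rewrite s0 /G1 big1 ?addr0 => [/eqP|i _]; last by rewrite hz0 mul0r.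
    rewrite expf_eq0 => /andP[_ /eqP ->].
    by rewrite rn0 mulr_ge0 ?exprn_ge0 ?rn_ge0 // ltW.
  have hd : rn (c * h x - g) <= rn g / 4.
    have -> : c * h x - g = h (c *: x - e) by rewrite hB hZ he.
    apply: le_trans (hKh _) _.
    by rewrite mulrC -ler_pdivlMr // ltW.
  have sd : rn (c * s ^+ k - c0) <= 1.
    have -> : c * s ^+ k - c0 = p (c *: x - e) i0 0.
      by rewrite linearB linearZ /= !mxE pe -sk.
    apply: le_trans (rn_coord _ _) _; apply: le_trans (hKp _) _.
    by rewrite mulrC -ler_pdivlMr // div1r ltW.
  have csk : rn (c * s ^+ k) <= rn c0 + 1.
    by rewrite -(subrK c0 (c * s ^+ k)) addrC; apply: le_trans (rnD _ _) _; rewrite lerD2l.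
  have chx : rn (c * h x) <= rn g / 4.
    rewrite rnM; apply: (@le_trans _ _ (e' * rn (c * s ^+ k))).
      rewrite rnM rnX mulrCA; apply: ler_wpM2l; [exact: rn_ge0 | exact: hw].
    apply: (@le_trans _ _ (e' * (rn c0 + 1))); first by rewrite ler_pM2l.
    by rewrite /e' divfK // gt_eqF.
  have := rnB (c * h x) (c * h x - g); rewrite opprB addrC subrK => gg.
  have := le_trans gg (lerD chx hd); rewrite leNgt => /negP; apply.
  by rewrite -mulrDl ltr_pdivrMr // -mulr2n -[ltLHS]mulr_natr ltr_pM2l // ltr_nat.
- move=> /near0P[dn dn0 S2S].
  have [e e0 [d3 d30 h3]] := nonv.
  pose d4 := Num.min ds d3; have d40 : 0 < d4 by rewrite lt_min ds0.
  have /(tangent_coneP _ l1v) hS := Sl1.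
  (* The bounds give |c * s ^+ k| >= 1/2 and |c * h x| <= e / 2, hence |h x| <= e * |s| ^+ k, where
     Z2 has no zero. *)
  have [|x [Sx + [c]]] := hS (Num.min (Num.min dn (d4 ^+ k / Kp))
      (Num.min (2^-1 / Kp) (e / 2 / Kh))).
    by rewrite !lt_min dn0 !divr_gt0 // ?exprn_gt0 // invr_gt0.
  rewrite !lt_min => /andP[/andP[xn xp] _] /andP[_ /andP[cx1 cx2]].
  have [s [sk pgs z]] := (S2S x xn).2 Sx.
  have sd3 : rn s < d3.
    by have := small_s s x _ sk d40 xp; rewrite lt_min => /andP[].
  have chx : rn c * rn (h x) <= e / 2.
    rewrite -rnM -[c * h x]subr0 -hv -hZ -hB; apply: le_trans (hKh _) _.
    by rewrite mulrC -ler_pdivlMr // ltW.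
  have csk : 2^-1 <= rn c * rn s ^+ k.
    have : rn (c * s ^+ k - 1) <= 2^-1.
      have -> : c * s ^+ k - 1 = p (c *: x - v) i0 0.
        by rewrite linearB linearZ /= !mxE pv ai0 -sk.
      apply: le_trans (rn_coord _ _) _; apply: le_trans (hKp _) _.
      by rewrite mulrC -ler_pdivlMr // ltW.
    have := rnB (c * s ^+ k) (c * s ^+ k - 1); rewrite opprB addrC subrK rn1 rnM rnX.
    by lra.
  have cs0 : 0 < rn c * rn s ^+ k by apply: lt_le_trans csk; rewrite invr_gt0.
  have c0 : 0 < rn c.
    by rewrite lt_def rn_ge0 andbT; apply: contraTneq cs0 => ->; rewrite mul0r ltxx.
  have s0 : 0 < rn s.
    rewrite lt_def rn_ge0 andbT; apply: contraTneq cs0 => ->.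
    by rewrite expr0n gtn_eqF // mulr0 ltxx.
  have := h3 s (h x); rewrite s0 sd3 z eqxx => /(_ isT) H; apply: (notF (H _)).
  rewrite -(ler_pM2l c0); apply: le_trans chx _.
  by rewrite mulrCA; apply: ler_wpM2l => //; exact: ltW.
Qed.

End Transverse.

Lemma cone_section_eq : tangent_cone S = tangent_cone X `&` proj_line L.
Proof.
apply/seteqP; split; first exact: cone_sectionS.
move=> l [lX lL]; have le := proj_vpickE l; set e := vpick (\val l) in le.
have fX0 x : rn x < Num.min df dX -> X x -> f x = 0.
  by rewrite lt_min => /andP[_ xd] /(fX xd).
have psie g : \val l = <[g]>%VS -> psi g = 0.
  move=> lg; apply: (@tangent_cone_initial R _ f psi m B Af (Num.min df dX) X l g) => //.
    by rewrite lt_min df0.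
  by move=> x; rewrite lt_min => /andP[xd _]; exact: hfpsi.
have eL : e \in L by rewrite memvE -le.
have [u u0 keru] := kernel_line.
have [v0 v0L pv0] := arc_direction.
have [c [g eE]] := plane_span u0 keru v0L pv0 eL.
have pu : p u = 0 by apply/eqP; rewrite -memv_ker keru memv_line.
have e0 := line_gen_neq0 le.
(* For c = 0 the line is the kernel and the second chart applies; otherwise dividing by c makes its
   generator project to a. *)
have [c0|c0] := eqVneq c 0.
  have eu : e = g *: u by rewrite eE c0 scale0r add0r.
  have lu : \val l = <[u]>%VS.
    by rewrite le eu line_scale //; apply: contraNneq e0 => g0; rewrite eu g0 scale0r.
  have [sec [sl ps sa]] := section_exists pv0.
  exact: (cone_section_kernel u0 keru v0L pv0 sl ps sa lu (psie u lu)).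
pose v := c^-1 *: e.
have pv : p v = a.
  by rewrite /v eE linearZ /= linearP linearZ /= pu scaler0 addr0 pv0 scalerA mulVf // scale1r.
have lv : \val l = <[v]>%VS by rewrite le /v line_scale // invr_eq0.
have vL : v \in L by rewrite memvZ.
have [sec [sl ps sa]] := section_exists pv.
exact: (cone_section_transverse u0 keru vL pv sl ps sa lv (psie v lv)).
Qed.

Lemma section_reducible (l1 l2 : projC R n.+1) :
  (tangent_cone X `&` proj_line L) l1 -> (tangent_cone X `&` proj_line L) l2 -> l1 <> l2 ->
  reducible_germ S.
Proof.
have [u u0 keru] := kernel_line.
have pu : p u = 0 by apply/eqP; rewrite -memv_ker keru memv_line.
have [v0 v0L pv0] := arc_direction.
have main (l l' : projC R n.+1) : (tangent_cone X `&` proj_line L) l ->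
    (tangent_cone X `&` proj_line L) l' -> l <> l' -> \val l != <[u]>%VS -> reducible_germ S.
  move=> Tl Tl' ll' lu; have [lX lL] := Tl.
  have le := proj_vpickE l; set e := vpick (\val l) in le.
  have eL : e \in L by rewrite memvE -le.
  have e0 := line_gen_neq0 le.
  have [c [g eE]] := plane_span u0 keru v0L pv0 eL.
  have c0 : c != 0.
    apply: contraNneq lu => c0; have eu : e = g *: u by rewrite eE c0 scale0r add0r.
    rewrite le eu line_scale //; apply: contraNneq e0 => g0; by rewrite eu g0 scale0r.
  pose v := c^-1 *: e.
  have pv : p v = a.
    by rewrite /v eE linearZ /= linearP linearZ /= pu scaler0 addr0 pv0 scalerA mulVf // scale1r.
  have lv : \val l = <[v]>%VS by rewrite le /v line_scale // invr_eq0.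
  have vL : v \in L by rewrite memvZ.
  have psiv : psi v = 0.
    apply: (@tangent_cone_initial R _ f psi m B Af (Num.min df dX) X l v) => //.
    - by rewrite lt_min df0.
    - by move=> x; rewrite lt_min => /andP[xd _]; exact: hfpsi.
    - by move=> x; rewrite lt_min => /andP[_ xd] /(fX xd).
  have [sec [sl ps sa]] := section_exists pv.
  apply: (reducible_section u0 keru vL pv sl ps sa lv psiv _ _ _ ll').
  - by rewrite cone_section_eq.
  - by rewrite cone_section_eq.
  - by case: Tl'.
(* At most one of the two lines is the kernel, so the other can serve as the transverse one. *)
move=> T1 T2 l12; have [l1u|l1u] := eqVneq (\val l1) <[u]>%VS; last exact: (main l1 l2).
apply: (main l2 l1) => //; first exact: nesym.
by apply/eqP => l2u; apply: l12; apply: val_inj; rewrite /= l1u l2u.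
Qed.

End ArcSection.

Local Close Scope complex_scope.

Theorem lemma4p1 (R : realType) (n : nat)
    (X : set 'cV[Cplx R]_n.+1) (p : 'Hom('cV[Cplx R]_n.+1, 'cV[Cplx R]_n))
    (L : {vspace 'cV[Cplx R]_n.+1})
    (alpha : Cplx R -> 'cV[Cplx R]_n) (r : R) :
  hypersurface_germ X ->
  limg p = fullv ->
  finite_germ X p ->
  \dim L = 2%N ->
  (lker p <= L)%VS ->
  tangent_cone X `&` proj_line L `<=`
    isolated (tangent_cone X `&` proj_line L) ->
  is_arc alpha ->
  arc_disk X p alpha r ->
  tangent_cone (alpha @` disk r) = proj_image p L ->
  tangent_cone (arc_section X p alpha r) = tangent_cone X `&` proj_line L /\
  ((exists l m, [/\ (tangent_cone X `&` proj_line L) l,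
                    (tangent_cone X `&` proj_line L) m & l <> m]) ->
   reducible_germ (arc_section X p alpha r)).
Proof.
move=> [f [hf _ fn0 fX]] limp _ dimL kerL iso [al0 _] [r0 harc _] cone_arc.
have {}hf := holo_germ_GH hf.
have [m [B [psi [hpsi psi0 [Af [Af0 [df df0 hfpsi]]]]]]] := initial_form hf fn0.
have [dX dX0 {}fX] := (near0P _).1 fX.
have [k [i0 [a [gam [[k0 ai0] [gam0 hgam] [A [A0 [dl dl0 gamE]]] [d1 d10 gam_arc] arc_gam]]]]] :=
  arc_normal_form r0 al0 harc.
(* Isolatedness enters the argument here, and from now on only through the vector b. *)
have [b bL psib] := initial_form_on_plane hf hpsi Af0 df0 hfpsi dX0
  (fun x xd => (fX x xd).2) psi0 dimL iso.
split.
  exact: (cone_section_eq limp dimL kerL hf hpsi Af0 df0 hfpsi dX0 fX k0 ai0 gam0 hgam A0 dl0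
    gamE d10 gam_arc cone_arc bL psib).
move=> [l1 [l2 [T1 T2 l12]]].
exact: (section_reducible limp dimL kerL hf hpsi Af0 df0 hfpsi dX0 fX k0 ai0 gam0 hgam A0 dl0
    gamE d10 gam_arc arc_gam cone_arc bL psib T1 T2 l12).
Qed.
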